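(* Let $K_1\subset\mathbb C$ and $K_2\subset\mathbb C^m$ be compact sets such that $\overline{\mathcal O}(K_1)=A_D(K_1)$ and $\overline{\mathcal O}(K_2)=A_D(K_2)$. Then \[ \overline{\mathcal O}(K_1\times K_2)=A_D(K_1\times K_2). \]
   Context: For a compact $K\subset\mathbb C^n$: $\overline{\mathcal O}(K)$ is the closure in $C(K)$ (supremum norm) of the restrictions to $K$ of functions holomorphic on some open neighbourhood of $K$ (depending on the function); $A_D(K)$ is the set of continuous functions $f:K\to\mathbb C$ such that for every open disc $D\subset\mathbb C$ and every injective holomorphic mapping $\phi:D\to\mathbb C^n$ with $\phi(D)\subset K$, the composition $f\circ\phi$ is holomorphic on $D$. For planar compact sets $A_D$ coincides with $A$, the algebra of continuous functions holomorphic on the interior. *)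

(* Defs.v *)
From Stdlib Require Import Reals.
From Stdlib Require Fin.
Open Scope R_scope.

Definition C : Type := (R * R)%type.
Definition C0 : C := (0, 0).
Definition Cadd (z w : C) : C := (fst z + fst w, snd z + snd w).
Definition Copp (z : C) : C := (- fst z, - snd z).
Definition Csub (z w : C) : C := Cadd z (Copp w).
Definition Cmul (z w : C) : C :=
  (fst z * fst w - snd z * snd w, fst z * snd w + snd z * fst w).
Definition Cmod (z : C) : R := sqrt (fst z ^ 2 + snd z ^ 2).

Definition Cn (n : nat) : Type := Fin.t n -> C.

Definition vadd {n} (z h : Cn n) : Cn n := fun i => Cadd (z i) (h i).

Fixpoint Csum (n : nat) : (Fin.t n -> C) -> C :=
  match n with
  | O => fun _ => C0
  | S k => fun f => Cadd (f Fin.F1) (Csum k (fun i => f (Fin.FS i)))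
  end.

Fixpoint vnorm (n : nat) : (Fin.t n -> C) -> R :=
  match n with
  | O => fun _ => 0
  | S k => fun f => Rmax (Cmod (f Fin.F1)) (vnorm k (fun i => f (Fin.FS i)))
  end.

Definition vdist {n} (z w : Cn n) : R := vnorm n (fun i => Csub (z i) (w i)).

Definition is_open {n} (U : Cn n -> Prop) : Prop :=
  forall z, U z -> exists r, 0 < r /\ forall w, vdist w z < r -> U w.

Definition is_closed {n} (K : Cn n -> Prop) : Prop :=
  forall z, (forall r, 0 < r -> exists w, K w /\ vdist w z < r) -> K z.

Definition is_bounded {n} (K : Cn n -> Prop) : Prop :=
  exists M, forall z, K z -> vnorm n z <= M.

(* compact subsets of C^n (Heine-Borel) *)
Definition is_compact {n} (K : Cn n -> Prop) : Prop :=
  is_closed K /\ is_bounded K.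

Definition subset {n} (A B : Cn n -> Prop) : Prop := forall z, A z -> B z.

Definition continuous_on {n} (K : Cn n -> Prop) (f : Cn n -> C) : Prop :=
  forall z, K z -> forall eps, 0 < eps -> exists delta, 0 < delta /\
    forall w, K w -> vdist w z < delta -> Cmod (Csub (f w) (f z)) < eps.

Definition Cdiff {n} (f : Cn n -> C) (z : Cn n) : Prop :=
  exists a : Fin.t n -> C, forall eps, 0 < eps -> exists delta, 0 < delta /\
    forall h : Cn n, vnorm n h < delta ->
      Cmod (Csub (Csub (f (vadd z h)) (f z)) (Csum n (fun i => Cmul (a i) (h i))))
        <= eps * vnorm n h.

Definition holomorphic_on {n} (U : Cn n -> Prop) (f : Cn n -> C) : Prop :=
  forall z, U z -> Cdiff f z.

Definition Cdiff1 (g : C -> C) (z : C) : Prop :=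
  exists a : C, forall eps, 0 < eps -> exists delta, 0 < delta /\
    forall h : C, Cmod h < delta ->
      Cmod (Csub (Csub (g (Cadd z h)) (g z)) (Cmul a h)) <= eps * Cmod h.

Definition disc (c : C) (r : R) : C -> Prop := fun z => Cmod (Csub z c) < r.

Definition holomorphic1_on (D : C -> Prop) (g : C -> C) : Prop :=
  forall z, D z -> Cdiff1 g z.

(* \overline{O}(K): closure in C(K) (sup norm) of restrictions to K of
   functions holomorphic on some open neighbourhood of K *)
Definition in_Obar {n} (K : Cn n -> Prop) (f : Cn n -> C) : Prop :=
  continuous_on K f /\
  forall eps, 0 < eps -> exists (U : Cn n -> Prop) (g : Cn n -> C),
    is_open U /\ subset K U /\ holomorphic_on U g /\
    forall z, K z -> Cmod (Csub (f z) (g z)) <= eps.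

Definition in_AD {n} (K : Cn n -> Prop) (f : Cn n -> C) : Prop :=
  continuous_on K f /\
  forall (c : C) (r : R) (phi : C -> Cn n),
    0 < r ->
    (forall i, holomorphic1_on (disc c r) (fun t => phi t i)) ->
    (forall t s, disc c r t -> disc c r s -> (forall i, phi t i = phi s i) -> t = s) ->
    (forall t, disc c r t -> K (phi t)) ->
    holomorphic1_on (disc c r) (fun t => f (phi t)).

Definition prodK {m} (K1 : Cn 1 -> Prop) (K2 : Cn m -> Prop) : Cn (S m) -> Prop :=
  fun z => K1 (fun _ : Fin.t 1 => z Fin.F1) /\ K2 (fun j => z (Fin.FS j)).

(* Main.v *)
Require Import Defs.
From Stdlib Require Import Reals Lra Lia Psatz ClassicalEpsilon FunctionalExtensionality.
From Stdlib Require Cantor.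
From Coquelicot Require Import Coquelicot.
Open Scope R_scope.

(* That the left side is contained in the right one is the chain rule together with Weierstrass' theorem on uniform
   limits. For the converse it suffices that A(K_1) has the approximation property, with explicit finite-rank operators,
   since these can be applied to f(., w) uniformly in w. Extend f(., w) to the plane linearly in f (Dugundji) and split it
   with Vitushkin's localization operators T_j along a grid of mesh 2^-N; each piece T_j f is continuous, holomorphic
   where f is and outside a square of side 2^(1-N), and bounded by a constant times the oscillation omega of f there.
   Replace T_j f by a combination of three functions T_j G with the same three leading coefficients at infinity. Choosing
   the G successively as near-extremal for these coefficients keeps the combination bounded by a constant times omega, so
   no comparison of analytic capacities is needed. The error of piece j decays like (distance / 2^-N)^-4, and the errors
   sum to a constant times omega. The functions T_j G lie in A_D(K_1) and their coefficients, being integrals of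
   f(., w), lie in A_D(K_2). *)

(** Approximating each slice [f(., w)] by itself does not suffice: the approximants must depend on w
    through finitely many functions in A_D(K_2). This dictates linearity in f at every stage; the
    functions G and the matrix that turns moments into coefficients depend on the grid cell only,
    never on w. In Vitushkin's theorem the substitutes for T_j f must be holomorphic near K_1, which
    forces a comparison of two capacities. Here they only have to lie in A(K_1), the class of f
    itself, so the extremal problem is posed inside that class, and the hypothesis on K_1 is applied
    afterwards, to T_j G. Matching two coefficients would leave errors of order distance^-3, still
    summable over a planar grid; the third gives order -4, which is dominated by a product of two
    one-variable kernels with telescoping majorants. Holomorphy is treated weakly, by integration
    against dbar derivatives of test functions: this form passes to uniform limits and admits
    localized truncated Cauchy kernels as tests. *)

Definition cont_at (f : C -> C) (z : C) : Prop :=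
  forall eps, 0 < eps -> exists delta, 0 < delta /\
    forall w, Cmod (w - z) < delta -> Cmod (f w - f z) < eps.

(** * Squares and bisection *)

Definition insq (a b l : R) (z : C) : Prop :=
  a <= fst z <= a + l /\ b <= snd z <= b + l.

Lemma C_ext (z w : C) : fst z = fst w -> snd z = snd w -> z = w.
Proof. destruct z, w; simpl; intros; subst; reflexivity. Qed.

Ltac cring := apply C_ext; simpl; ring.

Lemma Cmod_fst (z : C) : Rabs (fst z) <= Cmod z.
Proof. eapply Rle_trans; [apply Rmax_l | apply Rmax_Cmod]. Qed.

Lemma Cmod_snd (z : C) : Rabs (snd z) <= Cmod z.
Proof. eapply Rle_trans; [apply Rmax_r | apply Rmax_Cmod]. Qed.

Lemma Cmod_le_abs (z : C) : Cmod z <= Rabs (fst z) + Rabs (snd z).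
Proof.
  unfold Cmod. apply Rsqr_incr_0_var.
  2: { generalize (Rabs_pos (fst z)), (Rabs_pos (snd z)); lra. }
  rewrite Rsqr_sqrt by nra.
  unfold Rsqr. generalize (Rabs_pos (fst z)), (Rabs_pos (snd z)).
  rewrite <- (pow2_abs (fst z)), <- (pow2_abs (snd z)). nra.
Qed.

Lemma Cmod_le_max (z : C) (r : R) : Rabs (fst z) <= r -> Rabs (snd z) <= r -> Cmod z <= 2 * r.
Proof. intros; generalize (Cmod_le_abs z); lra. Qed.

Lemma Cmod_sub_sym (z w : C) : Cmod (z - w) = Cmod (w - z).
Proof. rewrite <- Cmod_opp. f_equal. cring. Qed.

Lemma Cmod_sub_triangle (z w t : C) : Cmod (z - t) <= Cmod (z - w) + Cmod (w - t).
Proof. replace (z - t)%C with ((z - w) + (w - t))%C by cring. apply Cmod_triangle. Qed.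

Lemma Cmod_le_sub (z w : C) : Cmod z <= Cmod (z - w) + Cmod w.
Proof. replace z with ((z - w) + w)%C at 1 by cring. apply Cmod_triangle. Qed.

Lemma Cmod_subself (z : C) : Cmod (z - z) = 0.
Proof. replace (z - z)%C with (RtoC 0) by cring. apply Cmod_0. Qed.

Lemma Rlt_div_mult (x e b : R) : 0 < b -> x < e / b -> b * x < e.
Proof.
  intros Hb Hx. replace e with (b * (e / b)) by (field; lra). apply Rmult_lt_compat_l; assumption.
Qed.

Lemma insq_mod a b l z w : insq a b l z -> insq a b l w -> Cmod (w - z) <= 2 * l.
Proof. unfold insq. intros Hz Hw. apply Cmod_le_max; simpl; apply Rabs_le; lra. Qed.

(** Cousin's lemma: if the property failed, repeated quartering would give nested bad squares
    shrinking to a point, where the local hypothesis contradicts badness. It replaces finite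
    subcovers for uniform continuity, Green's formula and Riemann sums alike. *)
Lemma cousin_square (P : R -> R -> R -> Prop) (a b l : R) : 0 < l ->
  (forall a b l, 0 < l -> P a b (l / 2) -> P (a + l / 2) b (l / 2) ->
     P a (b + l / 2) (l / 2) -> P (a + l / 2) (b + l / 2) (l / 2) -> P a b l) ->
  (forall z, insq a b l z -> exists delta, 0 < delta /\
     forall a' b' l', 0 < l' < delta -> insq a' b' l' z -> P a' b' l') ->
  P a b l.
Proof.
  intros Hl Hsub Hloc. apply NNPP; intro HN.
  (* The premises inside the relation make it hold vacuously at good squares. Hence every triple has
     a successor and the iteration runs on plain triples. *)
  set (step := fun (t s : R * R * R) =>
    let '(x, y, h) := t in let '(x', y', h') := s in
    0 < h -> ~ P x y h -> ~ P x' y' h' /\ h' = h / 2 /\ x <= x' <= x + h / 2 /\ y <= y' <= y + h / 2).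
  assert (Hst : forall t, exists s, step t s).
  { intros [[x y] h]. unfold step.
    destruct (classic (0 < h /\ ~ P x y h)) as [[Hh HP]|Hn].
    2: { exists (x, y, h). intros. exfalso. tauto. }
    destruct (classic (P x y (h / 2))) as [H1|H1];
      [|exists (x, y, h / 2); intros; repeat split; try assumption; try lra].
    destruct (classic (P (x + h / 2) y (h / 2))) as [H2|H2];
      [|exists (x + h / 2, y, h / 2); intros; repeat split; try assumption; try lra].
    destruct (classic (P x (y + h / 2) (h / 2))) as [H3|H3];
      [|exists (x, y + h / 2, h / 2); intros; repeat split; try assumption; try lra].
    destruct (classic (P (x + h / 2) (y + h / 2) (h / 2))) as [H4|H4];
      [|exists (x + h / 2, y + h / 2, h / 2); intros; repeat split; try assumption; try lra].
    exfalso. apply HP. apply Hsub; assumption. }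
  set (nxt := fun t => proj1_sig (constructive_indefinite_description _ (Hst t))).
  assert (Hnxt : forall t, step t (nxt t)).
  { intro t. unfold nxt. apply (proj2_sig (constructive_indefinite_description _ (Hst t))). }
  set (sq := fix sq (n : nat) := match n with O => (a, b, l) | S k => nxt (sq k) end).
  set (A := fun n => fst (fst (sq n))). set (B := fun n => snd (fst (sq n))).
  assert (Hsq : forall n, ~ P (A n) (B n) (l / 2 ^ n) /\ snd (sq n) = l / 2 ^ n).
  { induction n as [|n [IH1 IH2]].
    - unfold A, B; simpl. replace (l / 1) with l by field. split; [exact HN|reflexivity].
    - specialize (Hnxt (sq n)). unfold A, B in *. simpl sq.
      destruct (sq n) as [[x y] h] eqn:E1. destruct (nxt (x, y, h)) as [[x' y'] h'] eqn:E2.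
      simpl in *. subst h. destruct Hnxt as (H1 & H2 & _); [|exact IH1|].
      { apply Rdiv_lt_0_compat; [lra|apply pow_lt; lra]. }
      rewrite H2 in *. replace (l / (2 * 2 ^ n)) with (l / 2 ^ n / 2); [split; [exact H1|reflexivity]|].
      field. apply pow_nonzero; lra. }
  assert (Hpos : forall n, 0 < l / 2 ^ n).
  { intro; apply Rdiv_lt_0_compat; [lra|apply pow_lt; lra]. }
  assert (Hmono : forall n, A n <= A (S n) <= A n + l / 2 ^ n / 2 /\ B n <= B (S n) <= B n + l / 2 ^ n / 2).
  { intro n. destruct (Hsq n) as [H1 H2]. specialize (Hnxt (sq n)). unfold A, B in *. simpl sq.
    destruct (sq n) as [[x y] h] eqn:E1. destruct (nxt (x, y, h)) as [[x' y'] h'] eqn:E2.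
    simpl in *. subst h. destruct Hnxt as (_ & _ & H3 & H4); [apply Hpos|exact H1|]. split; assumption. }
  assert (Hhalf : forall n, l / 2 ^ (S n) = l / 2 ^ n / 2).
  { intro n; simpl; field; apply pow_nonzero; lra. }
  assert (Hnest : forall n k, A n <= A (n + k)%nat /\ A (n + k)%nat + l / 2 ^ (n + k) <= A n + l / 2 ^ n
     /\ B n <= B (n + k)%nat /\ B (n + k)%nat + l / 2 ^ (n + k) <= B n + l / 2 ^ n).
  { intros n k; induction k as [|k IH].
    - rewrite Nat.add_0_r; lra.
    - rewrite Nat.add_succ_r. specialize (Hmono (n + k)%nat). rewrite Hhalf. lra. }
  assert (Hcross : forall n m, A m <= A n + l / 2 ^ n /\ B m <= B n + l / 2 ^ n).
  { intros n m. destruct (Nat.le_ge_cases n m) as [Hm|Hm].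
    - replace m with (n + (m - n))%nat by lia. specialize (Hnest n (m - n)%nat).
      specialize (Hpos (n + (m - n))%nat). lra.
    - specialize (Hnest m (n - m)%nat). replace (m + (n - m))%nat with n in Hnest by lia.
      specialize (Hpos n). lra. }
  destruct (completeness (fun x => exists n, x = A n)) as [x [Hx1 Hx2]].
  { exists (A O + l / 2 ^ 0). intros x [n ->]. apply Hcross. }
  { exists (A O), O; reflexivity. }
  destruct (completeness (fun x => exists n, x = B n)) as [y [Hy1 Hy2]].
  { exists (B O + l / 2 ^ 0). intros y [n ->]. apply Hcross. }
  { exists (B O), O; reflexivity. }
  assert (Hin : forall n, insq (A n) (B n) (l / 2 ^ n) (x, y)).
  { intro n; unfold insq; simpl. repeat split.
    - apply Hx1; exists n; reflexivity.
    - apply Hx2. intros ? [m ->]. apply Hcross.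
    - apply Hy1; exists n; reflexivity.
    - apply Hy2. intros ? [m ->]. apply Hcross. }
  destruct (Hloc (x, y)) as (d & Hd & HP).
  { specialize (Hin O). unfold A, B in Hin; simpl in Hin. replace (l / 1) with l in Hin by field. exact Hin. }
  destruct (pow_lt_1_zero (/ 2)) with (y := d / l) as [n Hn].
  { rewrite Rabs_right; lra. }
  { apply Rdiv_lt_0_compat; lra. }
  apply (proj1 (Hsq n)). apply HP; [|apply Hin]. split; [apply Hpos|].
  specialize (Hn n (le_n _)). rewrite pow_inv in Hn. rewrite Rabs_right in Hn.
  2: { left. apply Rinv_0_lt_compat, pow_lt; lra. }
  apply (Rmult_lt_compat_l l) in Hn; [|lra]. unfold Rdiv in *.
  replace (l * (d * / l)) with d in Hn by (field; lra). exact Hn.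
Qed.

(** [P d z] is to be read as: the radius d works at z. As smaller radii work too, the minimum over
    four quarters serves the whole square. *)
Lemma cousin_uniform (P : R -> C -> Prop) (a b l : R) : 0 < l ->
  (forall d d' z, 0 < d' <= d -> P d z -> P d' z) ->
  (forall z, insq a b l z -> exists r d, 0 < r /\ 0 < d /\ forall t, Cmod (t - z) < r -> P d t) ->
  exists d, 0 < d /\ forall z, insq a b l z -> P d z.
Proof.
  intros Hl Hmono Hloc.
  apply (cousin_square (fun a b l => exists d, 0 < d /\ forall z, insq a b l z -> P d z)); [exact Hl| |].
  - intros a' b' l' Hl' (d1 & P1 & H1) (d2 & P2 & H2) (d3 & P3 & H3) (d4 & P4 & H4).
    set (d := Rmin (Rmin d1 d2) (Rmin d3 d4)).
    assert (Hd : 0 < d) by (repeat apply Rmin_glb_lt; assumption).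
    generalize (Rmin_l (Rmin d1 d2) (Rmin d3 d4)), (Rmin_r (Rmin d1 d2) (Rmin d3 d4)),
      (Rmin_l d1 d2), (Rmin_r d1 d2), (Rmin_l d3 d4), (Rmin_r d3 d4); fold d; intros.
    exists d. split; [exact Hd|]. intros z [Hz1 Hz2].
    destruct (Rle_dec (fst z) (a' + l' / 2)); destruct (Rle_dec (snd z) (b' + l' / 2)).
    + apply (Hmono d1); [lra|]. apply H1; unfold insq; lra.
    + apply (Hmono d3); [lra|]. apply H3; unfold insq; lra.
    + apply (Hmono d2); [lra|]. apply H2; unfold insq; lra.
    + apply (Hmono d4); [lra|]. apply H4; unfold insq; lra.
  - intros z Hz. destruct (Hloc z Hz) as (r & d & Hr & Hd & H). exists (r / 2). split; [lra|].
    intros a' b' l' Hl' Hz'. exists d. split; [exact Hd|]. intros t Ht. apply H.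
    generalize (insq_mod _ _ _ _ _ Hz' Ht). lra.
Qed.

Lemma heine_square (f : C -> C) (a b l eps : R) : 0 < l -> 0 < eps ->
  (forall z, insq a b l z -> cont_at f z) ->
  exists delta, 0 < delta /\ forall z w, insq a b l z -> Cmod (w - z) < delta -> Cmod (f w - f z) < eps.
Proof.
  intros Hl He Hc.
  destruct (cousin_uniform (fun d z => forall w, Cmod (w - z) < d -> Cmod (f w - f z) < eps) a b l Hl) as (d & Hd & H).
  - intros d d' z Hd H w Hw. apply H. lra.
  - intros z Hz. destruct (Hc z Hz (eps / 2)) as (d & Hd & Hf); [lra|].
    exists (d / 2), (d / 2). repeat split; [lra|lra|]. intros t Ht w Hw.
    assert (A := Hf t ltac:(lra)). assert (B := Hf w ltac:(generalize (Cmod_sub_triangle w t z); lra)).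
    generalize (Cmod_sub_triangle (f w) (f z) (f t)). rewrite (Cmod_sub_sym (f z)). lra.
  - exists d. split; [exact Hd|]. intros z w Hz Hw. apply H; assumption.
Qed.

(** A bound on f is encoded as a radius: d works at z when d |f z| <= 1, and a uniform d gives the
    bound 1 / d. *)
Lemma bounded_on_square (f : C -> C) (a b l : R) : 0 < l ->
  (forall z, insq a b l z -> cont_at f z) ->
  exists M, forall z, insq a b l z -> Cmod (f z) <= M.
Proof.
  intros Hl Hc.
  destruct (cousin_uniform (fun d z => d * Cmod (f z) <= 1) a b l Hl) as (d & Hd & H).
  - intros d d' z Hd H. generalize (Cmod_ge_0 (f z)). nra.
  - intros z Hz. destruct (Hc z Hz 1) as (d & Hd & Hf); [lra|].
    assert (P : 0 < Cmod (f z) + 1) by (generalize (Cmod_ge_0 (f z)); lra).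
    exists d, (/ (Cmod (f z) + 1)). repeat split; [exact Hd|apply Rinv_0_lt_compat, P|]. intros t Ht.
    apply Rmult_le_reg_l with (Cmod (f z) + 1); [exact P|]. rewrite <- Rmult_assoc, Rinv_r by lra.
    generalize (Cmod_le_sub (f t) (f z)), (Hf t Ht). lra.
  - exists (/ d). intros z Hz. apply Rmult_le_reg_l with d; [exact Hd|]. rewrite Rinv_r by lra. apply H, Hz.
Qed.

(** * Complex-valued integrals *)

Definition cint (g : R -> C) (a b : R) : C :=
  (RInt (fun t => fst (g t)) a b, RInt (fun t => snd (g t)) a b).

Definition rcont (g : R -> C) : Prop :=
  forall t eps, 0 < eps -> exists delta, 0 < delta /\
    forall s, Rabs (s - t) < delta -> Cmod (g s - g t) < eps.

Lemma rcont_fst g : rcont g -> forall t, continuous (fun s => fst (g s)) t.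
Proof.
  intros H t. apply continuity_pt_filterlim. intros eps He.
  destruct (H t eps He) as (d & Hd & Hg). exists d; split; [exact Hd|].
  intros s [_ Hs]. simpl in *. unfold R_dist in *.
  eapply Rle_lt_trans; [|apply Hg, Hs]. apply (Cmod_fst (g s - g t)).
Qed.

Lemma rcont_snd g : rcont g -> forall t, continuous (fun s => snd (g s)) t.
Proof.
  intros H t. apply continuity_pt_filterlim. intros eps He.
  destruct (H t eps He) as (d & Hd & Hg). exists d; split; [exact Hd|].
  intros s [_ Hs]. simpl in *. unfold R_dist in *.
  eapply Rle_lt_trans; [|apply Hg, Hs]. apply (Cmod_snd (g s - g t)).
Qed.

Lemma rcont_ex_fst g a b : rcont g -> ex_RInt (fun s => fst (g s)) a b.
Proof. intros H. apply (ex_RInt_continuous (V := R_CompleteNormedModule)). intros; apply rcont_fst, H. Qed.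

Lemma rcont_ex_snd g a b : rcont g -> ex_RInt (fun s => snd (g s)) a b.
Proof. intros H. apply (ex_RInt_continuous (V := R_CompleteNormedModule)). intros; apply rcont_snd, H. Qed.

Lemma rcont_plus f g : rcont f -> rcont g -> rcont (fun t => f t + g t)%C.
Proof.
  intros Hf Hg t eps He. destruct (Hf t (eps / 2)) as (d1 & P1 & H1); [lra|].
  destruct (Hg t (eps / 2)) as (d2 & P2 & H2); [lra|].
  exists (Rmin d1 d2); split; [apply Rmin_glb_lt; assumption|]. intros s Hs.
  replace (f s + g s - (f t + g t))%C with ((f s - f t) + (g s - g t))%C by cring.
  eapply Rle_lt_trans; [apply Cmod_triangle|].
  generalize (H1 s (Rlt_le_trans _ _ _ Hs (Rmin_l _ _))), (H2 s (Rlt_le_trans _ _ _ Hs (Rmin_r _ _))). lra.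
Qed.

Lemma rcont_scal (c : C) f : rcont f -> rcont (fun t => c * f t)%C.
Proof.
  intros Hf t eps He. assert (Hp : 0 < Cmod c + 1) by (generalize (Cmod_ge_0 c); lra).
  destruct (Hf t (eps / (Cmod c + 1))) as (d1 & P1 & H1).
  { apply Rdiv_lt_0_compat; assumption. }
  exists d1; split; [assumption|]. intros s Hs.
  replace (c * f s - c * f t)%C with (c * (f s - f t))%C by cring. rewrite Cmod_mult.
  specialize (H1 s Hs). apply Rlt_div_mult in H1; [|lra].
  generalize (Cmod_ge_0 (f s - f t)). nra.
Qed.

Lemma cint_ext f g a b : (forall t, f t = g t) -> cint f a b = cint g a b.
Proof. intros H. replace g with f; [reflexivity|]. apply functional_extensionality, H. Qed.

Lemma cint_plus f g a b : rcont f -> rcont g ->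
  cint (fun t => f t + g t)%C a b = (cint f a b + cint g a b)%C.
Proof.
  intros Hf Hg. apply C_ext; simpl; rewrite <- (RInt_plus (V := R_CompleteNormedModule));
    auto using rcont_ex_fst, rcont_ex_snd.
Qed.

Lemma cint_scal (c : C) f a b : rcont f -> cint (fun t => c * f t)%C a b = (c * cint f a b)%C.
Proof.
  intros Hf. pose proof (rcont_ex_fst f a b Hf) as H1. pose proof (rcont_ex_snd f a b Hf) as H2.
  assert (Hs : forall k u, ex_RInt u a b -> ex_RInt (fun t : R => k * u t) a b).
  { intros k u Hu. apply (ex_RInt_scal (V := R_NormedModule)), Hu. }
  assert (Hi : forall k u, ex_RInt u a b -> RInt (fun t : R => k * u t) a b = k * RInt u a b).
  { intros k u Hu. apply (RInt_scal (V := R_CompleteNormedModule)), Hu. }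
  apply C_ext; simpl; rewrite <- !Hi by assumption.
  - apply (RInt_minus (V := R_CompleteNormedModule)); apply Hs; assumption.
  - apply (RInt_plus (V := R_CompleteNormedModule)); apply Hs; assumption.
Qed.

Lemma cint_chasles f a b c : rcont f -> (cint f a b + cint f b c = cint f a c)%C.
Proof.
  intros Hf. apply C_ext; simpl; apply (RInt_Chasles (V := R_CompleteNormedModule));
    auto using rcont_ex_fst, rcont_ex_snd.
Qed.

Lemma RInt_abs_le (u : R -> R) a b M : a <= b -> ex_RInt u a b ->
  (forall t, a <= t <= b -> Rabs (u t) <= M) -> Rabs (RInt u a b) <= M * (b - a).
Proof.
  intros Hab Hex H. rewrite Rmult_comm. apply abs_RInt_le_const; assumption.
Qed.

(** The factor 2 comes from estimating real and imaginary parts separately. It recurs as 4 in every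
    area integral below and is harmless, since no constant has to be sharp. *)
Lemma cint_le f a b M : a <= b -> rcont f -> (forall t, a <= t <= b -> Cmod (f t) <= M) ->
  Cmod (cint f a b) <= 2 * M * (b - a).
Proof.
  intros Hab Hf HM. rewrite Rmult_assoc. apply Cmod_le_max; simpl; apply RInt_abs_le;
    auto using rcont_ex_fst, rcont_ex_snd; intros t Ht; (eapply Rle_trans; [|apply HM, Ht]).
  - apply Cmod_fst.
  - apply Cmod_snd.
Qed.

Lemma cint_affine (p q : C) a b :
  cint (fun t => p + q * RtoC t)%C a b = (p * RtoC (b - a) + q * RtoC ((b ^ 2 - a ^ 2) / 2))%C.
Proof.
  assert (H : forall c d : R, RInt (fun t => c + d * t) a b = c * (b - a) + d * ((b ^ 2 - a ^ 2) / 2)).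
  { intros c d. apply is_RInt_unique.
    replace (c * (b - a) + d * ((b ^ 2 - a ^ 2) / 2)) with
      (minus ((fun t => c * t + d * (t ^ 2 / 2)) b) ((fun t => c * t + d * (t ^ 2 / 2)) a)).
    2: { unfold minus, plus, opp; simpl. field. }
    apply (is_RInt_derive (V := R_CompleteNormedModule) (fun t => c * t + d * (t ^ 2 / 2))).
    - intros x _. auto_derive; [easy|]. field.
    - intros x _. apply (continuous_plus (V := R_NormedModule)).
      + apply continuous_const.
      + apply (continuous_mult (K := R_AbsRing)); [apply continuous_const|apply continuous_id]. }
  unfold cint. apply C_ext; simpl.
  - rewrite (RInt_ext _ (fun t => fst p + fst q * t)) by (intros; simpl; ring). rewrite H. simpl. ring.
  - rewrite (RInt_ext _ (fun t => snd p + snd q * t)) by (intros; simpl; ring). rewrite H. simpl. ring.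
Qed.

Definition acont (u : C -> C) : Prop := forall z, cont_at u z.

Lemma cint_zero g a b : a <= b -> (forall t, a < t < b -> g t = RtoC 0) -> cint g a b = RtoC 0.
Proof.
  intros Hab H. apply C_ext; simpl.
  - rewrite (RInt_ext _ (fun _ => 0)), (RInt_const (V := R_CompleteNormedModule)).
    + unfold scal; simpl; unfold mult; simpl; ring.
    + intros x Hx. rewrite Rmin_left, Rmax_right in Hx by assumption. rewrite H by assumption. reflexivity.
  - rewrite (RInt_ext _ (fun _ => 0)), (RInt_const (V := R_CompleteNormedModule)).
    + unfold scal; simpl; unfold mult; simpl; ring.
    + intros x Hx. rewrite Rmin_left, Rmax_right in Hx by assumption. rewrite H by assumption. reflexivity.
Qed.

Lemma cint_extend g a b a' b' : rcont g -> a' <= a -> a <= b -> b <= b' ->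
  (forall t, t < a \/ b < t -> g t = RtoC 0) -> cint g a' b' = cint g a b.
Proof.
  intros Hg H1 H2 H3 H0.
  rewrite <- (cint_chasles g a' a b'), <- (cint_chasles g a b b') by assumption.
  rewrite (cint_zero g a' a), (cint_zero g b b'); try assumption.
  - cring.
  - intros; apply H0; lra.
  - intros; apply H0; lra.
Qed.

Lemma rcont_row u y : acont u -> rcont (fun x => u (x, y)).
Proof.
  intros H t eps He. destruct (H (t, y) eps He) as (d & Hd & Hu).
  exists d; split; [exact Hd|]. intros s Hs. apply Hu.
  replace ((s, y) - (t, y))%C with (RtoC (s - t)) by cring. rewrite Cmod_R; exact Hs.
Qed.

Lemma rcont_col u x : acont u -> rcont (fun y => u (x, y)).
Proof.
  intros H t eps He. destruct (H (x, t) eps He) as (d & Hd & Hu).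
  exists d; split; [exact Hd|]. intros s Hs. apply Hu.
  replace ((x, s) - (x, t))%C with (Ci * RtoC (s - t))%C by cring.
  rewrite Cmod_mult, Cmod_Ci, Cmod_R, Rmult_1_l; exact Hs.
Qed.

Lemma cint_minus f g a b : rcont f -> rcont g ->
  cint (fun t => f t - g t)%C a b = (cint f a b - cint g a b)%C.
Proof.
  intros Hf Hg. rewrite (cint_ext _ (fun t => f t + (RtoC (-1)) * g t)%C) by (intros; cring).
  rewrite cint_plus, cint_scal; auto using rcont_scal. cring.
Qed.

Lemma rcont_row_int u a a' : acont u -> a <= a' -> rcont (fun y => cint (fun x => u (x, y)) a a').
Proof.
  intros H Ha t eps He.
  (* Only the first point has to lie in the square, here on its bottom edge; the second ranges over
     a full neighbourhood. Adding 1 keeps the side positive when [a = a']. *)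
  destruct (heine_square u a t (a' - a + 1) (eps / (4 * (a' - a + 1)))) as (d & Hd & Hu); [lra| |auto|].
  { apply Rdiv_lt_0_compat; lra. }
  exists d; split; [exact Hd|]. intros s Hs.
  rewrite <- cint_minus by (apply rcont_row; assumption).
  eapply Rle_lt_trans.
  - apply cint_le with (M := eps / (4 * (a' - a + 1))); [assumption| |].
    { apply (rcont_plus (fun x => u (x, s)) (fun x => Copp (u (x, t)))); [apply rcont_row, H|].
      intros x e Hx. destruct (rcont_row u t H x e Hx) as (d' & Hd' & Hv). exists d'; split; [exact Hd'|].
      intros r Hr. replace (- u (r, t) - - u (x, t))%C with (- (u (r, t) - u (x, t)))%C by cring.
      rewrite Cmod_opp; auto. }
    intros x Hx. left. apply Hu; [unfold insq; simpl; lra|].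
    replace ((x, s) - (x, t))%C with (Ci * RtoC (s - t))%C by cring.
    rewrite Cmod_mult, Cmod_Ci, Cmod_R, Rmult_1_l; exact Hs.
  - replace (2 * (eps / (4 * (a' - a + 1))) * (a' - a)) with (eps * ((a' - a) / (2 * (a' - a + 1)))) by (field; lra).
    rewrite <- (Rmult_1_r eps) at 2. apply Rmult_lt_compat_l; [exact He|].
    apply Rmult_lt_reg_r with (2 * (a' - a + 1)); [lra|]. unfold Rdiv. rewrite Rmult_assoc, Rinv_l; lra.
Qed.

(** * Integrals over squares *)

Definition Isq (a b l : R) (u : C -> C) : C :=
  cint (fun y => cint (fun x => u (x, y)) a (a + l)) b (b + l).

Lemma acont_plus u v : acont u -> acont v -> acont (fun z => u z + v z)%C.
Proof.
  intros Hf Hg t eps He. destruct (Hf t (eps / 2)) as (d1 & P1 & H1); [lra|].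
  destruct (Hg t (eps / 2)) as (d2 & P2 & H2); [lra|].
  exists (Rmin d1 d2); split; [apply Rmin_glb_lt; assumption|]. intros s Hs.
  replace (u s + v s - (u t + v t))%C with ((u s - u t) + (v s - v t))%C by cring.
  eapply Rle_lt_trans; [apply Cmod_triangle|].
  generalize (H1 s (Rlt_le_trans _ _ _ Hs (Rmin_l _ _))), (H2 s (Rlt_le_trans _ _ _ Hs (Rmin_r _ _))). lra.
Qed.

Lemma cont_at_const (c z : C) : cont_at (fun _ => c) z.
Proof. intros eps He; exists 1; split; [lra|]. intros. rewrite Cmod_subself; exact He. Qed.

Lemma cont_at_mult u v z : cont_at u z -> cont_at v z -> cont_at (fun z => u z * v z)%C z.
Proof.
  intros Hu Hv eps He.
  set (M := Cmod (u z) + Cmod (v z) + 1).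
  assert (HM : 1 <= M) by (unfold M; generalize (Cmod_ge_0 (u z)), (Cmod_ge_0 (v z)); lra).
  assert (He' : 0 < eps / (2 * M)) by (apply Rdiv_lt_0_compat; lra).
  destruct (Hu (Rmin 1 (eps / (2 * M)))) as (d1 & P1 & H1); [apply Rmin_glb_lt; lra|].
  destruct (Hv (eps / (2 * M))) as (d2 & P2 & H2); [lra|].
  exists (Rmin d1 d2); split; [apply Rmin_glb_lt; assumption|]. intros w Hw.
  specialize (H1 w (Rlt_le_trans _ _ _ Hw (Rmin_l _ _))).
  specialize (H2 w (Rlt_le_trans _ _ _ Hw (Rmin_r _ _))).
  generalize (Rmin_l 1 (eps / (2 * M))), (Rmin_r 1 (eps / (2 * M))); intros K1 K2.
  replace (u w * v w - u z * v z)%C with (u w * (v w - v z) + v z * (u w - u z))%C by cring.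
  eapply Rle_lt_trans; [apply Cmod_triangle|]. rewrite !Cmod_mult.
  assert (Cmod (u w) <= Cmod (u z) + 1) by (generalize (Cmod_le_sub (u w) (u z)); lra).
  assert (E : eps = (eps / (2 * M)) * (2 * M)) by (field; lra).
  set (e := eps / (2 * M)) in *. unfold M in E.
  generalize (Cmod_ge_0 (u z)), (Cmod_ge_0 (v z)), (Cmod_ge_0 (u w)), (Cmod_ge_0 (u w - u z)), (Cmod_ge_0 (v w - v z)).
  intros. nra.
Qed.

Lemma acont_const c : acont (fun _ => c).
Proof. intro; apply cont_at_const. Qed.

Lemma acont_mult u v : acont u -> acont v -> acont (fun z => u z * v z)%C.
Proof. intros Hu Hv z; apply cont_at_mult; auto. Qed.

Lemma acont_scal (c : C) u : acont u -> acont (fun z => c * u z)%C.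
Proof. intros; apply (acont_mult (fun _ => c)); auto using acont_const. Qed.

Lemma acont_ext u v : (forall z, u z = v z) -> acont u -> acont v.
Proof. intros E H. replace v with u; [exact H|]. apply functional_extensionality, E. Qed.

Lemma acont_minus u v : acont u -> acont v -> acont (fun z => u z - v z)%C.
Proof.
  intros Hu Hv. apply (acont_ext (fun z => u z + (RtoC (-1)) * v z)%C); [intro; cring|].
  apply acont_plus, acont_scal; assumption.
Qed.

Lemma Isq_plus a b l u v : 0 <= l -> acont u -> acont v ->
  Isq a b l (fun z => u z + v z)%C = (Isq a b l u + Isq a b l v)%C.
Proof.
  intros Hl Hu Hv. unfold Isq. rewrite <- cint_plus by (apply rcont_row_int; [assumption|lra]).
  apply cint_ext. intro y. apply cint_plus; apply rcont_row; assumption.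
Qed.

Lemma Isq_scal a b l (c : C) u : 0 <= l -> acont u ->
  Isq a b l (fun z => c * u z)%C = (c * Isq a b l u)%C.
Proof.
  intros Hl Hu. unfold Isq. rewrite <- cint_scal by (apply rcont_row_int; [assumption|lra]).
  apply cint_ext. intro y. apply (cint_scal c (fun x => u (x, y))); apply rcont_row; assumption.
Qed.

Lemma Isq_le a b l u M : 0 <= l -> acont u -> (forall z, insq a b l z -> Cmod (u z) <= M) ->
  Cmod (Isq a b l u) <= 4 * M * l ^ 2.
Proof.
  intros Hl Hu HM. unfold Isq.
  eapply Rle_trans; [apply cint_le with (M := 2 * M * l); [lra|apply rcont_row_int; [assumption|lra]|]|right; ring].
  intros y Hy. eapply Rle_trans; [apply cint_le with (M := M); [lra|apply rcont_row; assumption|]|right; ring].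
  intros x Hx. apply HM. unfold insq; simpl; lra.
Qed.

Lemma Isq_split a b l u : 0 < l -> acont u ->
  Isq a b l u = (Isq a b (l / 2) u + Isq (a + l / 2) b (l / 2) u +
    Isq a (b + l / 2) (l / 2) u + Isq (a + l / 2) (b + l / 2) (l / 2) u)%C.
Proof.
  intros Hl Hu. unfold Isq.
  replace (a + l / 2 + l / 2) with (a + l) by field.
  replace (b + l / 2 + l / 2) with (b + l) by field.
  assert (H : forall b b', cint (fun y => cint (fun x => u (x, y)) a (a + l)) b b' =
    (cint (fun y => cint (fun x => u (x, y)) a (a + l / 2)) b b' +
     cint (fun y => cint (fun x => u (x, y)) (a + l / 2) (a + l)) b b')%C).
  { intros c d. rewrite <- cint_plus by (apply rcont_row_int; [assumption|lra]).
    apply cint_ext. intro y. symmetry. apply cint_chasles, rcont_row, Hu. }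
  rewrite <- (cint_chasles _ b (b + l / 2) (b + l)) by (apply rcont_row_int; [assumption|lra]).
  rewrite !H. ring.
Qed.

Lemma cont_at_ball u z r : 0 < r -> (forall w, Cmod (w - z) < r -> u w = u z) -> cont_at u z.
Proof.
  intros Hr H eps He. exists r; split; [exact Hr|]. intros w Hw. rewrite H by exact Hw. rewrite Cmod_subself; exact He.
Qed.

Lemma cont_at_ext_loc u v z r : 0 < r -> (forall w, Cmod (w - z) < r -> u w = v w) -> cont_at u z -> cont_at v z.
Proof.
  intros Hr H Hu eps He. destruct (Hu eps He) as (d & Hd & K). exists (Rmin d r).
  split; [apply Rmin_glb_lt; assumption|]. intros w Hw.
  rewrite <- !H.
  - apply K. eapply Rlt_le_trans; [exact Hw|apply Rmin_l].
  - rewrite Cmod_subself; exact Hr.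
  - eapply Rlt_le_trans; [exact Hw|apply Rmin_r].
Qed.

(** * Goursat's lemma in the form of Green's formula *)

(* [dbar u z b]: u is real-differentiable at z and b is the value of the Wirtinger derivative du/d(conj z). *)
Definition dbar (u : C -> C) (z b : C) : Prop :=
  exists a : C, forall eps, 0 < eps -> exists delta, 0 < delta /\
    forall h, Cmod h < delta ->
      Cmod (u (z + h) - u z - (a * h + b * Cconj h))%C <= eps * Cmod h.

Lemma dbar_cont_at u z b : dbar u z b -> cont_at u z.
Proof.
  intros (a & H) eps He. destruct (H 1) as (d & Hd & K); [lra|].
  set (M := 1 + Cmod a + Cmod b).
  assert (HM : 0 < M) by (unfold M; generalize (Cmod_ge_0 a), (Cmod_ge_0 b); lra).
  exists (Rmin d (eps / M)); split; [apply Rmin_glb_lt; [assumption|apply Rdiv_lt_0_compat; assumption]|].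
  intros w Hw.
  specialize (K (w - z)%C (Rlt_le_trans _ _ _ Hw (Rmin_l _ _))).
  replace (z + (w - z))%C with w in K by cring.
  assert (Hw2 : Cmod (w - z) * M < eps).
  { rewrite Rmult_comm. apply Rlt_div_mult; [exact HM|]. eapply Rlt_le_trans; [exact Hw|apply Rmin_r]. }
  eapply Rle_lt_trans; [|exact Hw2].
  replace (u w - u z)%C with ((u w - u z - (a * (w - z) + b * Cconj (w - z))) + (a * (w - z) + b * Cconj (w - z)))%C by cring.
  eapply Rle_trans; [apply Cmod_triangle|].
  generalize (Cmod_triangle (a * (w - z)) (b * Cconj (w - z))).
  rewrite !Cmod_mult, Cmod_conj. unfold M. nra.
Qed.

(** The integral of u dz counterclockwise around the square: bottom, right, top, left. *)
Definition edge (a b l : R) (u : C -> C) : C :=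
  (cint (fun x => u (x, b)) a (a + l) + Ci * cint (fun y => u ((a + l)%R, y)) b (b + l)
   - cint (fun x => u (x, (b + l)%R)) a (a + l) - Ci * cint (fun y => u (a, y)) b (b + l))%C.

Lemma edge_split a b l u : 0 < l -> acont u ->
  edge a b l u = (edge a b (l / 2) u + edge (a + l / 2) b (l / 2) u +
    edge a (b + l / 2) (l / 2) u + edge (a + l / 2) (b + l / 2) (l / 2) u)%C.
Proof.
  intros Hl Hu. unfold edge.
  replace (a + l / 2 + l / 2) with (a + l) by field.
  replace (b + l / 2 + l / 2) with (b + l) by field.
  rewrite <- (cint_chasles (fun x => u (x, b)) a (a + l / 2) (a + l)) by (apply rcont_row, Hu).
  rewrite <- (cint_chasles (fun x => u (x, b + l)) a (a + l / 2) (a + l)) by (apply rcont_row, Hu).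
  rewrite <- (cint_chasles (fun y => u (a, y)) b (b + l / 2) (b + l)) by (apply rcont_col, Hu).
  rewrite <- (cint_chasles (fun y => u (a + l, y)) b (b + l / 2) (b + l)) by (apply rcont_col, Hu).
  ring.
Qed.

Lemma edge_plus a b l u v : acont u -> acont v ->
  edge a b l (fun z => u z + v z)%C = (edge a b l u + edge a b l v)%C.
Proof.
  intros Hu Hv. unfold edge.
  rewrite !cint_plus; [ring|..]; auto using rcont_row, rcont_col.
Qed.

Lemma edge_le a b l u M : 0 <= l -> acont u -> (forall z, insq a b l z -> Cmod (u z) <= M) ->
  Cmod (edge a b l u) <= 8 * M * l.
Proof.
  intros Hl Hu HM. unfold edge.
  assert (H1 : forall y, b <= y <= b + l -> Cmod (cint (fun x => u (x, y)) a (a + l)) <= 2 * M * (a + l - a)).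
  { intros y Hy. apply cint_le; [lra|apply rcont_row, Hu|]. intros; apply HM; unfold insq; simpl; lra. }
  assert (H2 : forall x, a <= x <= a + l -> Cmod (cint (fun y => u (x, y)) b (b + l)) <= 2 * M * (b + l - b)).
  { intros y Hy. apply cint_le; [lra|apply rcont_col, Hu|]. intros; apply HM; unfold insq; simpl; lra. }
  generalize (H1 b ltac:(lra)), (H1 (b + l) ltac:(lra)), (H2 a ltac:(lra)), (H2 (a + l) ltac:(lra)).
  set (p := cint _ _ _). set (q := cint _ _ _). set (r := cint _ _ _). set (s := cint _ _ _). intros.
  eapply Rle_trans; [apply Cmod_triangle|]. rewrite Cmod_opp, Cmod_mult, Cmod_Ci.
  generalize (Cmod_triangle (p + Ci * s) (- q)), (Cmod_triangle p (Ci * s)).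
  rewrite Cmod_opp, Cmod_mult, Cmod_Ci. unfold Cminus. lra.
Qed.

(** The holomorphic part of an affine map integrates to 0 around a square, and the conjugate
    contributes 2i times the area: Green's formula for first-order Taylor polynomials. *)
Lemma edge_affine a b l (z A al be : C) :
  edge a b l (fun w => A + (al * (w - z) + be * Cconj (w - z)))%C = (2 * Ci * be * RtoC (l ^ 2))%C.
Proof.
  unfold edge.
  assert (H1 : forall y p q, cint (fun x => A + (al * ((x, y) - z) + be * Cconj ((x, y) - z)))%C p q =
    ((A + (al * (Ci * y - z) + be * Cconj (Ci * y - z))) * RtoC (q - p) + (al + be) * RtoC ((q ^ 2 - p ^ 2) / 2))%C).
  { intros y p q. rewrite <- cint_affine. apply cint_ext; intro; cring. }
  assert (H2 : forall x p q, cint (fun y => A + (al * ((x, y) - z) + be * Cconj ((x, y) - z)))%C p q =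
    ((A + (al * (x - z) + be * Cconj (x - z))) * RtoC (q - p) + (al * Ci - be * Ci) * RtoC ((q ^ 2 - p ^ 2) / 2))%C).
  { intros y p q. rewrite <- cint_affine. apply cint_ext; intro; cring. }
  rewrite !H1, !H2. apply C_ext; simpl; field.
Qed.

Lemma acont_affine (z A al be : C) : acont (fun w => A + (al * (w - z) + be * Cconj (w - z)))%C.
Proof.
  intros t. apply (dbar_cont_at _ _ be). exists al. intros eps He. exists 1; split; [lra|].
  intros h _. replace (_ - _)%C with (RtoC 0) by cring. rewrite Cmod_0. generalize (Cmod_ge_0 h); nra.
Qed.

Lemma Isq_const a b l (c : C) : Isq a b l (fun _ => c) = (c * RtoC (l ^ 2))%C.
Proof.
  unfold Isq.
  assert (H : forall (d : C) p q, cint (fun _ => d) p q = (d * RtoC (q - p))%C).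
  { intros d p q. rewrite (cint_ext _ (fun t => d + (RtoC 0) * RtoC t)%C) by (intro; cring).
    rewrite cint_affine. cring. }
  rewrite (cint_ext _ (fun _ => c * RtoC l)%C); [rewrite H; cring|].
  intro; rewrite H. f_equal. f_equal. ring.
Qed.

(* Both sides are additive under bisection and agree up to o(l^2) on small squares around each point. *)
Lemma goursat_green a b l u v : 0 < l -> (forall z, dbar u z (v z)) -> acont v ->
  edge a b l u = (2 * Ci * Isq a b l v)%C.
Proof.
  intros Hl Hd Hv.
  assert (Hu : acont u) by (intro z; apply (dbar_cont_at _ _ _ (Hd z))).
  assert (Key : forall eps, 0 < eps -> Cmod (edge a b l u - 2 * Ci * Isq a b l v) <= eps * l ^ 2).
  { intros eps He.
    apply (cousin_square (fun a b l => Cmod (edge a b l u - 2 * Ci * Isq a b l v) <= eps * l ^ 2)); [exact Hl| |].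
    - intros a' b' l' Hl' H1 H2 H3 H4. rewrite edge_split, Isq_split by assumption.
      set (e1 := edge a' b' (l' / 2) u) in *. set (e2 := edge (a' + l' / 2) b' (l' / 2) u) in *.
      set (e3 := edge a' (b' + l' / 2) (l' / 2) u) in *. set (e4 := edge (a' + l' / 2) (b' + l' / 2) (l' / 2) u) in *.
      set (i1 := Isq a' b' (l' / 2) v) in *. set (i2 := Isq (a' + l' / 2) b' (l' / 2) v) in *.
      set (i3 := Isq a' (b' + l' / 2) (l' / 2) v) in *. set (i4 := Isq (a' + l' / 2) (b' + l' / 2) (l' / 2) v) in *.
      replace (e1 + e2 + e3 + e4 - 2 * Ci * (i1 + i2 + i3 + i4))%C with
        ((e1 - 2 * Ci * i1) + ((e2 - 2 * Ci * i2) + ((e3 - 2 * Ci * i3) + (e4 - 2 * Ci * i4))))%C by ring.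
      eapply Rle_trans; [apply Cmod_triangle|].
      eapply Rle_trans; [apply Rplus_le_compat_l, Cmod_triangle|].
      eapply Rle_trans; [apply Rplus_le_compat_l, Rplus_le_compat_l, Cmod_triangle|].
      lra.
    - intros z Hz. destruct (Hd z) as (al & Hal).
      (* With e = eps / 24 the Taylor remainder is at most 2 e l' on the square and costs 16 e l'^2
         along the edges; the oscillation of v costs 2 * 4 e l'^2. The total is 24 e l'^2. *)
      destruct (Hal (eps / 24)) as (d1 & Hd1 & K1); [lra|].
      destruct (Hv z (eps / 24)) as (d2 & Hd2 & K2); [lra|].
      exists (Rmin (d1 / 2) (d2 / 2)). split; [apply Rmin_glb_lt; lra|].
      intros a' b' l' Hl' Hz'.
      generalize (Rmin_l (d1 / 2) (d2 / 2)), (Rmin_r (d1 / 2) (d2 / 2)); intros.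
      assert (Hdist : forall w, insq a' b' l' w -> Cmod (w - z) <= 2 * l').
      { intros w Hw. apply (insq_mod a' b'); assumption. }
      set (af := fun w => (u z + (al * (w - z) + v z * Cconj (w - z)))%C).
      assert (Haf : acont af) by apply acont_affine.
      assert (Er : edge a' b' l' u = (edge a' b' l' af + edge a' b' l' (fun w => u w - af w))%C).
      { rewrite <- edge_plus; [|exact Haf|apply acont_minus; assumption].
        f_equal. apply functional_extensionality; intro; cring. }
      assert (Ei : Isq a' b' l' v = (Isq a' b' l' (fun _ => v z) + Isq a' b' l' (fun w => v w - v z))%C).
      { rewrite <- Isq_plus; [|lra|apply acont_const|apply acont_minus; [assumption|apply acont_const]].
        f_equal. apply functional_extensionality; intro; cring. }
      rewrite Er, Ei, Isq_const. unfold af at 1. rewrite edge_affine.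
      replace (_ - _)%C with (edge a' b' l' (fun w => u w - af w)%C - 2 * Ci * Isq a' b' l' (fun w => v w - v z)%C)%C by ring.
      assert (B1 : Cmod (edge a' b' l' (fun w => u w - af w)%C) <= 8 * (eps / 24 * (2 * l')) * l').
      { apply edge_le; [lra|apply acont_minus; assumption|]. intros w Hw.
        specialize (Hdist w Hw). specialize (K1 (w - z)%C ltac:(lra)).
        replace (z + (w - z))%C with w in K1 by cring.
        replace (u w - af w)%C with (u w - u z - (al * (w - z) + v z * Cconj (w - z)))%C by (unfold af; cring).
        eapply Rle_trans; [exact K1|]. apply Rmult_le_compat_l; lra. }
      assert (B2 : Cmod (Isq a' b' l' (fun w => v w - v z)%C) <= 4 * (eps / 24) * l' ^ 2).
      { apply Isq_le; [lra|apply acont_minus; [assumption|apply acont_const]|]. intros w Hw. left.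
        apply K2. specialize (Hdist w Hw). lra. }
      eapply Rle_trans; [apply Cmod_triangle|]. rewrite Cmod_opp, !Cmod_mult, Cmod_Ci, Cmod_R.
      rewrite (Rabs_right 2) by lra. lra. }
  assert (Hz : Cmod (edge a b l u - 2 * Ci * Isq a b l v) = 0).
  { apply Rle_antisym; [|apply Cmod_ge_0]. apply Rnot_lt_le; intro Hp.
    specialize (Key (Cmod (edge a b l u - 2 * Ci * Isq a b l v) / (2 * l ^ 2))).
    assert (0 < l ^ 2) by (apply pow_lt; assumption).
    assert (Hpos : 0 < Cmod (edge a b l u - 2 * Ci * Isq a b l v) / (2 * l ^ 2)).
    { apply Rdiv_lt_0_compat; lra. }
    specialize (Key Hpos).
    replace (Cmod (edge a b l u - 2 * Ci * Isq a b l v) / (2 * l ^ 2) * l ^ 2)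
      with (Cmod (edge a b l u - 2 * Ci * Isq a b l v) / 2) in Key by (field; lra). lra. }
  apply Cmod_eq_0 in Hz.
  replace (edge a b l u) with ((edge a b l u - 2 * Ci * Isq a b l v) + 2 * Ci * Isq a b l v)%C by ring.
  rewrite Hz. ring.
Qed.

(** * Integration of compactly supported functions over the plane *)

Definition supp_in (a b l : R) (u : C -> C) : Prop := forall z, ~ insq a b l z -> u z = RtoC 0.

Definition csupp (u : C -> C) : Prop := exists r, 0 < r /\ supp_in (- r) (- r) (2 * r) u.

(* Unspecified unless [u] has compact support; for continuous [u] the choice of the box is irrelevant. *)
Definition Pint (u : C -> C) : C :=
  epsilon (inhabits (RtoC 0))
    (fun v => exists r, 0 < r /\ supp_in (- r) (- r) (2 * r) u /\ v = Isq (- r) (- r) (2 * r) u).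

Lemma Isq_extend a b l a' b' l' u : 0 < l -> acont u -> supp_in a b l u ->
  a' <= a -> a + l <= a' + l' -> b' <= b -> b + l <= b' + l' ->
  Isq a' b' l' u = Isq a b l u.
Proof.
  intros Hl Hu Hs H1 H2 H3 H4. unfold Isq.
  assert (Hz : forall x y, x < a \/ a + l < x \/ y < b \/ b + l < y -> u (x, y) = RtoC 0).
  { intros x y H. apply Hs. unfold insq; simpl. lra. }
  rewrite (cint_extend _ b (b + l) b' (b' + l')); try lra.
  - apply cint_ext. intro y. apply cint_extend; try lra.
    + apply rcont_row, Hu.
    + intros t Ht; apply Hz; tauto.
  - apply rcont_row_int; [assumption|lra].
  - intros y Hy. apply cint_zero; [lra|]. intros; apply Hz; tauto.
Qed.

Lemma supp_in_csupp a b l u : 0 < l -> supp_in a b l u -> csupp u.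
Proof.
  intros Hl Hs. exists (Rabs a + Rabs b + l). split; [generalize (Rabs_pos a), (Rabs_pos b); lra|].
  intros z Hz. apply Hs. intro H. apply Hz. unfold insq in *.
  generalize (Rle_abs a), (Rle_abs (- a)), (Rle_abs b), (Rle_abs (- b)).
  rewrite !Rabs_Ropp. lra.
Qed.

Lemma Pint_eq a b l u : 0 < l -> acont u -> supp_in a b l u -> Pint u = Isq a b l u.
Proof.
  intros Hl Hu Hs.
  destruct (epsilon_spec (inhabits (RtoC 0))
    (fun v => exists r, 0 < r /\ supp_in (- r) (- r) (2 * r) u /\ v = Isq (- r) (- r) (2 * r) u)) as (r & Hr & Hs' & E).
  { destruct (supp_in_csupp a b l u Hl Hs) as (r & Hr & Hs').
    exists (Isq (- r) (- r) (2 * r) u), r. auto. }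
  fold (Pint u) in E. rewrite E.
  set (R1 := Rabs a + Rabs b + l + r).
  generalize (Rle_abs a), (Rle_abs (- a)), (Rle_abs b), (Rle_abs (- b)), (Rabs_pos a), (Rabs_pos b).
  rewrite !Rabs_Ropp. intros.
  rewrite <- (Isq_extend (- r) (- r) (2 * r) (- R1) (- R1) (2 * R1)); try assumption; try (unfold R1; lra).
  rewrite <- (Isq_extend a b l (- R1) (- R1) (2 * R1)); try assumption; try (unfold R1; lra).
  reflexivity.
Qed.

Lemma Pint_box u : acont u -> csupp u ->
  exists r, 0 < r /\ forall r', r <= r' -> supp_in (- r') (- r') (2 * r') u /\ Pint u = Isq (- r') (- r') (2 * r') u.
Proof.
  intros Hu (r & Hr & Hs). exists r; split; [assumption|]. intros r' Hr'.
  assert (supp_in (- r') (- r') (2 * r') u).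
  { intros z Hz. apply Hs. unfold insq in *. lra. }
  split; [assumption|]. apply Pint_eq; [lra|assumption|assumption].
Qed.

Lemma csupp_plus u v : csupp u -> csupp v -> csupp (fun z => u z + v z)%C.
Proof.
  intros (r & Hr & Hu) (r' & Hr' & Hv). exists (r + r'). split; [lra|].
  intros z Hz. rewrite Hu, Hv; [cring|unfold insq in *; lra|unfold insq in *; lra].
Qed.

Lemma csupp_mult_r u v : csupp u -> csupp (fun z => v z * u z)%C.
Proof.
  intros (r & Hr & Hu). exists r. split; [lra|]. intros z Hz. rewrite Hu; [cring|assumption].
Qed.

Lemma csupp_mult_l u v : csupp u -> csupp (fun z => u z * v z)%C.
Proof.
  intros (r & Hr & Hu). exists r. split; [lra|]. intros z Hz. rewrite Hu; [cring|assumption].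
Qed.

Lemma csupp_minus u v : csupp u -> csupp v -> csupp (fun z => u z - v z)%C.
Proof.
  intros (r & Hr & Hu) (r' & Hr' & Hv). exists (r + r'). split; [lra|].
  intros z Hz. rewrite Hu, Hv; [cring|unfold insq in *; lra|unfold insq in *; lra].
Qed.

Lemma Pint_ext u v : (forall z, u z = v z) -> Pint u = Pint v.
Proof. intros E. f_equal. apply functional_extensionality, E. Qed.

Lemma Pint_plus u v : acont u -> acont v -> csupp u -> csupp v ->
  Pint (fun z => u z + v z)%C = (Pint u + Pint v)%C.
Proof.
  intros Hu Hv Su Sv.
  destruct (Pint_box u Hu Su) as (r1 & P1 & H1). destruct (Pint_box v Hv Sv) as (r2 & P2 & H2).
  destruct (Pint_box _ (acont_plus u v Hu Hv) (csupp_plus u v Su Sv)) as (r3 & P3 & H3).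
  destruct (H1 (r1 + r2 + r3)) as [_ ->]; [lra|]. destruct (H2 (r1 + r2 + r3)) as [_ ->]; [lra|].
  destruct (H3 (r1 + r2 + r3)) as [_ ->]; [lra|]. apply Isq_plus; try assumption; lra.
Qed.

Lemma Pint_scal (c : C) u : acont u -> csupp u -> Pint (fun z => c * u z)%C = (c * Pint u)%C.
Proof.
  intros Hu Su.
  destruct (Pint_box u Hu Su) as (r1 & P1 & H1).
  destruct (Pint_box _ (acont_scal c u Hu) (csupp_mult_r u _ Su)) as (r3 & P3 & H3).
  destruct (H1 (r1 + r3)) as [_ ->]; [lra|].
  destruct (H3 (r1 + r3)) as [_ ->]; [lra|]. apply Isq_scal; try assumption; lra.
Qed.

Lemma Pint_minus u v : acont u -> acont v -> csupp u -> csupp v ->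
  Pint (fun z => u z - v z)%C = (Pint u - Pint v)%C.
Proof.
  intros Hu Hv Su Sv. rewrite (Pint_ext _ (fun z => u z + (RtoC (-1)) * v z)%C) by (intro; cring).
  rewrite Pint_plus, Pint_scal; auto using acont_scal, csupp_mult_r. cring.
Qed.

Lemma Pint_le a b l u M : 0 < l -> acont u -> supp_in a b l u ->
  (forall z, insq a b l z -> Cmod (u z) <= M) -> Cmod (Pint u) <= 4 * M * l ^ 2.
Proof.
  intros Hl Hu Hs HM. rewrite (Pint_eq a b l) by assumption. apply Isq_le; [lra|assumption|assumption].
Qed.

Lemma cint_translate g a b x : rcont g -> cint (fun t => g (t - x)) a b = cint g (a - x) (b - x).
Proof.
  intros Hg.
  assert (H : forall u : R -> R, (forall t, continuous u t) ->
    RInt (fun t => u (t - x)) a b = RInt u (a - x) (b - x)).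
  { intros u Hu. pose proof (RInt_comp_lin (V := R_CompleteNormedModule) u 1 (- x) a b) as E.
    replace (1 * a + - x) with (a - x) in E by ring. replace (1 * b + - x) with (b - x) in E by ring.
    rewrite <- E.
    - apply RInt_ext. intros t _. unfold scal; simpl; unfold mult; simpl.
      rewrite Rmult_1_l. f_equal. ring.
    - apply (ex_RInt_continuous (V := R_CompleteNormedModule)). intros; apply Hu. }
  unfold cint. f_equal; [apply (H (fun t => fst (g t)))|apply (H (fun t => snd (g t)))].
  - apply rcont_fst, Hg.
  - apply rcont_snd, Hg.
Qed.

Lemma acont_translate u w : acont u -> acont (fun z => u (z - w)%C).
Proof.
  intros Hu z eps He. destruct (Hu (z - w)%C eps He) as (d & Hd & K). exists d; split; [assumption|].
  intros t Ht. apply K. replace (t - w - (z - w))%C with (t - z)%C by cring. exact Ht.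
Qed.

Lemma Pint_translate u w : acont u -> csupp u -> Pint (fun z => u (z - w)%C) = Pint u.
Proof.
  intros Hu Su. destruct (Pint_box u Hu Su) as (r & Hr & H). destruct (H r (Rle_refl _)) as [Hs ->].
  rewrite (Pint_eq (- r + fst w) (- r + snd w) (2 * r)); [|lra|apply acont_translate, Hu|].
  - unfold Isq. 
    rewrite (cint_ext _ (fun y => (fun y => cint (fun x => u (x, y)) (- r) (- r + 2 * r)) (y - snd w))).
    + rewrite (cint_translate (fun y => cint (fun x => u (x, y)) (- r) (- r + 2 * r)));
        [|apply rcont_row_int; [assumption|lra]]. f_equal; ring.
    + intro y. rewrite (cint_ext _ (fun x => (fun x => u (x, y - snd w)) (x - fst w))) by reflexivity.
      rewrite (cint_translate (fun x => u (x, y - snd w))) by (apply rcont_row, Hu). f_equal; ring.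
  - intros z Hz. apply Hs. intro H1. apply Hz. unfold insq in *; simpl in *. lra.
Qed.

(** * Wirtinger derivatives and test functions *)

(** That is, z lies outside the closed support of u. The property survives multiplication by an
    arbitrary, even discontinuous, factor. *)
Definition lzero (u : C -> C) (z : C) : Prop :=
  exists r, 0 < r /\ forall w, Cmod (w - z) < r -> u w = RtoC 0.

Lemma lzero_at u z : lzero u z -> u z = RtoC 0.
Proof. intros (r & Hr & H). apply H. rewrite Cmod_subself; exact Hr. Qed.

Lemma lzero_cont_at u z : lzero u z -> cont_at u z.
Proof.
  intros Hz. pose proof (lzero_at u z Hz) as H0. destruct Hz as (r & Hr & H).
  apply (cont_at_ball _ _ r Hr). intros w Hw. rewrite H0. auto.
Qed.

Lemma lzero_mult_r u v z : lzero u z -> lzero (fun w => v w * u w)%C z.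
Proof. intros (r & Hr & H). exists r; split; [assumption|]. intros w Hw. rewrite H by assumption. cring. Qed.

(** The differential vanishes in the directions 1 and i, which reads a + b = 0 and a - b = 0. So the
    dbar derivative of a test function is automatically supported where the function is. *)
Lemma dbar_unique_zero u z b : lzero u z -> dbar u z b -> b = RtoC 0.
Proof.
  intros (r & Hr & H0) (a & H).
  assert (Hab : forall th : C, Cmod th = 1 -> (a * th + b * Cconj th)%C = RtoC 0).
  { intros th Hth. apply Cmod_eq_0. apply Rle_antisym; [|apply Cmod_ge_0].
    apply Rnot_lt_le; intro Hp. destruct (H (Cmod (a * th + b * Cconj th) / 2)) as (d & Hd & K); [lra|].
    set (t := Rmin d r / 2). assert (Ht : 0 < t) by (unfold t; generalize (Rmin_glb_lt d r 0 Hd Hr); lra).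
    assert (Ht2 : t < d /\ t < r).
    { generalize (Rmin_l d r), (Rmin_r d r). unfold t in *. lra. }
    assert (Hm : Cmod (RtoC t * th) = t).
    { rewrite Cmod_mult, Hth, Cmod_R, Rabs_right by lra. ring. }
    specialize (K (RtoC t * th)%C). rewrite Hm in K. specialize (K (proj1 Ht2)).
    rewrite !H0 in K.
    - replace (0 - 0 - (a * (t * th) + b * Cconj (t * th)))%C with (RtoC (- t) * (a * th + b * Cconj th))%C in K by cring.
      rewrite Cmod_mult, Cmod_R, Rabs_Ropp, Rabs_right in K by lra. nra.
    - rewrite Cmod_subself; exact Hr.
    - replace (z + RtoC t * th - z)%C with (RtoC t * th)%C by cring. rewrite Hm; tauto. }
  pose proof (Hab (RtoC 1) Cmod_1) as H1. pose proof (Hab Ci Cmod_Ci) as H2.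
  pose proof (f_equal fst H1) as H1a. pose proof (f_equal snd H1) as H1b.
  pose proof (f_equal fst H2) as H2a. pose proof (f_equal snd H2) as H2b. simpl in *.
  apply C_ext; simpl; lra.
Qed.

Lemma dbar_const (c z : C) : dbar (fun _ => c) z (RtoC 0).
Proof.
  exists (RtoC 0). intros eps He. exists 1; split; [lra|]. intros h _.
  replace (_ - _)%C with (RtoC 0) by cring. rewrite Cmod_0. generalize (Cmod_ge_0 h); nra.
Qed.

Lemma dbar_plus u v z b d : dbar u z b -> dbar v z d -> dbar (fun w => u w + v w)%C z (b + d)%C.
Proof.
  intros (p & Hp) (q & Hq). exists (p + q)%C. intros eps He.
  destruct (Hp (eps / 2)) as (d1 & P1 & H1); [lra|]. destruct (Hq (eps / 2)) as (d2 & P2 & H2); [lra|].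
  exists (Rmin d1 d2); split; [apply Rmin_glb_lt; assumption|]. intros h Hh.
  specialize (H1 h (Rlt_le_trans _ _ _ Hh (Rmin_l _ _))).
  specialize (H2 h (Rlt_le_trans _ _ _ Hh (Rmin_r _ _))).
  replace (_ - _)%C with ((u (z + h)%C - u z - (p * h + b * Cconj h)) + (v (z + h)%C - v z - (q * h + d * Cconj h)))%C by cring.
  eapply Rle_trans; [apply Cmod_triangle|]. lra.
Qed.

Lemma dbar_ext_loc u v z b r : 0 < r -> (forall w, Cmod (w - z) < r -> u w = v w) -> dbar u z b -> dbar v z b.
Proof.
  intros Hr E (p & Hp). exists p. intros eps He. destruct (Hp eps He) as (d & Hd & K).
  exists (Rmin d r); split; [apply Rmin_glb_lt; assumption|]. intros h Hh.
  rewrite <- !E.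
  - apply K. eapply Rlt_le_trans; [exact Hh|apply Rmin_l].
  - rewrite Cmod_subself; exact Hr.
  - replace (z + h - z)%C with h by cring. eapply Rlt_le_trans; [exact Hh|apply Rmin_r].
Qed.

Lemma dbar_eq u z b b' : b = b' -> dbar u z b -> dbar u z b'.
Proof. intros <-; auto. Qed.

Lemma dbar_mult u v z b d : dbar u z b -> dbar v z d -> dbar (fun w => u w * v w)%C z (b * v z + u z * d)%C.
Proof.
  intros Hu Hv. pose proof (dbar_cont_at _ _ _ Hv) as Cv.
  destruct Hu as (p & Hp). destruct Hv as (q & Hq). exists (p * v z + u z * q)%C. intros eps He.
  set (M := Cmod (v z) + 1 + Cmod (u z) + Cmod p + Cmod b).
  assert (HM : 1 <= M).
  { unfold M. generalize (Cmod_ge_0 (v z)), (Cmod_ge_0 (u z)), (Cmod_ge_0 p), (Cmod_ge_0 b). lra. }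
  set (e := eps / (3 * M)). assert (He' : 0 < e) by (apply Rdiv_lt_0_compat; lra).
  assert (Ee : eps = 3 * M * e) by (unfold e; field; lra).
  destruct (Hp e He') as (d1 & P1 & H1). destruct (Hq e He') as (d2 & P2 & H2).
  destruct (Cv (Rmin 1 e)) as (d3 & P3 & H3); [apply Rmin_glb_lt; lra|].
  exists (Rmin d1 (Rmin d2 d3)); split; [repeat apply Rmin_glb_lt; assumption|]. intros h Hh.
  generalize (Rmin_l d1 (Rmin d2 d3)), (Rmin_r d1 (Rmin d2 d3)), (Rmin_l d2 d3), (Rmin_r d2 d3); intros.
  specialize (H1 h ltac:(lra)). specialize (H2 h ltac:(lra)).
  specialize (H3 (z + h)%C). replace (z + h - z)%C with h in H3 by cring. specialize (H3 ltac:(lra)).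
  generalize (Rmin_l 1 e), (Rmin_r 1 e); intros.
  replace (_ - _)%C with ((u (z + h)%C - u z - (p * h + b * Cconj h)) * v (z + h)%C
     + ((p * h + b * Cconj h) * (v (z + h)%C - v z) + u z * (v (z + h)%C - v z - (q * h + d * Cconj h))))%C by cring.
  eapply Rle_trans; [apply Cmod_triangle|].
  eapply Rle_trans; [apply Rplus_le_compat_l, Cmod_triangle|]. rewrite !Cmod_mult.
  assert (A1 : Cmod (v (z + h)%C) <= M).
  { generalize (Cmod_le_sub (v (z + h)%C) (v z)), (Cmod_ge_0 (u z)), (Cmod_ge_0 p), (Cmod_ge_0 b). unfold M. lra. }
  assert (A2 : Cmod (p * h + b * Cconj h) <= M * Cmod h).
  { eapply Rle_trans; [apply Cmod_triangle|]. rewrite !Cmod_mult, Cmod_conj. unfold M.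
    generalize (Cmod_ge_0 h), (Cmod_ge_0 (u z)), (Cmod_ge_0 (v z)). nra. }
  assert (A3 : Cmod (u z) <= M).
  { unfold M. generalize (Cmod_ge_0 (v z)), (Cmod_ge_0 p), (Cmod_ge_0 b). lra. }
  set (x1 := Cmod (u (z + h)%C - u z - (p * h + b * Cconj h))) in *.
  set (x2 := Cmod (v (z + h)%C - v z - (q * h + d * Cconj h))) in *.
  set (x3 := Cmod (v (z + h)%C - v z)) in *. set (x4 := Cmod (p * h + b * Cconj h)) in *.
  assert (B1 : x1 * Cmod (v (z + h)%C) <= e * Cmod h * M) by (apply Rmult_le_compat; [apply Cmod_ge_0|apply Cmod_ge_0|exact H1|exact A1]).
  assert (B2 : x4 * x3 <= M * Cmod h * e) by (apply Rmult_le_compat; [apply Cmod_ge_0|apply Cmod_ge_0|exact A2|lra]).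
  assert (B3 : Cmod (u z) * x2 <= M * (e * Cmod h)) by (apply Rmult_le_compat; [apply Cmod_ge_0|apply Cmod_ge_0|exact A3|exact H2]).
  rewrite Ee. lra.
Qed.

Lemma dbar_scal (c : C) u z b : dbar u z b -> dbar (fun w => c * u w)%C z (c * b)%C.
Proof.
  intros H. apply (dbar_eq _ _ (0 * u z + c * b)%C); [cring|].
  apply (dbar_mult (fun _ => c)); [apply dbar_const|exact H].
Qed.

Lemma dbar_minus u v z b d : dbar u z b -> dbar v z d -> dbar (fun w => u w - v w)%C z (b - d)%C.
Proof.
  intros Hu Hv. apply (dbar_eq _ _ (b + RtoC (-1) * d)%C); [cring|].
  apply (dbar_ext_loc (fun w => u w + (RtoC (-1)) * v w)%C _ _ _ 1); [lra|intros; cring|].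
  apply dbar_plus, dbar_scal; assumption.
Qed.

Lemma dbar_id (z : C) : dbar (fun w => w) z (RtoC 0).
Proof.
  exists (RtoC 1). intros eps He. exists 1; split; [lra|]. intros h _.
  replace (_ - _)%C with (RtoC 0) by cring. rewrite Cmod_0. generalize (Cmod_ge_0 h); nra.
Qed.

(** The Cauchy-Riemann equation. It transfers the sum and product rules, proved once for [dbar], to
    complex differentiability. *)
Lemma holo_dbar f z : Cdiff1 f z <-> dbar f z (RtoC 0).
Proof.
  split; intros (a & H); exists a; intros eps He; destruct (H eps He) as (d & Hd & K);
    exists d; split; try assumption; intros h Hh; specialize (K h Hh).
  - replace (a * h + 0 * Cconj h)%C with (a * h)%C by cring. exact K.
  - replace (a * h + 0 * Cconj h)%C with (a * h)%C in K by cring. exact K.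
Qed.

Lemma cont_at_inv (z : C) : z <> RtoC 0 -> cont_at (fun w => / w)%C z.
Proof.
  intros Hz eps He. assert (Hp : 0 < Cmod z) by (apply Cmod_gt_0, Hz).
  exists (Rmin (Cmod z / 2) (eps * (Cmod z) ^ 2 / 2)). split.
  { apply Rmin_glb_lt; [lra|]. assert (0 < Cmod z ^ 2) by (apply pow_lt; lra). nra. }
  intros w Hw. generalize (Rmin_l (Cmod z / 2) (eps * (Cmod z) ^ 2 / 2)), (Rmin_r (Cmod z / 2) (eps * (Cmod z) ^ 2 / 2)); intros.
  assert (Hw2 : Cmod z / 2 < Cmod w).
  { generalize (Cmod_le_sub z w). rewrite (Cmod_sub_sym z w). lra. }
  assert (Hw0 : w <> RtoC 0) by (apply Cmod_gt_0; lra).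
  replace (/ w - / z)%C with (- (w - z) * (/ w * / z))%C by (field; split; assumption).
  rewrite !Cmod_mult, Cmod_opp, !Cmod_inv by assumption.
  apply Rmult_lt_reg_r with (Cmod w * Cmod z); [apply Rmult_lt_0_compat; lra|].
  replace (Cmod (w - z) * (/ Cmod w * / Cmod z) * (Cmod w * Cmod z)) with (Cmod (w - z)) by (field; lra).
  assert (Cmod z * (Cmod z / 2) < Cmod z * Cmod w) by (apply Rmult_lt_compat_l; lra). nra.
Qed.

Lemma holo_inv (z : C) : z <> RtoC 0 -> dbar (fun w => / w)%C z (RtoC 0).
Proof.
  intros Hz. assert (Hp : 0 < Cmod z) by (apply Cmod_gt_0, Hz).
  exists (- / (z * z))%C. intros eps He.
  destruct (cont_at_inv z Hz (eps * Cmod z)) as (d & Hd & K); [apply Rmult_lt_0_compat; lra|].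
  exists (Rmin d (Cmod z)). split; [apply Rmin_glb_lt; assumption|]. intros h Hh.
  assert (Hw0 : (z + h)%C <> RtoC 0).
  { intro E. assert (h = (- z)%C) by (replace h with (z + h - z)%C by cring; rewrite E; cring).
    subst h. rewrite Cmod_opp in Hh. generalize (Rmin_r d (Cmod z)). lra. }
  specialize (K (z + h)%C). replace (z + h - z)%C with h in K by cring.
  specialize (K (Rlt_le_trans _ _ _ Hh (Rmin_l _ _))).
  replace (/ (z + h) - / z - (- / (z * z) * h + 0 * Cconj h))%C with (- (h * / z * (/ (z + h) - / z)))%C by (field; split; assumption).
  rewrite Cmod_opp, !Cmod_mult, Cmod_inv by assumption.
  apply Rmult_le_reg_r with (Cmod z); [lra|].
  replace (Cmod h * / Cmod z * Cmod (/ (z + h) - / z) * Cmod z) with (Cmod h * Cmod (/ (z + h) - / z)) by (field; lra).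
  generalize (Cmod_ge_0 h). nra.
Qed.

Lemma dbar_comp_holo_translate_inv (z w : C) : w <> z -> dbar (fun t => / (t - z))%C w (RtoC 0).
Proof.
  intros H. assert (Hn : (w - z)%C <> RtoC 0).
  { intro E. apply H. replace w with ((w - z) + z)%C by cring. rewrite E. cring. }
  destruct (holo_inv _ Hn) as (a & Ha). exists a. intros eps He. destruct (Ha eps He) as (d & Hd & K).
  exists d; split; [assumption|]. intros h Hh.
  replace (w + h - z)%C with (w - z + h)%C by cring. apply K, Hh.
Qed.

(** Slightly wider than C^1 with compact support: the z-derivative may be discontinuous, since
    Green's formula integrates the dbar derivative alone. This lets f * psi be a test function as
    soon as f is complex differentiable on the support of psi. *)
Definition test (psi dpsi : C -> C) : Prop :=
  (forall z, dbar psi z (dpsi z)) /\ acont dpsi /\ csupp psi.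

Lemma test_acont psi dpsi : test psi dpsi -> acont psi.
Proof. intros (H & _) z. apply (dbar_cont_at _ _ _ (H z)). Qed.

Lemma test_lzero psi dpsi z : test psi dpsi -> lzero psi z -> lzero dpsi z.
Proof.
  intros (H & _) (r & Hr & K). exists r; split; [assumption|]. intros w Hw.
  apply (dbar_unique_zero psi w); [|apply H]. exists (r - Cmod (w - z)). split; [lra|].
  intros t Ht. apply K. generalize (Cmod_sub_triangle t w z). lra.
Qed.

Lemma insq_closed a b l z : ~ insq a b l z ->
  exists r, 0 < r /\ forall w, Cmod (w - z) < r -> ~ insq a b l w.
Proof.
  intros Hn.
  assert (H : forall g : C -> R, (forall w, Rabs (g w - g z) <= Cmod (w - z)) -> forall c,
     c < g z -> exists r, 0 < r /\ forall w, Cmod (w - z) < r -> c < g w).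
  { intros g Hg c Hc. exists (g z - c). split; [lra|]. intros w Hw. specialize (Hg w).
    apply Rabs_le_between in Hg. lra. }
  assert (Hf : forall w, Rabs (fst w - fst z) <= Cmod (w - z)) by (intro w; apply (Cmod_fst (w - z))).
  assert (Hs : forall w, Rabs (snd w - snd z) <= Cmod (w - z)) by (intro w; apply (Cmod_snd (w - z))).
  unfold insq in *.
  destruct (Rlt_dec (fst z) a) as [h|h].
  { destruct (H (fun w => - fst w)) with (c := - a) as (r & Hr & K); [|lra|].
    - intro w. replace (- fst w - - fst z) with (- (fst w - fst z)) by ring. rewrite Rabs_Ropp; apply Hf.
    - exists r; split; [assumption|]. intros w Hw. specialize (K w Hw). lra. }
  destruct (Rlt_dec (a + l) (fst z)) as [h'|h'].
  { destruct (H (fun w => fst w)) with (c := a + l) as (r & Hr & K); [apply Hf|lra|].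
    exists r; split; [assumption|]. intros w Hw. specialize (K w Hw). lra. }
  destruct (Rlt_dec (snd z) b) as [h2|h2].
  { destruct (H (fun w => - snd w)) with (c := - b) as (r & Hr & K); [|lra|].
    - intro w. replace (- snd w - - snd z) with (- (snd w - snd z)) by ring. rewrite Rabs_Ropp; apply Hs.
    - exists r; split; [assumption|]. intros w Hw. specialize (K w Hw). lra. }
  destruct (Rlt_dec (b + l) (snd z)) as [h3|h3].
  { destruct (H (fun w => snd w)) with (c := b + l) as (r & Hr & K); [apply Hs|lra|].
    exists r; split; [assumption|]. intros w Hw. specialize (K w Hw). lra. }
  exfalso. apply Hn. lra.
Qed.

Lemma supp_in_lzero a b l u z : supp_in a b l u -> ~ insq a b l z -> lzero u z.
Proof.
  intros Hs Hz. destruct (insq_closed _ _ _ _ Hz) as (r & Hr & K). exists r; split; [assumption|].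
  intros w Hw. apply Hs, K, Hw.
Qed.

Lemma test_supp_in a b l psi dpsi : test psi dpsi -> supp_in a b l psi -> supp_in a b l dpsi.
Proof.
  intros Ht Hs z Hz. apply lzero_at. apply (test_lzero psi); [assumption|]. eapply supp_in_lzero; eassumption.
Qed.

Lemma test_csupp psi dpsi : test psi dpsi -> csupp dpsi.
Proof.
  intros Ht. destruct (Ht) as (_ & _ & r & Hr & Hs). exists r; split; [assumption|].
  eapply test_supp_in; eassumption.
Qed.

Lemma Pint_dbar psi dpsi : test psi dpsi -> Pint dpsi = RtoC 0.
Proof.
  intros Ht. pose proof (test_csupp _ _ Ht) as Hc. destruct (Ht) as (Hd & Ha & r & Hr & Hs).
  (* Enlarging the box by 1 makes psi vanish on its whole boundary, so the contour side of Green's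
     formula is 0. *)
  rewrite (Pint_eq (- (r + 1)) (- (r + 1)) (2 * (r + 1))); [|lra|assumption|].
  2: { apply (test_supp_in _ _ _ psi); [assumption|]. intros z Hz. apply Hs. unfold insq in *. lra. }
  pose proof (goursat_green (- (r + 1)) (- (r + 1)) (2 * (r + 1)) psi dpsi) as G.
  rewrite <- (Cmult_1_l (Isq _ _ _ _)). replace (RtoC 1) with (/ (2 * Ci) * (2 * Ci))%C.
  2: { apply Cinv_l. intro E. apply (f_equal snd) in E. simpl in E. lra. }
  rewrite <- Cmult_assoc, <- G by (try assumption; lra).
  assert (E : edge (- (r + 1)) (- (r + 1)) (2 * (r + 1)) psi = RtoC 0).
  { unfold edge. rewrite !cint_zero; try cring; try lra; intros t _; apply Hs; unfold insq; simpl; lra. }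
  rewrite E. ring.
Qed.

(** * Spline bumps *)

(** C^(1,1) with one constant for the whole line. The class contains the truncated square, is stable
    under sums and affine substitutions, and directly gives the real differentiability of a bump and
    the continuity of its dbar derivative. *)
Definition smooth1 (g g' : R -> R) : Prop :=
  exists K, 0 <= K /\ forall x h,
    Rabs (g (x + h) - g x - g' x * h) <= K * h ^ 2 /\ Rabs (g' (x + h) - g' x) <= K * Rabs h.

Lemma smooth1_plus g g' f f' : smooth1 g g' -> smooth1 f f' ->
  smooth1 (fun x => g x + f x) (fun x => g' x + f' x).
Proof.
  intros (K & HK & H) (L & HL & G). exists (K + L). split; [lra|]. intros x h.
  destruct (H x h) as [H1 H2], (G x h) as [G1 G2]. split.
  - replace (_ - _ - _) with ((g (x + h) - g x - g' x * h) + (f (x + h) - f x - f' x * h)) by ring.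
    eapply Rle_trans; [apply Rabs_triang|]. lra.
  - replace (_ - _) with ((g' (x + h) - g' x) + (f' (x + h) - f' x)) by ring.
    eapply Rle_trans; [apply Rabs_triang|]. lra.
Qed.

Lemma smooth1_scal c g g' : smooth1 g g' -> smooth1 (fun x => c * g x) (fun x => c * g' x).
Proof.
  intros (K & HK & H). exists (Rabs c * K). split; [generalize (Rabs_pos c); nra|]. intros x h.
  destruct (H x h) as [H1 H2]. split.
  - replace (_ - _ - _) with (c * (g (x + h) - g x - g' x * h)) by ring.
    rewrite Rabs_mult, Rmult_assoc. apply Rmult_le_compat_l; [apply Rabs_pos|assumption].
  - replace (_ - _) with (c * (g' (x + h) - g' x)) by ring.
    rewrite Rabs_mult, Rmult_assoc. apply Rmult_le_compat_l; [apply Rabs_pos|assumption].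
Qed.

Lemma smooth1_affine a s g g' : smooth1 g g' ->
  smooth1 (fun x => g ((x - a) / s)) (fun x => g' ((x - a) / s) / s).
Proof.
  intros (K & HK & H). exists (K * (/ s) ^ 2). split; [generalize (pow2_ge_0 (/ s)); nra|]. intros x h.
  destruct (H ((x - a) / s) (h / s)) as [H1 H2].
  replace ((x + h - a) / s) with ((x - a) / s + h / s) by (unfold Rdiv; ring). split.
  - replace (K * (/ s) ^ 2 * h ^ 2) with (K * (h / s) ^ 2) by (unfold Rdiv; ring).
    replace (g' ((x - a) / s) / s * h) with (g' ((x - a) / s) * (h / s)) by (unfold Rdiv; ring). exact H1.
  - replace (_ - _) with ((g' ((x - a) / s + h / s) - g' ((x - a) / s)) * / s) by (unfold Rdiv; ring).
    rewrite Rabs_mult. unfold Rdiv in H2 at 4. rewrite Rabs_mult in H2.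
    rewrite <- (pow2_abs (/ s)).
    replace (K * Rabs (/ s) ^ 2 * Rabs h) with (K * (Rabs h * Rabs (/ s)) * Rabs (/ s)) by ring.
    apply Rmult_le_compat_r; [apply Rabs_pos|]. exact H2.
Qed.

Definition hsq (x : R) : R := Rmax 0 x ^ 2.

Ltac rmax := unfold Rmax in *; repeat match goal with
  | |- context [Rle_dec ?a ?b] => destruct (Rle_dec a b)
  | H : context [Rle_dec ?a ?b] |- _ => destruct (Rle_dec a b) end.

Lemma smooth1_hsq : smooth1 hsq (fun x => 2 * Rmax 0 x).
Proof.
  exists 2. split; [lra|]. intros x h. unfold hsq. split.
  - apply Rabs_le; split; rmax; nra.
  - unfold Rabs; destruct (Rcase_abs h); rmax; destruct (Rcase_abs _); lra.
Qed.

(* A quadratic C^1 spline from 0 to 1 on [0,1]; the redundant shifts and divisions match [smooth1_affine]. *)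
Definition ramp (x : R) : R := 2 * hsq ((x - 0) / 1) + (-4 * hsq ((x - / 2) / 1) + 2 * hsq ((x - 1) / 1)).
Definition dramp (x : R) : R :=
  2 * (2 * Rmax 0 ((x - 0) / 1) / 1) + (-4 * (2 * Rmax 0 ((x - / 2) / 1) / 1) + 2 * (2 * Rmax 0 ((x - 1) / 1) / 1)).

Lemma smooth1_ramp : smooth1 ramp dramp.
Proof.
  unfold ramp, dramp.
  apply smooth1_plus; [|apply smooth1_plus]; apply smooth1_scal;
    apply (smooth1_affine _ _ hsq (fun x => 2 * Rmax 0 x)), smooth1_hsq.
Qed.

Lemma ramp_unfold x : ramp x = 2 * Rmax 0 x ^ 2 - 4 * Rmax 0 (x - / 2) ^ 2 + 2 * Rmax 0 (x - 1) ^ 2.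
Proof. unfold ramp, hsq. unfold Rdiv; rewrite Rinv_1, !Rmult_1_r, Rminus_0_r. ring. Qed.

Lemma dramp_unfold x : dramp x = 4 * Rmax 0 x - 8 * Rmax 0 (x - / 2) + 4 * Rmax 0 (x - 1).
Proof. unfold dramp. unfold Rdiv; rewrite Rinv_1, !Rmult_1_r, Rminus_0_r. ring. Qed.

Lemma ramp_0 x : x <= 0 -> ramp x = 0 /\ dramp x = 0.
Proof. intros; rewrite ramp_unfold, dramp_unfold; rmax; split; nra. Qed.

Lemma ramp_1 x : 1 <= x -> ramp x = 1 /\ dramp x = 0.
Proof. intros; rewrite ramp_unfold, dramp_unfold; rmax; split; nra. Qed.

Lemma ramp_range x : 0 <= ramp x <= 1.
Proof. rewrite ramp_unfold; rmax; nra. Qed.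

Lemma ramp_pos x : 0 < x -> 0 < ramp x.
Proof. intros; rewrite ramp_unfold; rmax; nra. Qed.

Lemma ramp_lt_1 x : x < 1 -> ramp x < 1.
Proof. intros; rewrite ramp_unfold; rmax; nra. Qed.

Lemma dramp_range x : 0 <= dramp x <= 2.
Proof. rewrite dramp_unfold; rmax; lra. Qed.

(** A definite slope on a definite interval; it yields a square on which the integrand of [ckern] is
    bounded away from 0. *)
Lemma dramp_mid x : / 4 <= x <= 3 / 4 -> 1 <= dramp x.
Proof. intros; rewrite dramp_unfold; rmax; lra. Qed.

Definition plateau (x : R) : R := ramp ((x - -2) / 1) + -1 * ramp ((x - 1) / 1).
Definition dplateau (x : R) : R := dramp ((x - -2) / 1) / 1 + -1 * (dramp ((x - 1) / 1) / 1).

(** The difference of two consecutive translates of [ramp], so that integer translates of [hat]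
    telescope to a partition of unity. The spelling with [-1 *] and [/ 1] again follows the closure
    lemmas for [smooth1]. *)
Definition hat (x : R) : R := ramp ((x - -1) / 1) + -1 * ramp ((x - 0) / 1).
Definition dhat (x : R) : R := dramp ((x - -1) / 1) / 1 + -1 * (dramp ((x - 0) / 1) / 1).

Lemma plateau_unfold x : plateau x = ramp (x + 2) - ramp (x - 1).
Proof. unfold plateau. unfold Rdiv; rewrite Rinv_1, !Rmult_1_r. replace (x - -2) with (x + 2) by ring. ring. Qed.

Lemma dplateau_unfold x : dplateau x = dramp (x + 2) - dramp (x - 1).
Proof. unfold dplateau. unfold Rdiv; rewrite Rinv_1, !Rmult_1_r. replace (x - -2) with (x + 2) by ring. ring. Qed.

Lemma hat_unfold x : hat x = ramp (x + 1) - ramp x.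
Proof. unfold hat. unfold Rdiv; rewrite Rinv_1, !Rmult_1_r, Rminus_0_r. replace (x - -1) with (x + 1) by ring. ring. Qed.

Lemma dhat_unfold x : dhat x = dramp (x + 1) - dramp x.
Proof. unfold dhat. unfold Rdiv; rewrite Rinv_1, !Rmult_1_r, Rminus_0_r. replace (x - -1) with (x + 1) by ring. ring. Qed.

Lemma smooth1_plateau : smooth1 plateau dplateau.
Proof. unfold plateau, dplateau. apply smooth1_plus; [|apply (smooth1_scal (-1))]; apply smooth1_affine, smooth1_ramp. Qed.

Lemma smooth1_hat : smooth1 hat dhat.
Proof. unfold hat, dhat. apply smooth1_plus; [|apply (smooth1_scal (-1))]; apply smooth1_affine, smooth1_ramp. Qed.

Lemma plateau_one x : Rabs x <= 1 -> plateau x = 1 /\ dplateau x = 0.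
Proof.
  intros H. apply Rabs_le_between in H. rewrite plateau_unfold, dplateau_unfold.
  destruct (ramp_1 (x + 2)) as [-> ->]; [lra|]. destruct (ramp_0 (x - 1)) as [-> ->]; lra.
Qed.

Lemma plateau_zero x : 2 <= Rabs x -> plateau x = 0 /\ dplateau x = 0.
Proof.
  intros H. rewrite plateau_unfold, dplateau_unfold. unfold Rabs in H; destruct (Rcase_abs x).
  - destruct (ramp_0 (x + 2)) as [-> ->]; [lra|]. destruct (ramp_0 (x - 1)) as [-> ->]; lra.
  - destruct (ramp_1 (x + 2)) as [-> ->]; [lra|]. destruct (ramp_1 (x - 1)) as [-> ->]; lra.
Qed.

Lemma plateau_range x : 0 <= plateau x <= 1.
Proof.
  rewrite plateau_unfold. generalize (ramp_range (x + 2)), (ramp_range (x - 1)); intros.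
  destruct (Rle_dec x 1) as [h|h].
  - destruct (ramp_0 (x - 1)) as [-> _]; lra.
  - destruct (ramp_1 (x + 2)) as [-> _]; lra.
Qed.

Lemma plateau_pos x : -2 < x < 2 -> 0 < plateau x.
Proof.
  intros H. rewrite plateau_unfold. destruct (Rle_dec x 1) as [h|h].
  - destruct (ramp_0 (x - 1)) as [-> _]; [lra|]. generalize (ramp_pos (x + 2)). lra.
  - destruct (ramp_1 (x + 2)) as [-> _]; [lra|]. generalize (ramp_lt_1 (x - 1)). lra.
Qed.

Lemma dplateau_range x : Rabs (dplateau x) <= 2.
Proof. rewrite dplateau_unfold. generalize (dramp_range (x + 2)), (dramp_range (x - 1)). intros; apply Rabs_le; lra. Qed.

(** The cutoff decreases outwards. This gives the real part of [dkern] at the origin a constant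
    sign. *)
Lemma dplateau_sign x : x * dplateau x <= 0.
Proof.
  rewrite dplateau_unfold. generalize (dramp_range (x + 2)), (dramp_range (x - 1)); intros.
  destruct (Rle_dec x 0).
  - destruct (ramp_0 (x - 1)) as [_ ->]; [lra|]. nra.
  - destruct (ramp_1 (x + 2)) as [_ ->]; [lra|]. nra.
Qed.

Lemma hat_zero x : 1 <= Rabs x -> hat x = 0 /\ dhat x = 0.
Proof.
  intros H. rewrite hat_unfold, dhat_unfold. unfold Rabs in H; destruct (Rcase_abs x).
  - destruct (ramp_0 (x + 1)) as [-> ->]; [lra|]. destruct (ramp_0 x) as [-> ->]; lra.
  - destruct (ramp_1 (x + 1)) as [-> ->]; [lra|]. destruct (ramp_1 x) as [-> ->]; lra.
Qed.

Lemma hat_range x : 0 <= hat x <= 1.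
Proof.
  rewrite hat_unfold. generalize (ramp_range (x + 1)), (ramp_range x); intros.
  destruct (Rle_dec x 0) as [h|h].
  - destruct (ramp_0 x) as [-> _]; lra.
  - destruct (ramp_1 (x + 1)) as [-> _]; lra.
Qed.

Lemma dhat_range x : Rabs (dhat x) <= 2.
Proof. rewrite dhat_unfold. generalize (dramp_range (x + 1)), (dramp_range x). intros; apply Rabs_le; lra. Qed.

Definition bump (g : R -> R) (c : C) (s : R) (z : C) : C :=
  RtoC (g ((fst z - fst c) / s) * g ((snd z - snd c) / s)).

(** Half of d/dx + i d/dy applied to the product [bump g c s]. *)
Definition dbump (g g' : R -> R) (c : C) (s : R) (z : C) : C :=
  ((g' ((fst z - fst c) / s) / s * g ((snd z - snd c) / s) / 2)%R,
   (g ((fst z - fst c) / s) * (g' ((snd z - snd c) / s) / s) / 2)%R).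

(** Treats the two coordinates at once: a real linear form is conj(b) h + b conj(h), with b = 1/2
    for the real part and b = i/2 for the imaginary part. *)
Lemma dbar_real_part (pr : C -> R) (b : C) g g' z : (forall w h, pr (w + h)%C = pr w + pr h) ->
  (forall h, Rabs (pr h) <= Cmod h) -> (forall h, RtoC (pr h) = (Cconj b * h + b * Cconj h)%C) -> smooth1 g g' ->
  dbar (fun w => RtoC (g (pr w))) z (RtoC (g' (pr z)) * b)%C.
Proof.
  intros Hadd Hle Hpr (K & HK & H). exists (RtoC (g' (pr z)) * Cconj b)%C. intros eps He. exists (eps / (K + 1)).
  split; [apply Rdiv_lt_0_compat; lra|]. intros h Hh.
  destruct (H (pr z) (pr h)) as [H1 _]. apply Rlt_div_mult in Hh; [|lra].
  replace (_ - _)%C with (RtoC (g (pr z + pr h) - g (pr z) - g' (pr z) * pr h)).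
  2: { rewrite Hadd, !RtoC_minus, RtoC_mult, Hpr. ring. }
  rewrite Cmod_R. eapply Rle_trans; [exact H1|]. rewrite <- pow2_abs.
  assert (Rabs (pr h) ^ 2 <= Cmod h ^ 2) by (apply pow_incr; split; [apply Rabs_pos|apply Hle]).
  generalize (Cmod_ge_0 h). nra.
Qed.

Lemma acont_real_part (pr : C -> R) g : (forall w z, Rabs (pr w - pr z) <= Cmod (w - z)) ->
  (exists K, 0 <= K /\ forall x h, Rabs (g (x + h) - g x) <= K * Rabs h) -> acont (fun w => RtoC (g (pr w))).
Proof.
  intros Hle (K & HK & H) z eps He. exists (eps / (K + 1)).
  split; [apply Rdiv_lt_0_compat; lra|]. intros w Hw. apply Rlt_div_mult in Hw; [|lra].
  rewrite <- RtoC_minus, Cmod_R. specialize (H (pr z) (pr w - pr z)). specialize (Hle w z).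
  replace (pr z + (pr w - pr z)) with (pr w) in H by ring.
  generalize (Rabs_pos (pr w - pr z)). nra.
Qed.

Lemma dbar_fst g g' z : smooth1 g g' -> dbar (fun w => RtoC (g (fst w))) z (RtoC (g' (fst z) / 2)).
Proof.
  intros Hg. eapply dbar_eq; [|apply (dbar_real_part fst (RtoC (/ 2)) g g'); [reflexivity|apply Cmod_fst| |exact Hg]].
  - apply C_ext; simpl; field.
  - intro h. apply C_ext; simpl; field.
Qed.

Lemma dbar_snd g g' z : smooth1 g g' -> dbar (fun w => RtoC (g (snd w))) z (Ci * RtoC (g' (snd z) / 2))%C.
Proof.
  intros Hg. eapply dbar_eq; [|apply (dbar_real_part snd (Ci * RtoC (/ 2))%C g g'); [reflexivity|apply Cmod_snd| |exact Hg]].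
  - apply C_ext; simpl; field.
  - intro h. apply C_ext; simpl; field.
Qed.

Lemma bump_supp g c s r : 0 < s -> (forall x, r <= Rabs x -> g x = 0) ->
  supp_in (fst c - r * s) (snd c - r * s) (2 * r * s) (bump g c s).
Proof.
  intros Hs H z Hz. unfold bump.
  assert (Hx : forall x c : R, ~ (c - r * s <= x <= c - r * s + 2 * r * s) -> g ((x - c) / s) = 0).
  { intros x d Hx. apply H. apply Rnot_lt_le; intro Ha. apply Hx.
    assert (Hb : Rabs (x - d) < r * s).
    { unfold Rdiv in Ha. rewrite Rabs_mult, (Rabs_right (/ s)) in Ha.
      2: { left. apply Rinv_0_lt_compat, Hs. }
      apply Rmult_lt_compat_r with (r := s) in Ha; [|assumption].
      rewrite Rmult_assoc, Rinv_l, Rmult_1_r in Ha by lra. exact Ha. }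
    apply Rabs_lt_between in Hb. lra. }
  unfold insq in Hz. apply not_and_or in Hz. destruct Hz as [Hz|Hz]; rewrite (Hx _ _ Hz).
  - rewrite Rmult_0_l. reflexivity.
  - rewrite Rmult_0_r. reflexivity.
Qed.

Lemma bump_test g g' c s r : 0 < s -> 0 < r -> smooth1 g g' -> (forall x, r <= Rabs x -> g x = 0) ->
  test (bump g c s) (dbump g g' c s).
Proof.
  intros Hs Hr Hg H.
  pose proof (smooth1_affine (fst c) s g g' Hg) as Gx. pose proof (smooth1_affine (snd c) s g g' Hg) as Gy.
  assert (Hlip : forall f f' : R -> R, smooth1 f f' -> exists K, 0 <= K /\ forall x h, Rabs (f' (x + h) - f' x) <= K * Rabs h).
  { intros f f' (K & HK0 & HK). exists K. split; [exact HK0|]. intros x h. apply HK. }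
  assert (D1 : forall z, dbar (fun w => RtoC (g ((fst w - fst c) / s))) z (RtoC (g' ((fst z - fst c) / s)%R / s / 2)%R)).
  { intro z. apply (dbar_fst (fun x => g ((x - fst c) / s)) _ z Gx). }
  assert (D2 : forall z, dbar (fun w => RtoC (g ((snd w - snd c) / s))) z (Ci * RtoC (g' ((snd z - snd c) / s)%R / s / 2)%R)%C).
  { intro z. apply (dbar_snd (fun x => g ((x - snd c) / s)) _ z Gy). }
  assert (Efun : forall z, bump g c s z = (RtoC (g ((fst z - fst c) / s)%R) * RtoC (g ((snd z - snd c) / s)%R))%C).
  { intro z. unfold bump. rewrite RtoC_mult. reflexivity. }
  split; [|split].
  - intro z.
    apply (dbar_ext_loc (fun z => RtoC (g ((fst z - fst c) / s)%R) * RtoC (g ((snd z - snd c) / s)%R))%C _ _ _ 1); [lra| |].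
    { intros; symmetry; apply Efun. }
    eapply dbar_eq; [|apply dbar_mult; [apply D1|apply D2]].
    unfold dbump. apply C_ext; simpl; unfold Rdiv; ring.
  - apply (acont_ext (fun z => RtoC (g' ((fst z - fst c) / s)%R / s)%R * (RtoC (/ 2) * RtoC (g ((snd z - snd c) / s)%R))
       + RtoC (g' ((snd z - snd c) / s)%R / s)%R * ((Ci * RtoC (/ 2)) * RtoC (g ((fst z - fst c) / s)%R)))%C).
    { intro z. unfold dbump. apply C_ext; simpl; unfold Rdiv; ring. }
    apply acont_plus; apply acont_mult.
    + apply (acont_real_part fst (fun x => g' ((x - fst c) / s) / s)); [intros w z; apply (Cmod_fst (w - z))|apply (Hlip _ _ Gx)].
    + apply acont_scal. intro z; apply (dbar_cont_at _ _ _ (D2 z)).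
    + apply (acont_real_part snd (fun x => g' ((x - snd c) / s) / s)); [intros w z; apply (Cmod_snd (w - z))|apply (Hlip _ _ Gy)].
    + apply acont_scal. intro z; apply (dbar_cont_at _ _ _ (D1 z)).
  - apply (supp_in_csupp (fst c - r * s) (snd c - r * s) (2 * r * s)); [nra|]. apply bump_supp; assumption.
Qed.

Lemma bump_range g c s z : (forall x, 0 <= g x <= 1) -> 0 <= fst (bump g c s z) <= 1.
Proof.
  intros H. unfold bump; simpl. generalize (H ((fst z - fst c) / s)), (H ((snd z - snd c) / s)). nra.
Qed.

Lemma bump_mod g c s z : (forall x, 0 <= g x <= 1) -> Cmod (bump g c s z) <= 1.
Proof.
  intros H. pose proof (bump_range g c s z H) as B. unfold bump in *; simpl in B.
  rewrite Cmod_R. rewrite Rabs_right; lra.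
Qed.

Lemma dbump_mod g g' c s z : 0 < s -> (forall x, 0 <= g x <= 1) -> (forall x, Rabs (g' x) <= 2) ->
  Cmod (dbump g g' c s z) <= 2 / s.
Proof.
  intros Hs H H'. replace (2 / s) with (2 * (1 / s)) by (field; lra). 
  assert (E : forall x y, Rabs (g' x / s * g y / 2) <= 1 / s).
  { intros x y. replace (g' x / s * g y / 2) with (g' x * g y / 2 * / s) by (field; lra).
    rewrite Rabs_mult, (Rabs_right (/ s)). 2: { left. apply Rinv_0_lt_compat, Hs. }
    apply Rmult_le_compat_r; [left; apply Rinv_0_lt_compat, Hs|].
    unfold Rdiv. rewrite !Rabs_mult, (Rabs_right (/ 2)), (Rabs_right (g y)) by (generalize (H y); lra).
    generalize (H' x), (H y), (Rabs_pos (g' x)). nra. }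
  apply Cmod_le_max; unfold dbump; simpl; [apply E|].
  rewrite (Rmult_comm (g _)). apply E.
Qed.

(** * The truncated Cauchy kernel *)

Definition cutoff := bump plateau.
Definition dcutoff := dbump plateau dplateau.

Lemma cutoff_test c s : 0 < s -> test (cutoff c s) (dcutoff c s).
Proof.
  intros. apply (bump_test _ _ _ _ 2); [assumption|lra|apply smooth1_plateau|]. intros; apply plateau_zero; assumption.
Qed.

(** Squares instead of discs, since the bumps are products of functions of one coordinate. The
    square contains the disc of radius r and lies in the disc of radius 2r. *)
Definition ksq (c : C) (r : R) (z : C) : Prop := Rabs (fst z - fst c) <= r /\ Rabs (snd z - snd c) <= r.

Lemma ksq_insq c r z : ksq c r z <-> insq (fst c - r) (snd c - r) (2 * r) z.
Proof.
  unfold ksq, insq. split.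
  - intros [H1 H2]. apply Rabs_le_between in H1. apply Rabs_le_between in H2. lra.
  - intros [H1 H2]. split; apply Rabs_le; lra.
Qed.

Lemma ksq_mod c r z : ksq c r z -> Cmod (z - c) <= 2 * r.
Proof. intros [H1 H2]. apply Cmod_le_max; assumption. Qed.

Lemma mod_ksq c r z : Cmod (z - c) <= r -> ksq c r z.
Proof.
  intros H. split.
  - eapply Rle_trans; [apply (Cmod_fst (z - c))|exact H].
  - eapply Rle_trans; [apply (Cmod_snd (z - c))|exact H].
Qed.

Lemma not_ksq_mod c r z : ~ ksq c r z -> r < Cmod (z - c).
Proof. intros H. apply Rnot_le_lt; intro K. apply H, mod_ksq, K. Qed.

Lemma Rabs_div_le x s r : 0 < s -> (Rabs (x / s) <= r <-> Rabs x <= r * s).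
Proof.
  intros Hs. unfold Rdiv. rewrite Rabs_mult, (Rabs_right (/ s)) by (left; apply Rinv_0_lt_compat, Hs). split; intro H.
  - apply Rmult_le_compat_r with (r := s) in H; [|lra]. rewrite Rmult_assoc, Rinv_l, Rmult_1_r in H by lra. exact H.
  - apply Rmult_le_reg_r with s; [lra|]. rewrite Rmult_assoc, Rinv_l, Rmult_1_r by lra. exact H.
Qed.

Lemma cutoff_one c s z : 0 < s -> ksq c s z -> cutoff c s z = RtoC 1 /\ dcutoff c s z = RtoC 0.
Proof.
  intros Hs [H1 H2]. unfold cutoff, dcutoff, bump, dbump.
  destruct (plateau_one ((fst z - fst c) / s)) as [-> ->]; [apply Rabs_div_le; lra|].
  destruct (plateau_one ((snd z - snd c) / s)) as [-> ->]; [apply Rabs_div_le; lra|].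
  split; apply C_ext; simpl; unfold Rdiv; ring.
Qed.

Lemma cutoff_supp c s : 0 < s -> supp_in (fst c - 2 * s) (snd c - 2 * s) (2 * 2 * s) (cutoff c s).
Proof. intros. apply bump_supp; [assumption|]. intros; apply plateau_zero; assumption. Qed.

(** The first factor vanishes near z, so the default value of the inverse at 0 does not matter and
    [kern] is differentiable everywhere. As s tends to 0, [dkern] acts as an approximate identity at
    z of total mass [ckern]. *)
Definition kern (z : C) (s : R) (w : C) : C := ((1 - cutoff z s w) * / (w - z))%C.
Definition dkern (z : C) (s : R) (w : C) : C := (- dcutoff z s w * / (w - z))%C.

Lemma kern_near z s w : 0 < s -> ksq z s w -> kern z s w = RtoC 0 /\ dkern z s w = RtoC 0.
Proof. intros Hs H. unfold kern, dkern. destruct (cutoff_one z s w Hs H) as [-> ->]. split; cring. Qed.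

Lemma kern_lzero z s : 0 < s -> lzero (kern z s) z /\ lzero (dkern z s) z.
Proof.
  intros Hs. split; exists s; (split; [assumption|]); intros w Hw; apply kern_near;
    try assumption; apply mod_ksq; lra.
Qed.

Lemma cutoff_far c s z : 0 < s -> ~ ksq c (2 * s) z -> cutoff c s z = RtoC 0 /\ dcutoff c s z = RtoC 0.
Proof.
  intros Hs H. assert (H' : ~ insq (fst c - 2 * s) (snd c - 2 * s) (2 * 2 * s) z).
  { intro K. apply H. apply ksq_insq. replace (2 * (2 * s)) with (2 * 2 * s) by ring. exact K. }
  split; [apply cutoff_supp; assumption|].
  apply (test_supp_in _ _ _ _ _ (cutoff_test c s Hs) (cutoff_supp c s Hs)); assumption.
Qed.

Lemma kern_far z s w : 0 < s -> ~ ksq z (2 * s) w -> kern z s w = (/ (w - z))%C /\ dkern z s w = RtoC 0.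
Proof. intros Hs H. unfold kern, dkern. destruct (cutoff_far z s w Hs H) as [-> ->]. split; ring. Qed.

Lemma dkern_supp z s : 0 < s -> supp_in (fst z - 2 * s) (snd z - 2 * s) (2 * (2 * s)) (dkern z s).
Proof. intros Hs w Hw. apply kern_far; [assumption|]. intro K. apply Hw, ksq_insq, K. Qed.

Lemma kern_dbar z s : 0 < s -> forall w, dbar (kern z s) w (dkern z s w).
Proof.
  intros Hs w. destruct (classic (w = z)) as [->|Hn].
  - destruct (kern_lzero z s Hs) as [H1 H2]. rewrite (lzero_at _ _ H2).
    destruct H1 as (r & Hr & H). apply (dbar_ext_loc (fun _ => RtoC 0) _ _ _ r); [assumption| |apply dbar_const].
    intros t Ht. rewrite H; auto.
  - unfold kern, dkern. destruct (cutoff_test z s Hs) as (Hd & _).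
    eapply dbar_eq; [|apply (dbar_mult (fun w => 1 - cutoff z s w)%C (fun w => / (w - z))%C);
      [apply (dbar_minus (fun _ => RtoC 1)); [apply dbar_const|apply Hd]|apply dbar_comp_holo_translate_inv, Hn]].
    cbv beta. ring.
Qed.

Lemma cont_at_inv_sub z w : w <> z -> cont_at (fun t => / (t - z))%C w.
Proof. intros H. apply (dbar_cont_at _ _ _ (dbar_comp_holo_translate_inv z w H)). Qed.

Lemma kern_acont z s : 0 < s -> acont (kern z s).
Proof. intros Hs w. apply (dbar_cont_at _ _ _ (kern_dbar z s Hs w)). Qed.

Lemma dkern_acont z s : 0 < s -> acont (dkern z s).
Proof.
  intros Hs w. destruct (classic (w = z)) as [->|Hn].
  - apply lzero_cont_at, kern_lzero, Hs.
  - unfold dkern. apply (cont_at_mult (fun w => - dcutoff z s w)%C); [|apply cont_at_inv_sub, Hn].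
    apply (cont_at_ext_loc (fun w => RtoC (-1) * dcutoff z s w)%C _ _ 1); [lra|intros; cring|].
    apply acont_scal. apply (cutoff_test z s Hs).
Qed.

Lemma kern_mod z s w : 0 < s -> Cmod (kern z s w) <= 1 / s.
Proof.
  intros Hs. destruct (classic (ksq z s w)) as [H|H].
  - destruct (kern_near z s w Hs H) as [-> _]. rewrite Cmod_0. apply Rlt_le, Rdiv_lt_0_compat; lra.
  - apply not_ksq_mod in H. unfold kern. rewrite Cmod_mult, Cmod_inv.
    2: { apply Cmod_gt_0. lra. }
    replace (1 / s) with (1 * / s) by (unfold Rdiv; ring). apply Rmult_le_compat.
    + apply Cmod_ge_0.
    + left; apply Rinv_0_lt_compat; lra.
    + pose proof (bump_range plateau z s w plateau_range) as B. fold cutoff in B.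
      replace (1 - cutoff z s w)%C with (RtoC (1 - fst (cutoff z s w))).
      2: { unfold cutoff, bump. cring. }
      rewrite Cmod_R, Rabs_right; lra.
    + apply Rinv_le_contravar; lra.
Qed.

Lemma dkern_mod z s w : 0 < s -> Cmod (dkern z s w) <= 2 / s ^ 2.
Proof.
  intros Hs. destruct (classic (ksq z s w)) as [H|H].
  - destruct (kern_near z s w Hs H) as [_ ->]. rewrite Cmod_0. apply Rlt_le, Rdiv_lt_0_compat; [lra|apply pow_lt; lra].
  - apply not_ksq_mod in H. unfold dkern. rewrite Cmod_mult, Cmod_inv, Cmod_opp.
    2: { apply Cmod_gt_0. lra. }
    replace (2 / s ^ 2) with (2 / s * / s) by (field; lra). apply Rmult_le_compat.
    + apply Cmod_ge_0.
    + left; apply Rinv_0_lt_compat; lra.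
    + apply dbump_mod; [assumption|apply plateau_range|apply dplateau_range].
    + apply Rinv_le_contravar; lra.
Qed.

(* The value is pi, but only [ckern_neq_0] is needed. *)
Definition ckern : C := Pint (dkern (RtoC 0) 1).

Lemma dkern_csupp z s : 0 < s -> csupp (dkern z s).
Proof. intros. eapply supp_in_csupp; [|apply dkern_supp; assumption]. lra. Qed.

Lemma kern_diff_supp z s s' : 0 < s -> 0 < s' ->
  supp_in (fst z - 2 * Rmax s s') (snd z - 2 * Rmax s s') (2 * (2 * Rmax s s')) (fun w => kern z s w - kern z s' w)%C.
Proof.
  intros Hs Hs' w Hw.
  assert (H : ~ ksq z (2 * Rmax s s') w) by (intro K; apply Hw, ksq_insq, K).
  generalize (Rmax_l s s'), (Rmax_r s s'); intros.
  destruct (kern_far z s w) as [-> _]; [assumption| |].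
  { intros [K1 K2]. apply H. split; lra. }
  destruct (kern_far z s' w) as [-> _]; [assumption| |cring].
  intros [K1 K2]. apply H. split; lra.
Qed.

(** Two kernels with the same pole agree far away, so their difference is a test function and its
    dbar derivative has integral 0. The pole itself is moved by a translation. *)
Lemma Pint_dkern z s : 0 < s -> Pint (dkern z s) = ckern.
Proof.
  intros Hs.
  assert (E1 : Pint (dkern z 1) = ckern).
  { unfold ckern. rewrite <- (Pint_translate (dkern (RtoC 0) 1) z).
    - apply Pint_ext. intro w. unfold dkern, dcutoff, dbump. simpl.
      rewrite !Rminus_0_r. do 2 f_equal. cring.
    - apply dkern_acont; lra.
    - apply dkern_csupp; lra. }
  rewrite <- E1.
  assert (E : Pint (fun w => dkern z s w - dkern z 1 w)%C = RtoC 0).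
  { apply (Pint_dbar (fun w => kern z s w - kern z 1 w)%C). split; [|split].
    - intro w. apply dbar_minus; apply kern_dbar; lra.
    - apply acont_minus; apply dkern_acont; lra.
    - eapply supp_in_csupp; [|apply kern_diff_supp; lra]. generalize (Rmax_l s 1); lra. }
  rewrite Pint_minus in E; try apply dkern_acont; try apply dkern_csupp; try lra.
  replace (Pint (dkern z s)) with ((Pint (dkern z s) - Pint (dkern z 1)) + Pint (dkern z 1))%C by cring.
  rewrite E. cring.
Qed.

Lemma Pint_fst_nonneg u : acont u -> csupp u -> (forall z, 0 <= fst (u z)) -> 0 <= fst (Pint u).
Proof.
  intros Hu Su H. destruct (Pint_box u Hu Su) as (r & Hr & K). destruct (K r (Rle_refl _)) as [_ ->].
  unfold Isq. simpl. apply RInt_ge_0; [lra| |].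
  - apply (rcont_ex_fst (fun y => cint (fun x => u (x, y)) (- r) (- r + 2 * r))). apply rcont_row_int; [assumption|lra].
  - intros y _. simpl. apply RInt_ge_0; [lra| |intros; apply H].
    apply (rcont_ex_fst (fun x => u (x, y))). apply rcont_row, Hu.
Qed.

Lemma Pint_cutoff_pos c s : 0 < s -> 0 < fst (Pint (cutoff c s)).
Proof.
  intros Hs. pose proof (test_acont _ _ (cutoff_test c s Hs)) as Ha.
  rewrite (Pint_eq (fst c - 2 * s) (snd c - 2 * s) (2 * 2 * s)); [|lra|assumption|apply cutoff_supp; assumption].
  unfold Isq; simpl.
  assert (Hp : forall x d : R, d - 2 * s < x < d - 2 * s + 2 * 2 * s -> 0 < plateau ((x - d) / s)).
  { intros x d Hx. apply plateau_pos. split.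
    - apply Rmult_lt_reg_r with s; [lra|]. unfold Rdiv; rewrite Rmult_assoc, Rinv_l; lra.
    - apply Rmult_lt_reg_r with s; [lra|]. unfold Rdiv; rewrite Rmult_assoc, Rinv_l; lra. }
  apply RInt_gt_0; [lra| |].
  - intros y Hy. apply RInt_gt_0; [lra| |].
    + intros x Hx. unfold cutoff, bump; simpl. apply Rmult_lt_0_compat; apply Hp; assumption.
    + intros x _. apply (rcont_fst (fun x => cutoff c s (x, y))), rcont_row, Ha.
  - intros y _. apply (rcont_fst (fun y => cint (fun x => cutoff c s (x, y)) (fst c - 2 * s) (fst c - 2 * s + 2 * 2 * s))).
    apply rcont_row_int; [assumption|lra].
Qed.

(** The real part of the integrand is nonnegative by [dplateau_sign], and around the point 3/2,
    where [plateau] falls with slope at least 1, it dominates a tenth of a small bump. The integral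
    of that bump is positive. *)
Lemma ckern_neq_0 : ckern <> RtoC 0.
Proof.
  set (q := ((3 / 2)%R, 0) : C).
  assert (Hq := Pint_cutoff_pos q (/ 8) ltac:(lra)).
  assert (A1 := dkern_acont (RtoC 0) 1 ltac:(lra)). assert (S1 := dkern_csupp (RtoC 0) 1 ltac:(lra)).
  assert (A2 := test_acont _ _ (cutoff_test q (/ 8) ltac:(lra))).
  destruct (cutoff_test q (/ 8) ltac:(lra)) as (_ & _ & S2).
  assert (H : 0 <= fst (Pint (fun w => dkern (RtoC 0) 1 w - RtoC (/ 10) * cutoff q (/ 8) w)%C)).
  { apply Pint_fst_nonneg.
    - apply acont_minus, acont_scal; assumption.
    - apply csupp_minus, csupp_mult_r; assumption.
    - intros [x y].
      assert (E : fst (dkern (RtoC 0) 1 (x, y)) =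
        - (x * dplateau x * plateau y + y * dplateau y * plateau x) / 2 * / (x * x + y * y)).
      { unfold dkern, dcutoff, dbump, Cinv; simpl. rewrite Ropp_0, !Rplus_0_r, !Rminus_0_r, !Rmult_1_r.
        unfold Rdiv. rewrite !Rinv_1, !Rmult_1_r. ring. }
      cut (/ 10 * fst (cutoff q (/ 8) (x, y)) <= fst (dkern 0 1 (x, y))).
      { simpl. lra. }
      rewrite E. clear E.
      assert (Hpos : 0 <= - (x * dplateau x * plateau y + y * dplateau y * plateau x) / 2).
      { generalize (dplateau_sign x), (dplateau_sign y), (plateau_range x), (plateau_range y). nra. }
      destruct (classic (ksq q (2 * / 8) (x, y))) as [Hk|Hk].
      + pose proof (bump_range plateau q (/ 8) (x, y) plateau_range) as B. fold cutoff in B.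
        unfold ksq, q in Hk; simpl in Hk. destruct Hk as [K1 K2].
        apply Rabs_le_between in K1. apply Rabs_le_between in K2.
        destruct (plateau_one y) as [-> ->]; [apply Rabs_le; lra|].
        rewrite dplateau_unfold. destruct (ramp_1 (x + 2)) as [_ ->]; [lra|].
        pose proof (dramp_mid (x - 1)) as Hd. specialize (Hd ltac:(lra)).
        apply Rle_trans with (/ 10); [lra|].
        assert (P : 0 < x * x + y * y) by nra.
        apply Rmult_le_reg_r with (x * x + y * y); [exact P|].
        rewrite (Rmult_assoc _ (/ (x * x + y * y))), Rinv_l by lra. nra.
      + destruct (cutoff_far q (/ 8) (x, y)) as [-> _]; [lra|assumption|]. simpl. rewrite Rmult_0_r.
        apply Rmult_le_pos; [assumption|].
        (* At the origin the convention that the inverse of 0 is 0 gives the right sign. *)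
        destruct (Req_dec (x * x + y * y) 0) as [->|Hn]; [rewrite Rinv_0; lra|].
        left; apply Rinv_0_lt_compat. nra. }
  rewrite Pint_minus, Pint_scal in H; auto using acont_scal, csupp_mult_r.
  intro E. unfold ckern in E. rewrite E in H. simpl in H. lra.
Qed.

(** * Weakly holomorphic functions *)

Definition openC (U : C -> Prop) : Prop :=
  forall z, U z -> exists r, 0 < r /\ forall w, Cmod (w - z) < r -> U w.

(** The distributional equation dbar f = 0 on U; the disjunction says that the support of psi lies
    in U, so f may be arbitrary elsewhere. Unlike differentiability, this condition visibly survives
    uniform limits, and [weakhol_holo] recovers differentiability from it. *)
Definition weakhol (f : C -> C) (U : C -> Prop) : Prop :=
  (forall z, U z -> cont_at f z) /\
  forall psi dpsi, test psi dpsi -> (forall z, U z \/ lzero psi z) -> Pint (fun w => f w * dpsi w)%C = RtoC 0.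

Lemma acont_mult_lzero f v : acont v -> (forall z, cont_at f z \/ lzero v z) -> acont (fun w => f w * v w)%C.
Proof.
  intros Hv H z. destruct (H z) as [Hz|Hz].
  - apply cont_at_mult; [assumption|apply Hv].
  - apply lzero_cont_at, lzero_mult_r, Hz.
Qed.

(** f * psi is itself a test function with dbar derivative f * dpsi. The derivative of f may a
    priori be discontinuous, because only the continuity of f * dpsi enters: this is Goursat's
    gain. *)
Lemma holo_weakhol f U : (forall z, U z -> Cdiff1 f z) -> weakhol f U.
Proof.
  intros Hf.
  assert (Hd : forall z, U z -> dbar f z (RtoC 0)) by (intros; apply holo_dbar; auto).
  assert (Hc : forall z, U z -> cont_at f z) by (intros z Hz; apply (dbar_cont_at _ _ _ (Hd z Hz))).
  split; [exact Hc|]. intros psi dpsi Ht Hs.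
  apply (Pint_dbar (fun w => f w * psi w)%C). split; [|split].
  - intro z. destruct (Hs z) as [Hz|Hz].
    + eapply dbar_eq; [|apply dbar_mult; [apply Hd, Hz|apply Ht]]. cring.
    + pose proof (lzero_at _ _ (test_lzero _ _ _ Ht Hz)) as E. rewrite E.
      destruct (lzero_mult_r _ f _ Hz) as (r & Hr & K).
      apply (dbar_ext_loc (fun _ => RtoC 0) _ _ _ r); [assumption|intros; symmetry; auto|].
      eapply dbar_eq; [|apply dbar_const]. cring.
  - apply acont_mult_lzero; [apply Ht|]. intro z. destruct (Hs z) as [Hz|Hz]; [left; auto|right].
    apply (test_lzero _ _ _ Ht Hz).
  - apply csupp_mult_r, Ht.
Qed.

Lemma acont_bounded v : acont v -> csupp v -> exists M, 0 <= M /\ forall z, Cmod (v z) <= M.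
Proof.
  intros Hv (r & Hr & Hs). destruct (bounded_on_square v (- r) (- r) (2 * r)) as (M & HM); [lra|auto|].
  exists (Rmax 0 M). split; [apply Rmax_l|]. intro z.
  destruct (classic (insq (- r) (- r) (2 * r) z)) as [Hz|Hz].
  - eapply Rle_trans; [apply HM, Hz|apply Rmax_r].
  - rewrite Hs by assumption. rewrite Cmod_0. apply Rmax_l.
Qed.

Lemma cont_at_limit f z :
  (forall eps, 0 < eps -> exists g, cont_at g z /\ exists r, 0 < r /\ forall w, Cmod (w - z) < r -> Cmod (f w - g w) <= eps) ->
  cont_at f z.
Proof.
  intros H eps He. destruct (H (eps / 4)) as (g & Hg & r & Hr & K); [lra|].
  destruct (Hg (eps / 4)) as (d & Hd & G); [lra|].
  exists (Rmin d r); split; [apply Rmin_glb_lt; assumption|]. intros w Hw.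
  specialize (G w (Rlt_le_trans _ _ _ Hw (Rmin_l _ _))).
  pose proof (K w (Rlt_le_trans _ _ _ Hw (Rmin_r _ _))) as K1.
  specialize (K z). rewrite Cmod_subself in K. specialize (K Hr).
  generalize (Cmod_sub_triangle (f w) (g w) (f z)), (Cmod_sub_triangle (g w) (g z) (f z)).
  rewrite (Cmod_sub_sym (g z)). lra.
Qed.

Lemma Rle_eps_mult x K : 0 <= K -> (forall eps, 0 < eps -> x <= K * eps) -> x <= 0.
Proof.
  intros HK H. apply Rnot_lt_le; intro Hx. specialize (H (x / (2 * (K + 1)))).
  assert (P : 0 < x / (2 * (K + 1))) by (apply Rdiv_lt_0_compat; lra). specialize (H P).
  assert (E : x = x / (2 * (K + 1)) * (2 * (K + 1))) by (field; lra). nra.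
Qed.

Lemma Cmod_le_0 z : Cmod z <= 0 -> z = RtoC 0.
Proof. intros H. apply Cmod_eq_0. apply Rle_antisym; [assumption|apply Cmod_ge_0]. Qed.

Lemma weakhol_limit f U : openC U ->
  (forall eps, 0 < eps -> exists g, weakhol g U /\ forall z, U z -> Cmod (f z - g z) <= eps) -> weakhol f U.
Proof.
  intros HU H.
  assert (Hc : forall z, U z -> cont_at f z).
  { intros z Hz. apply cont_at_limit. intros eps He. destruct (H eps He) as (g & Hg & K).
    exists g. split; [apply Hg, Hz|]. destruct (HU z Hz) as (r & Hr & Hr'). exists r; split; auto. }
  split; [exact Hc|]. intros psi dpsi Ht Hs.
  destruct (Ht) as (Hd & Ha & Hps). pose proof (test_csupp _ _ Ht) as Hcs.
  destruct (acont_bounded dpsi Ha Hcs) as (M & HM & HM').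
  destruct (Hcs) as (r & Hr & Hsup).
  assert (Hcm : forall g, (forall z, U z -> cont_at g z) -> acont (fun w => g w * dpsi w)%C).
  { intros g Hg. apply acont_mult_lzero; [assumption|]. intro z. destruct (Hs z) as [Hz|Hz]; [left; auto|right].
    apply (test_lzero _ _ _ Ht Hz). }
  apply Cmod_le_0. apply (Rle_eps_mult _ (4 * M * (2 * r) ^ 2)); [nra|].
  intros eps He. destruct (H eps He) as (g & Hg & K).
  assert (E : Pint (fun w => f w * dpsi w)%C = Pint (fun w => f w * dpsi w - g w * dpsi w)%C).
  { rewrite Pint_minus; try (apply csupp_mult_r, Hcs); try (apply Hcm; try apply Hg; assumption).
    destruct Hg as [_ Hg]. rewrite (Hg psi dpsi Ht Hs). cring. }
  rewrite E. replace (4 * M * (2 * r) ^ 2 * eps) with (4 * (eps * M) * (2 * r) ^ 2) by ring.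
  apply (Pint_le (- r) (- r)); [lra| | |].
  - apply acont_minus; apply Hcm; [assumption|apply Hg].
  - intros z Hz. rewrite (Hsup z Hz). cring.
  - intros z _. destruct (Hs z) as [Hz|Hz].
    + replace (f z * dpsi z - g z * dpsi z)%C with ((f z - g z) * dpsi z)%C by cring.
      rewrite Cmod_mult. apply Rmult_le_compat; auto using Cmod_ge_0.
    + rewrite (lzero_at _ _ (test_lzero _ _ _ Ht Hz)).
      replace (_ - _)%C with (RtoC 0) by cring. rewrite Cmod_0. nra.
Qed.

(** [dkern z s] has integral [ckern], lives on a square of side 4s and is at most 2 / s^2. An
    oscillation e of f therefore costs 4 * e * (2 / s^2) * (4s)^2 = 128 e, independently of s. *)
Lemma Pint_dkern_approx f z eps : 0 < eps -> cont_at f z ->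
  exists delta, 0 < delta /\ forall s, 0 < s < delta -> acont (fun w => f w * dkern z s w)%C ->
    Cmod (Pint (fun w => f w * dkern z s w)%C - f z * ckern) <= eps.
Proof.
  intros He Hf. destruct (Hf (eps / 128)) as (d & Hd & K); [lra|].
  exists (d / 8). split; [lra|]. intros s Hs Ha.
  rewrite <- (Pint_dkern z s) by lra.
  assert (A1 := dkern_acont z s ltac:(lra)). assert (S1 := dkern_csupp z s ltac:(lra)).
  rewrite <- Pint_scal, <- Pint_minus; try assumption; try (apply csupp_mult_r; assumption); try (apply acont_scal; assumption).
  eapply Rle_trans; [apply (Pint_le (fst z - 2 * s) (snd z - 2 * s) (2 * (2 * s)) _ (eps / 128 * (2 / s ^ 2)))|].
  - lra.
  - apply acont_minus; [assumption|apply acont_scal; assumption].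
  - intros w Hw. rewrite (dkern_supp z s); [cring|lra|assumption].
  - intros w Hw. apply ksq_insq in Hw. apply ksq_mod in Hw.
    replace (_ - _)%C with ((f w - f z) * dkern z s w)%C by cring. rewrite Cmod_mult.
    apply Rmult_le_compat; try apply Cmod_ge_0.
    + left; apply K; lra.
    + apply dkern_mod; lra.
  - right. field. lra.
Qed.

(** * Cauchy transforms and Cauchy's formula *)

Definition cauchy_transform (g : C -> C) (z : C) : C := Pint (fun w => g w * / (w - z))%C.

Lemma acont_cauchy g z : acont g -> lzero g z -> acont (fun w => g w * / (w - z))%C.
Proof.
  intros Hg Hz w. destruct (classic (w = z)) as [->|Hn].
  - apply lzero_cont_at. destruct Hz as (r & Hr & K). exists r; split; [assumption|].
    intros w Hw. rewrite K by assumption. cring.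
  - apply cont_at_mult; [apply Hg|apply cont_at_inv_sub, Hn].
Qed.

Lemma lzero_mult_l u v z : lzero u z -> lzero (fun w => u w * v w)%C z.
Proof. intros (r & Hr & H). exists r; split; [assumption|]. intros w Hw. rewrite H by assumption. cring. Qed.

Lemma cauchy_holo g z0 : acont g -> csupp g -> lzero g z0 ->
  exists r, 0 < r /\ forall z, Cmod (z - z0) < r -> Cdiff1 (cauchy_transform g) z.
Proof.
  intros Hg Hs (rho & Hrho & K). exists (rho / 2). split; [lra|]. intros z Hz.
  destruct (acont_bounded g Hg Hs) as (M & HM & HM'). destruct (Hs) as (r & Hr & Hsup).
  assert (Hlz : forall t, Cmod (t - z0) < rho -> lzero g t).
  { intros t Ht. exists (rho - Cmod (t - z0)). split; [lra|]. intros w Hw. apply K.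
    generalize (Cmod_sub_triangle w t z0). lra. }
  set (g1 := fun w => (g w * / (w - z))%C). set (g2 := fun w => (g1 w * / (w - z))%C).
  assert (A1 : acont g1) by (apply acont_cauchy; [assumption|apply Hlz; lra]).
  assert (A2 : acont g2) by (apply acont_cauchy; [assumption|apply lzero_mult_l, Hlz; lra]).
  assert (S1 : csupp g1) by (apply csupp_mult_l, Hs). assert (S2 : csupp g2) by (apply csupp_mult_l, S1).
  exists (Pint g2). intros eps He.
  (* The remainder of the difference quotient has the kernel h^2 / ((w - z)^2 (w - z - h)). On the
     support of g the distances to z and z + h are at least rho / 2 and rho / 4, whence 16 /
     rho^3. *)
  set (B := 4 * (M * (16 / rho ^ 3)) * (2 * r) ^ 2).
  assert (Hrho3 : 0 < 16 / rho ^ 3) by (apply Rdiv_lt_0_compat; [lra|apply pow_lt; lra]).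
  assert (HB : 0 <= B) by (unfold B; apply Rmult_le_pos; [nra|apply pow2_ge_0]).
  exists (Rmin (rho / 4) (eps / (B + 1))). split; [apply Rmin_glb_lt; [lra|apply Rdiv_lt_0_compat; lra]|].
  intros h Hh.
  assert (Hh1 : Cmod h < rho / 4) by (eapply Rlt_le_trans; [exact Hh|apply Rmin_l]).
  assert (Hh2 : Cmod h * (B + 1) < eps).
  { rewrite Rmult_comm. apply Rlt_div_mult; [lra|]. eapply Rlt_le_trans; [exact Hh|apply Rmin_r]. }
  assert (Hzh : Cmod ((z + h)%C - z0) < rho * 3 / 4).
  { replace (z + h - z0)%C with ((z - z0) + h)%C by cring. generalize (Cmod_triangle (z - z0) h). lra. }
  set (g3 := fun w => (g w * / (w - (z + h)))%C).
  assert (A3 : acont g3) by (apply acont_cauchy; [assumption|apply Hlz; lra]).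
  assert (S3 : csupp g3) by (apply csupp_mult_l, Hs).
  change (Cmod (cauchy_transform g (z + h)%C - cauchy_transform g z - Pint g2 * h) <= eps * Cmod h).
  unfold cauchy_transform. fold g1. fold g3.
  rewrite Cmult_comm. rewrite <- Pint_scal, <- !Pint_minus; auto using acont_minus, acont_scal, csupp_minus, csupp_mult_r.
  eapply Rle_trans; [apply (Pint_le (- r) (- r) (2 * r) _ (M * (16 / rho ^ 3 * Cmod h ^ 2)))|].
  - lra.
  - auto using acont_minus, acont_scal.
  - intros w Hw. unfold g3, g2, g1. rewrite Hsup by assumption. cring.
  - intros w _. destruct (Rlt_dec (Cmod (w - z0)) rho) as [Hw|Hw].
    + unfold g3, g2, g1. rewrite K by assumption. replace (_ - _)%C with (RtoC 0) by cring. rewrite Cmod_0.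
      apply Rmult_le_pos; [lra|]. apply Rmult_le_pos; [lra|apply pow2_ge_0].
    + assert (N1 : rho / 2 <= Cmod (w - z)).
      { generalize (Cmod_sub_triangle w z z0). lra. }
      assert (N2 : rho / 4 <= Cmod (w - (z + h))).
      { generalize (Cmod_sub_triangle w (z + h)%C z0). lra. }
      assert (Z1 : (w - z)%C <> RtoC 0) by (apply Cmod_gt_0; lra).
      assert (Z2 : (w - (z + h))%C <> RtoC 0) by (apply Cmod_gt_0; lra).
      replace (g3 w - g1 w - h * g2 w)%C with (g w * (h * h * (/ (w - z) * / (w - z) * / (w - (z + h)))))%C.
      2: { unfold g3, g2, g1. field. split; assumption. }
      rewrite !Cmod_mult, !Cmod_inv by assumption.
      apply Rmult_le_compat; [apply Cmod_ge_0| |apply HM'|].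
      { repeat apply Rmult_le_pos; try apply Cmod_ge_0; left; apply Rinv_0_lt_compat; lra. }
      replace (16 / rho ^ 3 * Cmod h ^ 2) with (Cmod h * Cmod h * (/ (rho / 2) * / (rho / 2) * / (rho / 4))) by (field; lra).
      apply Rmult_le_compat_l; [apply Rmult_le_pos; apply Cmod_ge_0|].
      assert (I1 : / Cmod (w - z) <= / (rho / 2)) by (apply Rinv_le_contravar; lra).
      assert (I2 : / Cmod (w - (z + h)) <= / (rho / 4)) by (apply Rinv_le_contravar; lra).
      assert (P1 : 0 < / Cmod (w - z)) by (apply Rinv_0_lt_compat; lra).
      assert (P2 : 0 < / Cmod (w - (z + h))) by (apply Rinv_0_lt_compat; lra).
      apply Rmult_le_compat; [nra|lra| |lra]. apply Rmult_le_compat; lra.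
  - replace (4 * (M * (16 / rho ^ 3 * Cmod h ^ 2)) * (2 * r) ^ 2) with (B * Cmod h * Cmod h) by (unfold B; ring).
    apply Rmult_le_compat_r; [apply Cmod_ge_0|]. generalize (Cmod_ge_0 h). nra.
Qed.

Lemma test_mult u v psi dpsi : (forall z, dbar u z (v z)) -> acont v -> test psi dpsi ->
  test (fun w => psi w * u w)%C (fun w => dpsi w * u w + psi w * v w)%C.
Proof.
  intros Hu Hv Ht. pose proof (test_acont _ _ Ht) as Hpa. destruct Ht as (Hd & Ha & Hs). split; [|split].
  - intro z. apply dbar_mult; auto.
  - apply acont_plus; apply acont_mult; try assumption. intro z. apply (dbar_cont_at _ _ _ (Hu z)).
  - apply csupp_mult_l, Hs.
Qed.

(** Thanks to the truncation, psi times the kernel is an admissible test function even with the pole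
    in U. The product rule leaves a Cauchy integral of f * dpsi and an approximate identity applied
    to f * psi. *)
Lemma weakhol_kernel f U psi dpsi z s : weakhol f U -> test psi dpsi -> (forall w, U w \/ lzero psi w) -> 0 < s ->
  (Pint (fun w => f w * dpsi w * kern z s w) + Pint (fun w => f w * psi w * dkern z s w))%C = RtoC 0.
Proof.
  intros [Hc Hf] Ht Hs Hp.
  pose proof (test_acont _ _ Ht) as Hpa. pose proof (test_csupp _ _ Ht) as Hcs.
  assert (A1 : acont (fun w => f w * dpsi w)%C).
  { apply acont_mult_lzero; [apply Ht|]. intro w; destruct (Hs w); [left; auto|right]. apply (test_lzero _ _ _ Ht); assumption. }
  assert (A2 : acont (fun w => f w * psi w)%C).
  { apply acont_mult_lzero; [assumption|]. intro w; destruct (Hs w); [left; auto|right; assumption]. }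
  rewrite <- Pint_plus.
  - rewrite <- (Hf (fun w => psi w * kern z s w)%C (fun w => dpsi w * kern z s w + psi w * dkern z s w)%C).
    + apply Pint_ext. intro; cring.
    + apply test_mult; [apply kern_dbar, Hp|apply dkern_acont, Hp|assumption].
    + intro w; destruct (Hs w); [left; assumption|right; apply lzero_mult_l; assumption].
  - apply acont_mult; [assumption|apply kern_acont, Hp].
  - apply acont_mult; [assumption|apply dkern_acont, Hp].
  - apply csupp_mult_l, csupp_mult_r, Hcs.
  - apply csupp_mult_l, csupp_mult_r, Ht.
Qed.

Lemma cutoff_lzero_outside z0 s w : 0 < s -> ~ ksq z0 (2 * s) w -> lzero (cutoff z0 s) w.
Proof.
  intros Hs H. apply (supp_in_lzero _ _ _ _ _ (cutoff_supp z0 s Hs)). intro K. apply H. apply ksq_insq.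
  replace (2 * (2 * s)) with (2 * 2 * s) by ring. exact K.
Qed.

(* Test f against cutoff * kern and let the truncation of the kernel tend to 0. *)
Lemma cauchy_formula f U z0 s z : weakhol f U -> 0 < s -> (forall w, ksq z0 (2 * s) w -> U w) ->
  Cmod (z - z0) < s -> (ckern * f z = - cauchy_transform (fun w => f w * dcutoff z0 s w) z)%C.
Proof.
  intros Hf Hs HU Hz.
  assert (Ht := cutoff_test z0 s Hs).
  assert (HUl : forall w, U w \/ lzero (cutoff z0 s) w).
  { intro w. destruct (classic (ksq z0 (2 * s) w)) as [H|H]; [left; auto|right; apply cutoff_lzero_outside; assumption]. }
  assert (Hpz : cutoff z0 s z = RtoC 1) by (apply cutoff_one; [assumption|apply mod_ksq; lra]).
  assert (HUz : U z).
  { apply HU. destruct (mod_ksq z0 s z) as [K1 K2]; [lra|]. split; lra. }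
  assert (Hc : acont (fun w => f w * cutoff z0 s w)%C).
  { apply acont_mult_lzero; [apply (test_acont _ _ Ht)|]. intro w; destruct (HUl w); [left; apply Hf; assumption|right; assumption]. }
  replace (ckern * f z)%C with (f z * cutoff z0 s z * ckern)%C by (rewrite Hpz; cring).
  set (c := cauchy_transform _ z).
  replace (f z * cutoff z0 s z * ckern)%C with (- (- c - f z * cutoff z0 s z * ckern) + - c)%C by cring.
  rewrite (Cmod_le_0 (- c - f z * cutoff z0 s z * ckern)%C); [cring|].
  apply (Rle_eps_mult _ 1); [lra|]. intros eps He. rewrite Rmult_1_l.
  destruct (Pint_dkern_approx (fun w => f w * cutoff z0 s w)%C z eps He (Hc z)) as (d & Hd & K).
  (* The second bound keeps the truncated square around z inside the one where the cutoff is 1.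
     There its dbar derivative vanishes, and elsewhere the truncated kernel is the true one. *)
  set (s' := Rmin (d / 2) ((s - Cmod (z - z0)) / 8)).
  assert (Hs' : 0 < s') by (apply Rmin_glb_lt; lra).
  assert (Hs1 : s' <= d / 2) by apply Rmin_l. assert (Hs2 : s' <= (s - Cmod (z - z0)) / 8) by apply Rmin_r.
  assert (E : (- c)%C = Pint (fun w => f w * cutoff z0 s w * dkern z s' w)%C).
  { pose proof (weakhol_kernel f U _ _ z s' Hf Ht HUl Hs') as W.
    rewrite (Pint_ext (fun w => f w * dcutoff z0 s w * kern z s' w)%C (fun w => f w * dcutoff z0 s w * / (w - z))%C) in W.
    - unfold cauchy_transform in c. fold c in W.
      replace (Pint (fun w => f w * cutoff z0 s w * dkern z s' w)%C)
        with ((c + Pint (fun w => f w * cutoff z0 s w * dkern z s' w)) - c)%C by cring.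
      rewrite W. cring.
    - intro w. destruct (classic (ksq z0 s w)) as [H|H].
      + destruct (cutoff_one z0 s w Hs H) as [_ ->]. cring.
      + f_equal. apply kern_far; [assumption|]. intro H2. apply ksq_mod in H2. apply not_ksq_mod in H.
        generalize (Cmod_sub_triangle w z z0). lra. }
  rewrite E. apply K; [lra|]. apply acont_mult; [assumption|apply dkern_acont, Hs'].
Qed.

Lemma weakhol_cauchy_data f U z0 s : weakhol f U -> 0 < s -> (forall w, ksq z0 (2 * s) w -> U w) ->
  acont (fun w => f w * dcutoff z0 s w)%C /\ csupp (fun w => f w * dcutoff z0 s w)%C /\
  lzero (fun w => f w * dcutoff z0 s w)%C z0.
Proof.
  intros Hf Hs HU. assert (Ht := cutoff_test z0 s Hs). split; [|split].
  - apply acont_mult_lzero; [apply Ht|]. intro w.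
    destruct (classic (ksq z0 (2 * s) w)) as [H|H]; [left; apply Hf; auto|right].
    apply (test_lzero _ _ _ Ht), cutoff_lzero_outside; assumption.
  - apply csupp_mult_r, (test_csupp _ _ Ht).
  - apply lzero_mult_r. exists s; split; [assumption|]. intros w Hw. apply cutoff_one; [assumption|apply mod_ksq; lra].
Qed.

Lemma Cdiff1_ext_loc (f g : C -> C) (z : C) r : 0 < r -> (forall w, Cmod (w - z) < r -> f w = g w) -> Cdiff1 f z -> Cdiff1 g z.
Proof. intros Hr H Hf. apply holo_dbar. apply holo_dbar in Hf. apply (dbar_ext_loc f _ _ _ r); assumption. Qed.

Lemma Cdiff1_scal (c : C) (f : C -> C) (z : C) : Cdiff1 f z -> Cdiff1 (fun w => Cmult c (f w)) z.
Proof.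
  intros Hf. apply holo_dbar. apply holo_dbar in Hf. eapply dbar_eq; [|apply dbar_scal, Hf]. cring.
Qed.

(** Weyl's lemma: near z, Cauchy's formula exhibits f as a constant times the Cauchy transform of a
    density that vanishes near z. *)
Lemma weakhol_holo f U z : openC U -> weakhol f U -> U z -> Cdiff1 f z.
Proof.
  intros HU Hf Hz. destruct (HU z Hz) as (r & Hr & K).
  assert (Hs : 0 < r / 8) by lra.
  assert (HUs : forall w, ksq z (2 * (r / 8)) w -> U w).
  { intros w Hw. apply ksq_mod in Hw. apply K. lra. }
  destruct (weakhol_cauchy_data f U z (r / 8) Hf Hs HUs) as (A & S & L).
  destruct (cauchy_holo _ z A S L) as (r' & Hr' & H).
  apply (Cdiff1_ext_loc (fun w => (- / ckern) * cauchy_transform (fun w => f w * dcutoff z (r / 8) w)%C w)%C _ _ (r / 8)); [assumption| |].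
  - intros w Hw. pose proof (cauchy_formula f U z (r / 8) w Hf Hs HUs Hw) as E.
    replace (f w) with (/ ckern * (ckern * f w))%C by (field; apply ckern_neq_0).
    rewrite E. ring.
  - apply Cdiff1_scal, H. rewrite Cmod_subself; assumption.
Qed.

Lemma holo_limit f U : openC U ->
  (forall eps, 0 < eps -> exists g, (forall z, U z -> Cdiff1 g z) /\ forall z, U z -> Cmod (f z - g z) <= eps) ->
  forall z, U z -> Cdiff1 f z.
Proof.
  intros HU H z Hz. apply (weakhol_holo f U); [assumption| |assumption].
  apply weakhol_limit; [assumption|]. intros eps He. destruct (H eps He) as (g & Hg & K).
  exists g. split; [apply holo_weakhol, Hg|exact K].
Qed.

(** A maximum principle up to a constant: Cauchy's formula sees f only on the square annulus where
    the cutoff varies. The constant is 4 * (2 / s) * (1 / s) * (4s)^2 = 128. *)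
Lemma maximum_bound f U z0 s M : weakhol f U -> 0 < s -> (forall w, ksq z0 (2 * s) w -> U w) ->
  0 <= M -> (forall w, ksq z0 (2 * s) w -> ~ ksq z0 s w -> Cmod (f w) <= M) -> Cmod ckern * Cmod (f z0) <= 128 * M.
Proof.
  intros Hf Hs HU HM H. rewrite <- Cmod_mult.
  rewrite (cauchy_formula f U z0 s z0 Hf Hs HU) by (rewrite Cmod_subself; assumption).
  rewrite Cmod_opp. destruct (weakhol_cauchy_data f U z0 s Hf Hs HU) as (A & S & L).
  eapply Rle_trans; [apply (Pint_le (fst z0 - 2 * s) (snd z0 - 2 * s) (2 * (2 * s)) _ (M * (2 / s) * / s))|].
  - lra.
  - apply acont_cauchy; assumption.
  - intros w Hw. destruct (cutoff_far z0 s w Hs) as [_ ->]; [|cring]. intro K. apply Hw, ksq_insq, K.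
  - intros w Hw. apply ksq_insq in Hw. destruct (classic (ksq z0 s w)) as [K|K].
    + destruct (cutoff_one z0 s w Hs K) as [_ ->]. replace (_ * _)%C with (RtoC 0) by cring. rewrite Cmod_0.
      assert (0 < / s) by (apply Rinv_0_lt_compat, Hs). unfold Rdiv. repeat apply Rmult_le_pos; lra.
    + pose proof (not_ksq_mod _ _ _ K) as K'. rewrite !Cmod_mult, Cmod_inv.
      2: { apply Cmod_gt_0; lra. }
      apply Rmult_le_compat.
      * apply Rmult_le_pos; apply Cmod_ge_0.
      * left; apply Rinv_0_lt_compat; lra.
      * apply Rmult_le_compat; try apply Cmod_ge_0; [auto|].
        apply dbump_mod; [assumption|apply plateau_range|apply dplateau_range].
      * apply Rinv_le_contravar; lra.
  - right. field. lra.
Qed.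

(** * Composition and openness *)

Lemma Cdiff1_comp (g f : C -> C) (z : C) : Cdiff1 g (f z) -> Cdiff1 f z -> Cdiff1 (fun t => g (f t)) z.
Proof.
  intros (a & Ha) Hf. assert (Cf : cont_at f z) by (apply (dbar_cont_at _ _ _ (proj1 (holo_dbar f z) Hf))).
  destruct Hf as (b & Hb). exists (a * b)%C. intros eps He.
  set (M := Cmod a + Cmod b + 2). assert (HM : 2 <= M) by (unfold M; generalize (Cmod_ge_0 a), (Cmod_ge_0 b); lra).
  set (e := eps / (2 * M)). assert (He' : 0 < e) by (apply Rdiv_lt_0_compat; lra).
  assert (Ee : eps = 2 * M * e) by (unfold e; field; lra).
  destruct (Ha e He') as (d1 & Hd1 & K1). destruct (Hb (Rmin 1 e)) as (d2 & Hd2 & K2); [apply Rmin_glb_lt; lra|].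
  destruct (Cf d1 Hd1) as (d3 & Hd3 & K3).
  exists (Rmin d2 d3); split; [apply Rmin_glb_lt; assumption|]. intros h Hh.
  specialize (K2 h (Rlt_le_trans _ _ _ Hh (Rmin_l _ _))).
  specialize (K3 (z + h)%C). replace (z + h - z)%C with h in K3 by cring.
  specialize (K3 (Rlt_le_trans _ _ _ Hh (Rmin_r _ _))).
  specialize (K1 (f (z + h)%C - f z)%C K3).
  change (Cmod (g (f z + (f (z + h)%C - f z))%C - g (f z) - a * (f (z + h)%C - f z)) <= e * Cmod (f (z + h)%C - f z)) in K1.
  change (Cmod (f (z + h)%C - f z - b * h) <= Rmin 1 e * Cmod h) in K2.
  change (Cmod (g (f (z + h)%C) - g (f z) - (a * b) * h) <= eps * Cmod h).
  replace (f z + (f (z + h)%C - f z))%C with (f (z + h)%C) in K1 by cring.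
  replace (_ - _)%C with ((g (f (z + h)%C) - g (f z) - a * (f (z + h)%C - f z)) + a * (f (z + h)%C - f z - b * h))%C by cring.
  eapply Rle_trans; [apply Cmod_triangle|]. rewrite Cmod_mult.
  generalize (Rmin_l 1 e), (Rmin_r 1 e), (Cmod_ge_0 h), (Cmod_ge_0 a), (Cmod_ge_0 b). intros.
  assert (B : Cmod (f (z + h)%C - f z) <= (Cmod b + 1) * Cmod h).
  { generalize (Cmod_le_sub (f (z + h)%C - f z)%C (b * h)%C). rewrite Cmod_mult. nra. }
  assert (B2 : Cmod a * Cmod (f (z + h)%C - f z - b * h) <= Cmod a * (e * Cmod h)).
  { apply Rmult_le_compat_l; [assumption|]. nra. }
  assert (B3 : e * Cmod (f (z + h)%C - f z) <= e * ((Cmod b + 1) * Cmod h)) by (apply Rmult_le_compat_l; lra).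
  rewrite Ee. unfold M. assert (0 <= e * Cmod h) by nra. nra.
Qed.

(* If w is omitted, 1/(phi - w) is large at t0 but small on a square annulus around it. *)
Lemma injective_holo_open (phi : C -> C) (U : C -> Prop) (t0 : C) : openC U ->
  (forall t, U t -> Cdiff1 phi t) -> (forall t s, U t -> U s -> phi t = phi s -> t = s) -> U t0 ->
  exists eps, 0 < eps /\ forall w, Cmod (w - phi t0) < eps -> exists t, U t /\ phi t = w.
Proof.
  intros HU Hd Hi Ht0. destruct (HU t0 Ht0) as (r & Hr & K).
  set (s := r / 8). assert (Hs : 0 < s) by (unfold s; lra).
  assert (HUs : forall w, ksq t0 (2 * s) w -> U w).
  { intros w Hw. apply ksq_mod in Hw. apply K. unfold s in *. lra. }
  assert (Hc : forall t, U t -> cont_at phi t).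
  { intros t Ht. apply (dbar_cont_at _ _ _ (proj1 (holo_dbar phi t) (Hd t Ht))). }
  (* A lower bound for |phi - phi t0| on the annulus is an upper bound for its inverse. By
     injectivity t0 is the only pole, and the factor in front removes it, leaving a function
     continuous on the whole square. *)
  destruct (bounded_on_square (fun w => (1 - cutoff t0 (s / 2) w) * / (phi w - phi t0))%C
    (fst t0 - 2 * s) (snd t0 - 2 * s) (2 * (2 * s))) as (M & HM); [lra| |].
  { intros z Hz. apply ksq_insq in Hz. destruct (classic (z = t0)) as [->|Hn].
    - apply lzero_cont_at. exists (s / 2). split; [lra|]. intros w Hw.
      destruct (cutoff_one t0 (s / 2) w) as [-> _]; [lra|apply mod_ksq; lra|]. cring.
    - apply cont_at_mult.
      + apply (acont_minus (fun _ => RtoC 1)); [apply acont_const|]. apply (test_acont _ _ (cutoff_test t0 (s / 2) ltac:(lra))).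
      + assert (Hne : phi z <> phi t0) by (intro E; apply Hn, (Hi z t0); auto).
        intros e He. destruct (cont_at_inv_sub (phi t0) (phi z) Hne e He) as (d & Hd' & G).
        destruct (Hc z (HUs z Hz) d Hd') as (d2 & Hd2 & G2). exists d2. split; [assumption|]. intros w Hw. apply G, G2, Hw. }
  set (M1 := Rmax 1 M). assert (HM1 : 1 <= M1) by apply Rmax_l. assert (HM2 : M <= M1) by apply Rmax_r.
  assert (Hlow : forall w, ksq t0 (2 * s) w -> ~ ksq t0 s w -> / M1 <= Cmod (phi w - phi t0)).
  { intros w Hw Hn. specialize (HM w (proj1 (ksq_insq _ _ _) Hw)). cbv beta in HM.
    destruct (cutoff_far t0 (s / 2) w) as [E _]; [lra|replace (2 * (s / 2)) with s by field; assumption|].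
    rewrite E in HM. replace ((1 - 0) * / (phi w - phi t0))%C with (/ (phi w - phi t0))%C in HM by cring.
    assert (Hne : (phi w - phi t0)%C <> RtoC 0).
    { intro E0. assert (phi w = phi t0) by (replace (phi w) with ((phi w - phi t0) + phi t0)%C by cring; rewrite E0; cring).
      assert (w = t0) by (apply Hi; auto). subst w. apply Hn. apply mod_ksq. rewrite Cmod_subself; lra. }
    assert (P : 0 < Cmod (phi w - phi t0)) by (apply Cmod_gt_0, Hne).
    rewrite Cmod_inv in HM by assumption.
    rewrite <- (Rinv_inv (Cmod (phi w - phi t0))). apply Rinv_le_contravar; [apply Rinv_0_lt_compat, P|lra]. }
  assert (Hck : 0 < Cmod ckern) by (apply Cmod_gt_0, ckern_neq_0).
  assert (HiM : 0 < / M1) by (apply Rinv_0_lt_compat; lra).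
  (* If |w - phi t0| <= 1 / (2 M1), then phi - w has modulus at least 1 / (2 M1) on the annulus, and
     the maximum bound gives |ckern| <= 256 M1 |w - phi t0|. The value of [e2] contradicts this. *)
  set (e2 := Cmod ckern / (256 * M1)).
  assert (He2 : 0 < e2) by (apply Rdiv_lt_0_compat; lra).
  exists (Rmin (/ (2 * M1)) e2). split.
  { apply Rmin_glb_lt; [apply Rinv_0_lt_compat; lra|assumption]. }
  intros w Hw. apply NNPP; intro Hno.
  assert (Hne : forall t, U t -> (phi t - w)%C <> RtoC 0).
  { intros t Ht E. apply Hno. exists t. split; [assumption|].
    replace (phi t) with ((phi t - w) + w)%C by cring. rewrite E. cring. }
  assert (Hg : weakhol (fun t => / (phi t - w))%C U).
  { apply holo_weakhol. intros t Ht. apply (Cdiff1_comp (fun v => / (v - w))%C phi).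
    - apply holo_dbar, dbar_comp_holo_translate_inv. intro E. apply (Hne t Ht). rewrite E. cring.
    - apply Hd, Ht. }
  assert (Hb : Cmod ckern * Cmod (/ (phi t0 - w)) <= 128 * (2 * M1)).
  { apply (maximum_bound (fun t => / (phi t - w))%C U t0 s (2 * M1) Hg Hs HUs); [lra|].
    intros t Ht Hn. rewrite Cmod_inv by (apply Hne; auto).
    rewrite <- (Rinv_inv (2 * M1)). apply Rinv_le_contravar; [apply Rinv_0_lt_compat; lra|].
    specialize (Hlow t Ht Hn). generalize (Cmod_sub_triangle (phi t) w (phi t0)).
    generalize (Rmin_l (/ (2 * M1)) e2). rewrite Rinv_mult in *. lra. }
  rewrite Cmod_inv, (Cmod_sub_sym (phi t0)) in Hb by (apply Hne; assumption).
  assert (P : 0 < Cmod (w - phi t0)).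
  { rewrite Cmod_sub_sym. apply Cmod_gt_0, Hne, Ht0. }
  assert (Hw2 : Cmod (w - phi t0) < e2) by (eapply Rlt_le_trans; [exact Hw|apply Rmin_r]).
  apply Rmult_le_compat_r with (r := Cmod (w - phi t0)) in Hb; [|lra].
  rewrite Rmult_assoc, Rinv_l, Rmult_1_r in Hb by lra.
  assert (E : Cmod ckern = e2 * (256 * M1)) by (unfold e2; field; lra).
  nra.
Qed.

(** * The localization operator *)

Lemma pow2_pos n : 0 < / 2 ^ n.
Proof. apply Rinv_0_lt_compat, pow_lt; lra. Qed.

Lemma pow2_half n : / 2 ^ (S n) = / 2 ^ n / 2.
Proof. simpl. field. apply pow_nonzero; lra. Qed.

Lemma pow2_le n m : (n <= m)%nat -> / 2 ^ m <= / 2 ^ n.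
Proof.
  intros H. induction H as [|m H IH]; [lra|]. rewrite pow2_half. generalize (pow2_pos m). lra.
Qed.

Lemma pow2_small eps : 0 < eps -> exists N, / 2 ^ N < eps.
Proof.
  intros He. destruct (pow_lt_1_zero (/ 2)) with (y := eps) as [n Hn].
  { rewrite Rabs_right; lra. }
  { assumption. }
  exists n. specialize (Hn n (le_n _)). rewrite pow_inv in Hn. rewrite Rabs_right in Hn; [assumption|].
  left. apply pow2_pos.
Qed.

Lemma geometric_limit_R (u : nat -> R) (B : R) : (forall n, Rabs (u (S n) - u n) <= B * / 2 ^ n) ->
  exists l, forall n, Rabs (u n - l) <= 2 * B * / 2 ^ n.
Proof.
  intros H.
  assert (HB : 0 <= B).
  { specialize (H O). simpl in H. generalize (Rabs_pos (u 1%nat - u O)). lra. }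
  assert (Hk : forall n k, Rabs (u (n + k)%nat - u n) <= 2 * B * (/ 2 ^ n - / 2 ^ (n + k))).
  { intros n k; induction k as [|k IH].
    - rewrite Nat.add_0_r, !Rminus_diag, Rabs_R0. lra.
    - rewrite Nat.add_succ_r. replace (u (S (n + k)) - u n) with ((u (S (n + k)) - u (n + k)%nat) + (u (n + k)%nat - u n)) by ring.
      eapply Rle_trans; [apply Rabs_triang|]. specialize (H (n + k)%nat). rewrite pow2_half. lra. }
  assert (Hc : forall n m, (n <= m)%nat -> Rabs (u m - u n) <= 2 * B * / 2 ^ n).
  { intros n m Hm. replace m with (n + (m - n))%nat by lia. eapply Rle_trans; [apply Hk|].
    generalize (pow2_pos (n + (m - n))). nra. }
  destruct (Rcomplete.R_complete u) as [l Hl].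
  { intros eps He. destruct (pow2_small (eps / (4 * B + 1))) as [N HN]; [apply Rdiv_lt_0_compat; lra|].
    assert (HN2 : 4 * B * / 2 ^ N < eps).
    { apply Rlt_div_mult in HN; [|lra]. generalize (pow2_pos N). lra. }
    exists N. intros n m Hn Hm. unfold R_dist.
    generalize (Hc N n Hn), (Hc N m Hm). rewrite (Rabs_minus_sym (u m)). intros.
    replace (u n - u m) with ((u n - u N) + (u N - u m)) by ring.
    eapply Rle_lt_trans; [apply Rabs_triang|]. lra. }
  exists l. intro n. apply Rnot_lt_le; intro Hlt.
  destruct (Hl (Rabs (u n - l) - 2 * B * / 2 ^ n)) as [N HN]; [lra|].
  specialize (HN (max n N)). specialize (Hc n (max n N) (Nat.le_max_l _ _)).
  unfold R_dist in HN. assert (HNN : (max n N >= N)%nat) by apply Nat.le_max_r. specialize (HN HNN).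
  rewrite Rabs_minus_sym in Hc.
  assert (Rabs (u n - l) <= Rabs (u n - u (max n N)) + Rabs (u (max n N) - l)).
  { replace (u n - l) with ((u n - u (max n N)) + (u (max n N) - l)) by ring. apply Rabs_triang. }
  lra.
Qed.

Lemma geometric_limit (u : nat -> C) (B : R) : (forall n, Cmod (u (S n) - u n) <= B * / 2 ^ n) ->
  exists l, forall n, Cmod (u n - l) <= 4 * B * / 2 ^ n.
Proof.
  intros H. destruct (geometric_limit_R (fun n => fst (u n)) B) as [x Hx].
  { intro n. eapply Rle_trans; [apply (Cmod_fst (u (S n) - u n))|apply H]. }
  destruct (geometric_limit_R (fun n => snd (u n)) B) as [y Hy].
  { intro n. eapply Rle_trans; [apply (Cmod_snd (u (S n) - u n))|apply H]. }
  exists (x, y). intro n. replace (4 * B * / 2 ^ n) with (2 * (2 * B * / 2 ^ n)) by ring.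
  apply Cmod_le_max; [apply Hx|apply Hy].
Qed.

Definition ctrunc (g : C -> C) (z : C) (n : nat) : C := Pint (fun w => g w * kern z (/ 2 ^ n) w)%C.

Definition clim (u : nat -> C) (l : C) : Prop :=
  forall eps, 0 < eps -> exists N, forall n, (N <= n)%nat -> Cmod (u n - l) <= eps.

Definition CT (g : C -> C) (z : C) : C := epsilon (inhabits (RtoC 0)) (clim (ctrunc g z)).

Lemma clim_unique u l l' : clim u l -> clim u l' -> l = l'.
Proof.
  intros H H'. replace l with ((l - l') + l')%C by cring.
  rewrite (Cmod_le_0 (l - l')%C); [cring|]. apply (Rle_eps_mult _ 2); [lra|]. intros eps He.
  destruct (H eps He) as [N HN]. destruct (H' eps He) as [N' HN'].
  specialize (HN _ (Nat.le_max_l N N')). specialize (HN' _ (Nat.le_max_r N N')).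
  generalize (Cmod_sub_triangle l (u (max N N')) l'). rewrite (Cmod_sub_sym l (u (max N N'))). lra.
Qed.

Lemma CT_unique g z l : clim (ctrunc g z) l -> CT g z = l.
Proof.
  intros H. apply (clim_unique (ctrunc g z)); [|assumption].
  apply (epsilon_spec (inhabits (RtoC 0)) (clim (ctrunc g z))). exists l; assumption.
Qed.

Lemma geometric_clim u l B : (forall n, Cmod (u n - l) <= B * / 2 ^ n) -> clim u l.
Proof.
  intros H. assert (HB : 0 <= B).
  { specialize (H O). simpl in H. generalize (Cmod_ge_0 (u O - l)). lra. }
  intros eps He. destruct (pow2_small (eps / (B + 1))) as [N HN]; [apply Rdiv_lt_0_compat; lra|].
  exists N. intros n Hn. eapply Rle_trans; [apply H|].
  apply Rlt_div_mult in HN; [|lra].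
  generalize (pow2_pos n), (pow2_le N n Hn). nra.
Qed.

Lemma acont_gkern g z s : 0 < s -> acont g -> acont (fun w => g w * kern z s w)%C.
Proof. intros. apply acont_mult; [assumption|apply kern_acont; assumption]. Qed.

(** With s = 2^-n, two successive kernels differ by at most 3 / s, and only on a square of side 4s:
    4 * M * (3 / s) * (4s)^2 = 192 M s. The truncations thus converge geometrically and uniformly in
    z. *)
Lemma ctrunc_step g z n M : acont g -> csupp g -> (forall w, Cmod (g w) <= M) ->
  Cmod (ctrunc g z (S n) - ctrunc g z n) <= 192 * M * / 2 ^ n.
Proof.
  intros Hg Hs HM. pose proof (pow2_pos n) as P. pose proof (pow2_pos (S n)) as P'.
  unfold ctrunc. rewrite <- Pint_minus; auto using acont_gkern, csupp_mult_l.
  set (s := / 2 ^ n) in *. assert (E : / 2 ^ (S n) = s / 2) by apply pow2_half. rewrite E in *.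
  eapply Rle_trans; [apply (Pint_le (fst z - 2 * s) (snd z - 2 * s) (2 * (2 * s)) _ (M * (3 / s)))|].
  - lra.
  - apply acont_minus; apply acont_gkern; assumption.
  - intros w Hw. assert (K := kern_diff_supp z (s / 2) s P' P). rewrite Rmax_right in K by lra.
    specialize (K w Hw). replace (_ - _)%C with (g w * (kern z (s / 2) w - kern z s w))%C by cring. rewrite K. cring.
  - intros w _. replace (_ - _)%C with (g w * (kern z (s / 2) w - kern z s w))%C by cring. rewrite Cmod_mult.
    apply Rmult_le_compat; auto using Cmod_ge_0.
    eapply Rle_trans; [apply Cmod_triangle|]. rewrite Cmod_opp.
    generalize (kern_mod z (s / 2) w P'), (kern_mod z s w P).
    replace (1 / (s / 2)) with (2 / s) by (field; lra). unfold Rdiv. lra.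
  - right. field. lra.
Qed.

Lemma CT_spec g z M : acont g -> csupp g -> (forall w, Cmod (g w) <= M) ->
  forall n, Cmod (ctrunc g z n - CT g z) <= 768 * M * / 2 ^ n.
Proof.
  intros Hg Hs HM. destruct (geometric_limit (ctrunc g z) (192 * M)) as [l Hl].
  { intro n. apply ctrunc_step; assumption. }
  replace (CT g z) with l.
  - intro n. eapply Rle_trans; [apply Hl|right; ring].
  - symmetry. apply CT_unique. apply (geometric_clim _ _ _ Hl).
Qed.

Lemma CT_clim g z : acont g -> csupp g -> clim (ctrunc g z) (CT g z).
Proof.
  intros Hg Hs. destruct (acont_bounded g Hg Hs) as (M & _ & HM). 
  apply (geometric_clim _ _ (768 * M)). apply CT_spec; assumption.
Qed.

Lemma clim_plus u v l l' : clim u l -> clim v l' -> clim (fun n => u n + v n)%C (l + l')%C.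
Proof.
  intros H H' eps He. destruct (H (eps / 2)) as [N HN]; [lra|]. destruct (H' (eps / 2)) as [N' HN']; [lra|].
  exists (max N N'). intros n Hn. specialize (HN n ltac:(lia)). specialize (HN' n ltac:(lia)).
  replace (_ - _)%C with ((u n - l) + (v n - l'))%C by cring. eapply Rle_trans; [apply Cmod_triangle|]. lra.
Qed.

Lemma clim_scal c u l : clim u l -> clim (fun n => c * u n)%C (c * l)%C.
Proof.
  intros H eps He. destruct (H (eps / (Cmod c + 1))) as [N HN].
  { apply Rdiv_lt_0_compat; [assumption|generalize (Cmod_ge_0 c); lra]. }
  exists N. intros n Hn. specialize (HN n Hn). replace (_ - _)%C with (c * (u n - l))%C by cring.
  rewrite Cmod_mult. generalize (Cmod_ge_0 c), (Cmod_ge_0 (u n - l)); intros.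
  apply Rmult_le_compat_l with (r := Cmod c + 1) in HN; [|lra].
  replace ((Cmod c + 1) * (eps / (Cmod c + 1))) with eps in HN by (field; lra). nra.
Qed.

Lemma clim_ext u v l : (forall n, u n = v n) -> clim u l -> clim v l.
Proof. intros E H. replace v with u; [assumption|]. apply functional_extensionality, E. Qed.

Lemma CT_plus g h z : acont g -> csupp g -> acont h -> csupp h ->
  CT (fun w => g w + h w)%C z = (CT g z + CT h z)%C.
Proof.
  intros. apply CT_unique. apply (clim_ext (fun n => ctrunc g z n + ctrunc h z n)%C).
  - intro n. pose proof (pow2_pos n) as P. unfold ctrunc. rewrite <- Pint_plus; auto using acont_gkern, csupp_mult_l.
    apply Pint_ext; intro; cring.
  - apply clim_plus; apply CT_clim; assumption.
Qed.

Lemma CT_scal c g z : acont g -> csupp g -> CT (fun w => c * g w)%C z = (c * CT g z)%C.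
Proof.
  intros. apply CT_unique. apply (clim_ext (fun n => c * ctrunc g z n)%C).
  - intro n. pose proof (pow2_pos n) as P. unfold ctrunc. rewrite <- Pint_scal; auto using acont_gkern, csupp_mult_l.
    apply Pint_ext; intro; cring.
  - apply clim_scal; apply CT_clim; assumption.
Qed.

Lemma CT_ext g h z : (forall w, g w = h w) -> CT g z = CT h z.
Proof. intros E. replace h with g; [reflexivity|]. apply functional_extensionality, E. Qed.

Lemma CT_lzero g z : acont g -> csupp g -> lzero g z -> CT g z = cauchy_transform g z.
Proof.
  intros Hg Hs (r & Hr & K). apply CT_unique. intros eps He.
  destruct (pow2_small (r / 8)) as [N HN]; [lra|]. exists N. intros n Hn.
  pose proof (pow2_pos n) as P. pose proof (pow2_le N n Hn) as P'.
  replace (ctrunc g z n) with (cauchy_transform g z); [rewrite Cmod_subself; lra|].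
  unfold ctrunc, cauchy_transform. apply Pint_ext. intro w.
  destruct (Rlt_dec (Cmod (w - z)) r) as [Hw|Hw].
  - rewrite K by assumption. cring.
  - f_equal. symmetry. apply kern_far; [assumption|]. intro H. apply ksq_mod in H. lra.
Qed.

Lemma kern_shift z s w : kern z s w = kern (RtoC 0) s (w - z)%C.
Proof.
  unfold kern, cutoff, bump. simpl. rewrite !Rminus_0_r. do 2 f_equal. cring.
Qed.

Lemma ctrunc_cont g n z : acont g -> csupp g -> cont_at (fun z => ctrunc g z n) z.
Proof.
  intros Hg Hs eps He. pose proof (pow2_pos n) as P. set (s := / 2 ^ n) in *.
  destruct (acont_bounded g Hg Hs) as (M & HM & HM'). destruct (Hs) as (r & Hr & Hsup).
  set (B := 4 * M * (2 * r) ^ 2). assert (HB : 0 <= B) by (unfold B; generalize (pow2_ge_0 (2 * r)); nra).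
  set (r1 := r + Cmod z). generalize (Cmod_ge_0 z); intro Hz0.
  destruct (heine_square (kern (RtoC 0) s) (- r1) (- r1) (2 * r1) (eps / (B + 1))) as (d & Hd & K).
  { unfold r1; lra. }
  { apply Rdiv_lt_0_compat; lra. }
  { intros; apply kern_acont, P. }
  exists d. split; [assumption|]. intros z' Hz'. unfold ctrunc. fold s.
  rewrite <- Pint_minus; auto using acont_gkern, csupp_mult_l.
  eapply Rle_lt_trans; [apply (Pint_le (- r) (- r) (2 * r) _ (M * (eps / (B + 1))))|].
  - lra.
  - apply acont_minus; apply acont_gkern; assumption.
  - intros w Hw. rewrite Hsup by assumption. cring.
  - intros w Hw. replace (_ - _)%C with (g w * (kern z' s w - kern z s w))%C by cring. rewrite Cmod_mult.
    apply Rmult_le_compat; auto using Cmod_ge_0. left. rewrite (kern_shift z'), (kern_shift z).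
    apply K.
    + generalize (Cmod_fst z), (Cmod_snd z). intros A1 A2.
      apply Rabs_le_between in A1. apply Rabs_le_between in A2. unfold insq, r1 in *; simpl. lra.
    + replace (w - z' - (w - z))%C with (z - z')%C by cring. rewrite Cmod_sub_sym. assumption.
  - replace (4 * (M * (eps / (B + 1))) * (2 * r) ^ 2) with (eps * (B / (B + 1))) by (unfold B; field; unfold B in *; lra).
    rewrite <- (Rmult_1_r eps) at 2. apply Rmult_lt_compat_l; [assumption|].
    apply Rmult_lt_reg_r with (B + 1); [lra|]. unfold Rdiv; rewrite Rmult_assoc, Rinv_l; lra.
Qed.

Lemma CT_acont g : acont g -> csupp g -> acont (CT g).
Proof.
  intros Hg Hs z. destruct (acont_bounded g Hg Hs) as (M & HM & HM').
  apply cont_at_limit. intros eps He.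
  destruct (pow2_small (eps / (768 * M + 1))) as [N HN]; [apply Rdiv_lt_0_compat; lra|].
  exists (fun z => ctrunc g z N). split; [apply ctrunc_cont; assumption|].
  exists 1. split; [lra|]. intros w _. rewrite Cmod_sub_sym.
  eapply Rle_trans; [apply (CT_spec g w M); assumption|].
  apply Rlt_div_mult in HN; [|lra].
  generalize (pow2_pos N). nra.
Qed.

(** Truncating at the scale s of the support gives at most 4 * (M / s) * (2s)^2 = 16 M s, and
    passing to the limit costs 768 M s. The gain of the factor s is what balances the slope of the
    bumps later. *)
Lemma CT_bound g z a b N M : acont g -> supp_in a b (2 * / 2 ^ N) g -> (forall w, Cmod (g w) <= M) ->
  Cmod (CT g z) <= 784 * M * / 2 ^ N.
Proof.
  intros Hg Hs HM. pose proof (pow2_pos N) as P.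
  assert (Hcs : csupp g) by (apply (supp_in_csupp a b (2 * / 2 ^ N)); [lra|assumption]).
  pose proof (CT_spec g z M Hg Hcs HM N) as K. rewrite Cmod_sub_sym in K.
  assert (K2 : Cmod (ctrunc g z N) <= 4 * (M * (1 / / 2 ^ N)) * (2 * / 2 ^ N) ^ 2).
  { apply (Pint_le a b); [lra|apply acont_gkern; assumption| |].
    - intros w Hw. rewrite Hs by assumption. cring.
    - intros w _. rewrite Cmod_mult. apply Rmult_le_compat; auto using Cmod_ge_0. apply kern_mod, P. }
  replace (4 * (M * (1 / / 2 ^ N)) * (2 * / 2 ^ N) ^ 2) with (16 * M * / 2 ^ N) in K2.
  2: { field. apply pow_nonzero; lra. }
  generalize (Cmod_le_sub (CT g z) (ctrunc g z N)). lra.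
Qed.

(* Vitushkin's operator: up to the factor [ckern], the solution of dbar u = phi * dbar f vanishing at infinity. *)
Definition vit (phi dphi f : C -> C) (z : C) : C := (ckern * (f z * phi z) + CT (fun w => f w * dphi w) z)%C.

Lemma vit_acont phi dphi f : test phi dphi -> acont f -> acont (vit phi dphi f).
Proof.
  intros Ht Hf. unfold vit. apply acont_plus.
  - apply acont_scal, acont_mult; [assumption|apply (test_acont _ _ Ht)].
  - apply CT_acont; [apply acont_mult; [assumption|apply Ht]|apply csupp_mult_r, (test_csupp _ _ Ht)].
Qed.

Lemma vit_plus phi dphi f g z : test phi dphi -> acont f -> acont g ->
  vit phi dphi (fun w => f w + g w)%C z = (vit phi dphi f z + vit phi dphi g z)%C.
Proof.
  intros Ht Hf Hg. unfold vit.
  rewrite (CT_ext _ (fun w => f w * dphi w + g w * dphi w)%C) by (intro; cring).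
  destruct (Ht) as (_ & Ha & _). pose proof (test_csupp _ _ Ht).
  rewrite CT_plus; auto using acont_mult, csupp_mult_r. ring.
Qed.

Lemma vit_scal phi dphi c f z : test phi dphi -> acont f ->
  vit phi dphi (fun w => c * f w)%C z = (c * vit phi dphi f z)%C.
Proof.
  intros Ht Hf. unfold vit.
  rewrite (CT_ext _ (fun w => c * (f w * dphi w))%C) by (intro; cring).
  destruct (Ht) as (_ & Ha & _). pose proof (test_csupp _ _ Ht).
  rewrite (CT_scal c (fun w => f w * dphi w)%C); auto using acont_mult, csupp_mult_r. ring.
Qed.

(** Where f is holomorphic on the support of psi, letting the truncation tend to 0 in
    [weakhol_kernel] gives CT (f * dpsi) = - ckern * f * psi. This cancels the product term at z and
    trades phi for phi - psi. *)
Lemma vit_weakhol phi dphi f psi dpsi U z : test phi dphi -> acont f -> weakhol f U ->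
  test psi dpsi -> (forall w, U w \/ lzero psi w) -> psi z = phi z ->
  vit phi dphi f z = CT (fun w => f w * (dphi w - dpsi w))%C z.
Proof.
  intros Ht Hf Hw Hp HU E. unfold vit.
  assert (Ha := proj1 (proj2 Ht)). assert (Hs := test_csupp _ _ Ht).
  assert (Ha' := proj1 (proj2 Hp)). assert (Hs' := test_csupp _ _ Hp).
  rewrite (CT_ext (fun w => f w * (dphi w - dpsi w))%C (fun w => f w * dphi w + RtoC (-1) * (f w * dpsi w))%C) by (intro; cring).
  rewrite CT_plus, (CT_scal _ (fun w => f w * dpsi w)%C); auto using acont_mult, csupp_mult_r, acont_scal.
  assert (K : CT (fun w => f w * dpsi w)%C z = (- (ckern * (f z * phi z)))%C); [|rewrite K; cring].
  apply CT_unique. apply (clim_ext (fun n => RtoC (-1) * Pint (fun w => f w * psi w * dkern z (/ 2 ^ n) w))%C).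
  - intro n. pose proof (weakhol_kernel f U psi dpsi z (/ 2 ^ n) Hw Hp HU (pow2_pos n)) as W.
    unfold ctrunc. cbv beta. set (b := Pint (fun w => f w * psi w * dkern z (/ 2 ^ n) w)%C) in *.
    set (a := Pint (fun w => f w * dpsi w * kern z (/ 2 ^ n) w)%C) in *.
    replace b with ((a + b) - a)%C by cring. rewrite W. cring.
  - replace (- (ckern * (f z * phi z)))%C with (RtoC (-1) * (f z * psi z * ckern))%C by (rewrite E; cring).
    apply clim_scal. intros eps He.
    assert (Hfp : acont (fun w => f w * psi w)%C) by (apply acont_mult; [assumption|apply (test_acont _ _ Hp)]).
    destruct (Pint_dkern_approx (fun w => f w * psi w)%C z eps He (Hfp z)) as (d & Hd & K).
    destruct (pow2_small d Hd) as [N HN]. exists N. intros n Hn. apply K.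
    + generalize (pow2_pos n), (pow2_le N n Hn). lra.
    + apply acont_mult; [assumption|apply dkern_acont, pow2_pos].
Qed.

(** The operator depends on dbar f only. Hence f may be normalized to vanish at the centre of a
    cell, and the oscillation of f replaces its supremum in all estimates. *)
Lemma vit_const phi dphi c z : test phi dphi -> vit phi dphi (fun _ => c) z = RtoC 0.
Proof.
  intros Ht. rewrite (vit_weakhol phi dphi _ phi dphi (fun _ => True)); auto using acont_const.
  - assert (A := acont_const (RtoC 0)).
    assert (S : csupp (fun _ => RtoC 0)) by (exists 1; split; [lra|]; intros w _; reflexivity).
    rewrite (CT_ext _ (fun w => RtoC 0 * (fun _ => RtoC 0) w)%C) by (intro; cring).
    rewrite CT_scal by assumption. cring.
  - apply holo_weakhol. intros w _. apply holo_dbar, dbar_const.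
Qed.

Lemma vit_holo phi dphi f U z0 : test phi dphi -> acont f -> openC U -> (forall z, U z -> Cdiff1 f z) -> U z0 ->
  Cdiff1 (vit phi dphi f) z0.
Proof.
  intros Ht Hf HU Hh Hz0. destruct (HU z0 Hz0) as (r & Hr & K).
  set (s := r / 8). assert (Hs : 0 < s) by (unfold s; lra).
  (* [psi] equals [phi] near z0 and is supported in U, so f * (dphi - dpsi) vanishes near z0 and its
     Cauchy transform is holomorphic there. *)
  set (psi := fun w => (cutoff z0 s w * phi w)%C).
  set (dpsi := fun w => (dcutoff z0 s w * phi w + cutoff z0 s w * dphi w)%C).
  assert (Hcut := cutoff_test z0 s Hs).
  assert (Hp : test psi dpsi).
  { apply test_mult; [apply Ht|apply Ht|assumption]. }
  set (g := fun w => (f w * (dphi w - dpsi w))%C).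
  assert (Hga : acont g) by (apply acont_mult; [assumption|apply acont_minus; [apply Ht|apply Hp]]).
  assert (Hgs : csupp g) by (apply csupp_mult_r, csupp_minus; [apply (test_csupp _ _ Ht)|apply (test_csupp _ _ Hp)]).
  assert (Hgz : forall w, ksq z0 s w -> g w = RtoC 0).
  { intros w Hw. unfold g, dpsi. destruct (cutoff_one z0 s w Hs Hw) as [-> ->]. cring. }
  assert (Hgl : forall z, Cmod (z - z0) < s -> lzero g z).
  { intros z Hz. exists (s - Cmod (z - z0)). split; [lra|]. intros w Hw. apply Hgz, mod_ksq.
    generalize (Cmod_sub_triangle w z z0). lra. }
  destruct (cauchy_holo g z0 Hga Hgs) as (r' & Hr' & H).
  { apply Hgl. rewrite Cmod_subself; assumption. }
  apply (Cdiff1_ext_loc (cauchy_transform g) _ _ s); [assumption| |apply H; rewrite Cmod_subself; assumption].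
  intros w Hw. rewrite <- CT_lzero by auto. symmetry.
  apply (vit_weakhol phi dphi f psi dpsi U); try assumption.
  - apply holo_weakhol, Hh.
  - intro t. destruct (classic (ksq z0 (2 * s) t)) as [Ht2|Ht2].
    + left. apply K. apply ksq_mod in Ht2. unfold s in *. lra.
    + right. apply lzero_mult_l, cutoff_lzero_outside; assumption.
  - unfold psi. destruct (cutoff_one z0 s w Hs) as [-> _]; [apply mod_ksq; lra|]. cring.
Qed.

Lemma vit_one phi dphi f z : test phi dphi -> acont f ->
  (forall w, f w = RtoC 0 \/ (phi w = RtoC 1 /\ dphi w = RtoC 0)) -> vit phi dphi f z = (ckern * f z)%C.
Proof.
  intros Ht Hf H. unfold vit.
  assert (A := acont_const (RtoC 0)).
  assert (S : csupp (fun _ => RtoC 0)) by (exists 1; split; [lra|]; intros w _; reflexivity).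
  rewrite (CT_ext _ (fun w => RtoC 0 * (fun _ => RtoC 0) w)%C).
  2: { intro w. destruct (H w) as [->|[_ ->]]; cring. }
  rewrite (CT_scal (RtoC 0) (fun _ => RtoC 0)) by assumption.
  destruct (H z) as [->|[-> _]]; cring.
Qed.

Lemma vit_add_phi phi dphi phi' dphi' f z : test phi dphi -> test phi' dphi' -> acont f ->
  vit (fun w => phi w + phi' w)%C (fun w => dphi w + dphi' w)%C f z = (vit phi dphi f z + vit phi' dphi' f z)%C.
Proof.
  intros Ht Ht' Hf. unfold vit.
  rewrite (CT_ext _ (fun w => f w * dphi w + f w * dphi' w)%C) by (intro; cring).
  destruct (Ht) as (_ & Ha & _). destruct (Ht') as (_ & Ha' & _).
  pose proof (test_csupp _ _ Ht). pose proof (test_csupp _ _ Ht').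
  rewrite CT_plus; auto using acont_mult, csupp_mult_r. ring.
Qed.

(** * Decay of localized functions with vanishing moments *)

Definition tent (p : C) (N : nat) : C -> C := bump hat p (/ 2 ^ N).
Definition dtent (p : C) (N : nat) : C -> C := dbump hat dhat p (/ 2 ^ N).

Lemma tent_test p N : test (tent p N) (dtent p N).
Proof.
  apply (bump_test _ _ _ _ 1); [apply pow2_pos|lra|apply smooth1_hat|]. intros; apply hat_zero; assumption.
Qed.

Lemma tent_supp p N : supp_in (fst p - / 2 ^ N) (snd p - / 2 ^ N) (2 * / 2 ^ N) (tent p N).
Proof.
  pose proof (bump_supp hat p (/ 2 ^ N) 1 (pow2_pos N)) as H.
  rewrite !Rmult_1_l, Rmult_1_r in H. apply H. intros; apply hat_zero; assumption.
Qed.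

Lemma dtent_supp p N : supp_in (fst p - / 2 ^ N) (snd p - / 2 ^ N) (2 * / 2 ^ N) (dtent p N).
Proof. apply (test_supp_in _ _ _ _ _ (tent_test p N)), tent_supp. Qed.

Lemma dtent_mod p N w : Cmod (dtent p N w) <= 2 / / 2 ^ N.
Proof. apply dbump_mod; [apply pow2_pos|apply hat_range|apply dhat_range]. Qed.

(** Up to sign, the coefficient of (z - p)^(-k-1) in the expansion at infinity of the localization
    of f at p, since 1 / (w - z) is minus the sum of (w - p)^k / (z - p)^(k+1). *)
Definition moment (p : C) (N k : nat) (f : C -> C) : C := Pint (fun w => f w * dtent p N w * (w - p) ^ k)%C.

Lemma acont_pow p k : acont (fun w => (w - p) ^ k)%C.
Proof.
  induction k as [|k IH]; simpl; [apply acont_const|].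
  apply acont_mult; [|assumption]. apply acont_minus; [|apply acont_const].
  intro z. apply (dbar_cont_at _ _ _ (dbar_id z)).
Qed.

Lemma acont_moment p N k f : acont f -> acont (fun w => f w * dtent p N w * (w - p) ^ k)%C.
Proof. intros. apply acont_mult; [apply acont_mult; [assumption|apply tent_test]|apply acont_pow]. Qed.

Lemma csupp_moment p N k (f : C -> C) : csupp (fun w => f w * dtent p N w * (w - p) ^ k)%C.
Proof. apply csupp_mult_l, csupp_mult_r, (test_csupp _ _ (tent_test p N)). Qed.

Lemma moment_plus p N k f g : acont f -> acont g ->
  moment p N k (fun w => f w + g w)%C = (moment p N k f + moment p N k g)%C.
Proof.
  intros. unfold moment. rewrite <- Pint_plus; auto using acont_moment, csupp_moment.
  apply Pint_ext; intro; cring.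
Qed.

Lemma moment_scal p N k c f : acont f -> moment p N k (fun w => c * f w)%C = (c * moment p N k f)%C.
Proof.
  intros. unfold moment. rewrite <- Pint_scal; auto using acont_moment, csupp_moment.
  apply Pint_ext; intro; cring.
Qed.

Lemma moment_le p N k f M : acont f -> (forall w, ksq p (/ 2 ^ N) w -> Cmod (f w) <= M) ->
  Cmod (moment p N k f) <= 4 * (M * (2 / / 2 ^ N) * (2 * / 2 ^ N) ^ k) * (2 * / 2 ^ N) ^ 2.
Proof.
  intros Hf HM. pose proof (pow2_pos N) as P.
  apply (Pint_le (fst p - / 2 ^ N) (snd p - / 2 ^ N)); [lra|apply acont_moment; assumption| |].
  - intros w Hw. rewrite dtent_supp by assumption. cring.
  - intros w Hw. apply ksq_insq in Hw. rewrite !Cmod_mult, Cmod_pow.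
    apply Rmult_le_compat; [apply Rmult_le_pos; apply Cmod_ge_0|apply pow_le, Cmod_ge_0| |].
    + apply Rmult_le_compat; auto using Cmod_ge_0, dtent_mod.
    + apply pow_incr. split; [apply Cmod_ge_0|apply ksq_mod, Hw].
Qed.

(** The slope 2 / s of the tent, with s = 2^-N, cancels the factor s gained in [CT_bound], so the
    bound does not depend on the mesh; 1568 = 2 * 784. *)
Lemma vit_near p N f M z : acont f -> 0 <= M -> (forall w, ksq p (/ 2 ^ N) w -> Cmod (f w) <= M) ->
  Cmod (vit (tent p N) (dtent p N) f z) <= (Cmod ckern + 1568) * M.
Proof.
  intros Hf HM0 HM. pose proof (pow2_pos N) as P. unfold vit.
  eapply Rle_trans; [apply Cmod_triangle|].
  assert (K1 : Cmod (ckern * (f z * tent p N z)) <= Cmod ckern * M).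
  { rewrite Cmod_mult. apply Rmult_le_compat_l; [apply Cmod_ge_0|].
    destruct (classic (ksq p (/ 2 ^ N) z)) as [H|H].
    - rewrite Cmod_mult. rewrite <- (Rmult_1_r M). apply Rmult_le_compat; auto using Cmod_ge_0.
      apply bump_mod, hat_range.
    - rewrite tent_supp by (intro K; apply H, ksq_insq, K). replace (_ * _)%C with (RtoC 0) by cring.
      rewrite Cmod_0; assumption. }
  assert (K2 : Cmod (CT (fun w => f w * dtent p N w)%C z) <= 784 * (M * (2 / / 2 ^ N)) * / 2 ^ N).
  { apply (CT_bound _ _ (fst p - / 2 ^ N) (snd p - / 2 ^ N)).
    - apply acont_mult; [assumption|apply tent_test].
    - intros w Hw. rewrite dtent_supp by assumption. cring.
    - intro w. destruct (classic (ksq p (/ 2 ^ N) w)) as [H|H].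
      + rewrite Cmod_mult. apply Rmult_le_compat; auto using Cmod_ge_0, dtent_mod.
      + rewrite dtent_supp by (intro K; apply H, ksq_insq, K). replace (_ * _)%C with (RtoC 0) by cring.
        rewrite Cmod_0. apply Rmult_le_pos; [assumption|]. apply Rlt_le, Rdiv_lt_0_compat; lra. }
  replace (784 * (M * (2 / / 2 ^ N)) * / 2 ^ N) with (1568 * M) in K2; [lra|].
  field. apply pow_nonzero; lra.
Qed.

Lemma vit_far p N f M z : acont f -> 0 <= M -> (forall w, ksq p (/ 2 ^ N) w -> Cmod (f w) <= M) ->
  moment p N 0 f = RtoC 0 -> moment p N 1 f = RtoC 0 -> moment p N 2 f = RtoC 0 ->
  4 * / 2 ^ N <= Cmod (z - p) ->
  Cmod (vit (tent p N) (dtent p N) f z) <= 512 * M * (/ 2 ^ N) ^ 4 / Cmod (z - p) ^ 4.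
Proof.
  intros Hf HM0 HM L0 L1 L2 Hz. pose proof (pow2_pos N) as P.
  assert (Hnz : ~ ksq p (/ 2 ^ N) z).
  { intro K. apply ksq_mod in K. lra. }
  assert (HW0 : (z - p)%C <> RtoC 0) by (apply Cmod_gt_0; lra).
  set (g := fun w => (f w * dtent p N w)%C).
  assert (Hga : acont g) by (apply acont_mult; [assumption|apply tent_test]).
  assert (Hgs0 : supp_in (fst p - / 2 ^ N) (snd p - / 2 ^ N) (2 * / 2 ^ N) g).
  { intros w Hw. unfold g. rewrite dtent_supp by assumption. cring. }
  assert (Hgs : csupp g) by (apply csupp_mult_r, (test_csupp _ _ (tent_test p N))).
  assert (Hgl : lzero g z) by (apply (supp_in_lzero _ _ _ _ _ Hgs0); intro K; apply Hnz, ksq_insq, K).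
  unfold vit. rewrite tent_supp by (intro K; apply Hnz, ksq_insq, K).
  fold g. rewrite CT_lzero by assumption.
  set (W := (z - p)%C) in *.
  set (h := fun w => (g w * (w - p) ^ 3 * / (w - z))%C).
  assert (Hha : acont h).
  { apply (acont_cauchy (fun w => g w * (w - p) ^ 3)%C); [apply acont_mult; [assumption|apply acont_pow]|apply lzero_mult_l, Hgl]. }
  assert (Hhs : csupp h) by (apply csupp_mult_l, csupp_mult_l, Hgs).
  (* The geometric expansion of 1 / (w - z) in (w - p) / W, stopped after three terms with its exact
     remainder (w - p)^3 / (W^3 (w - z)). The remainder alone survives and supplies the order -4. *)
  assert (E : cauchy_transform g z = ((- / W) * moment p N 0 f + ((- / (W * W)) * moment p N 1 f
     + ((- / (W * W * W)) * moment p N 2 f + / (W * W * W) * Pint h)))%C).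
  { unfold moment. rewrite <- !Pint_scal by (auto using acont_moment, csupp_moment).
    rewrite <- !Pint_plus; auto 10 using acont_moment, csupp_moment, acont_plus, acont_scal, csupp_plus, csupp_mult_r.
    unfold cauchy_transform. apply Pint_ext. intro w. unfold h, g.
    destruct (classic (w = z)) as [->|Hn].
    - pose proof (lzero_at _ _ Hgl) as E0. unfold g in E0. rewrite E0. cring.
    - assert (Hwz : (w - z)%C <> RtoC 0).
      { intro K. apply Hn. replace w with ((w - z) + z)%C by cring. rewrite K; cring. }
      unfold W. field. split; assumption. }
  rewrite E, L0, L1, L2.
  replace (_ + _)%C with (/ (W * W * W) * Pint h)%C by ring.
  rewrite Cmod_mult, Cmod_inv, !Cmod_mult by (repeat apply Cmult_neq_0; assumption).
  set (x := Cmod W) in *. set (s := / 2 ^ N) in *. assert (Hx : 0 < x) by lra.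
  assert (K : Cmod (Pint h) <= 4 * (32 * M * s ^ 2 / x) * (2 * s) ^ 2).
  { apply (Pint_le (fst p - s) (snd p - s)); [lra|assumption| |].
    - intros w Hw. unfold h. rewrite Hgs0 by assumption. cring.
    - intros w Hw. apply ksq_insq in Hw. pose proof (ksq_mod _ _ _ Hw) as Hw2.
      assert (N1 : x / 2 <= Cmod (w - z)).
      { generalize (Cmod_sub_triangle z w p). rewrite (Cmod_sub_sym z w). fold W. fold x. lra. }
      unfold h, g. rewrite !Cmod_mult, Cmod_inv, Cmod_pow by (apply Cmod_gt_0; lra).
      replace (32 * M * s ^ 2 / x) with (M * (2 / s) * (2 * s) ^ 3 * / (x / 2)) by (field; lra).
      apply Rmult_le_compat.
      + repeat apply Rmult_le_pos; try apply Cmod_ge_0; lra.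
      + left; apply Rinv_0_lt_compat; lra.
      + apply Rmult_le_compat; [apply Rmult_le_pos; apply Cmod_ge_0|apply pow_le, Cmod_ge_0| |].
        * apply Rmult_le_compat; try apply Cmod_ge_0; [auto|apply dtent_mod].
        * apply pow_incr. split; [apply Cmod_ge_0|assumption].
      + apply Rinv_le_contravar; lra. }
  apply Rmult_le_reg_l with (x * x * x); [repeat apply Rmult_lt_0_compat; assumption|].
  rewrite <- Rmult_assoc, Rinv_r, Rmult_1_l.
  - eapply Rle_trans; [exact K|]. right. field. lra.
  - assert (0 < x * x * x) by (repeat apply Rmult_lt_0_compat; assumption). lra.
Qed.

(** A product rather than a radial function, so that its sum over the grid factors into two
    one-dimensional sums. It still dominates the fourth power, as (1 + u^2)(1 + v^2) <= 2 (u^2 +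
    v^2)^2 once u^2 + v^2 >= 16. *)
Definition decay (p : C) (N : nat) (z : C) : R :=
  / (1 + ((fst z - fst p) / / 2 ^ N) ^ 2) * / (1 + ((snd z - snd p) / / 2 ^ N) ^ 2).

(** Within distance 4 * 2^-N one has (1 + u^2)(1 + v^2) <= 17^2 = 289 and [vit_near] applies; beyond
    it [vit_far] contributes 2 * 512. *)
Definition Cdecay : R := 289 * (Cmod ckern + 1568) + 1024.

Lemma Cdecay_pos : 0 < Cdecay.
Proof. unfold Cdecay. generalize (Cmod_ge_0 ckern). lra. Qed.

Lemma vit_decay p N f M z : acont f -> 0 <= M -> (forall w, ksq p (/ 2 ^ N) w -> Cmod (f w) <= M) ->
  moment p N 0 f = RtoC 0 -> moment p N 1 f = RtoC 0 -> moment p N 2 f = RtoC 0 ->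
  Cmod (vit (tent p N) (dtent p N) f z) <= Cdecay * M * decay p N z.
Proof.
  intros Hf HM0 HM L0 L1 L2. pose proof (pow2_pos N) as P. unfold decay.
  set (s := / 2 ^ N) in *. set (u := (fst z - fst p) / s). set (v := (snd z - snd p) / s).
  assert (Hu := pow2_ge_0 u). assert (Hv := pow2_ge_0 v).
  rewrite <- Rinv_mult. assert (HD : 0 < (1 + u ^ 2) * (1 + v ^ 2)) by nra.
  assert (Ew : Cmod (z - p) ^ 2 = s ^ 2 * (u ^ 2 + v ^ 2)).
  { rewrite Cmod2_alt. unfold u, v. simpl. field. lra. }
  assert (Hck := Cmod_ge_0 ckern).
  apply Rmult_le_reg_r with ((1 + u ^ 2) * (1 + v ^ 2)); [assumption|].
  rewrite (Rmult_assoc _ (/ _)), Rinv_l, Rmult_1_r by lra.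
  destruct (Rle_dec (4 * s) (Cmod (z - p))) as [Hfar|Hnear].
  - pose proof (vit_far p N f M z Hf HM0 HM L0 L1 L2 Hfar) as K. fold s in K.
    replace (Cmod (z - p) ^ 4) with ((Cmod (z - p) ^ 2) ^ 2) in K by ring. rewrite Ew in K.
    assert (H16 : 16 <= u ^ 2 + v ^ 2).
    { apply Rmult_le_reg_l with (s ^ 2); [apply pow_lt; assumption|]. rewrite <- Ew.
      replace (s ^ 2 * 16) with ((4 * s) ^ 2) by ring. apply pow_incr; lra. }
    replace (512 * M * s ^ 4 / (s ^ 2 * (u ^ 2 + v ^ 2)) ^ 2) with (512 * M / (u ^ 2 + v ^ 2) ^ 2) in K by (field; lra).
    apply Rmult_le_compat_r with (r := (1 + u ^ 2) * (1 + v ^ 2)) in K; [|lra].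
    eapply Rle_trans; [exact K|].
    replace (512 * M / (u ^ 2 + v ^ 2) ^ 2 * ((1 + u ^ 2) * (1 + v ^ 2)))
      with (512 * M * (((1 + u ^ 2) * (1 + v ^ 2)) / (u ^ 2 + v ^ 2) ^ 2)) by (field; lra).
    assert (H2 : (1 + u ^ 2) * (1 + v ^ 2) / (u ^ 2 + v ^ 2) ^ 2 <= 2).
    { apply Rmult_le_reg_r with ((u ^ 2 + v ^ 2) ^ 2); [apply pow_lt; lra|].
      unfold Rdiv. rewrite Rmult_assoc, Rinv_l, Rmult_1_r by (apply pow_nonzero; lra). nra. }
    unfold Cdecay. apply Rle_trans with (512 * M * 2); [apply Rmult_le_compat_l; lra|]. nra.
  - pose proof (vit_near p N f M z Hf HM0 HM) as K.
    assert (H16 : u ^ 2 + v ^ 2 <= 16).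
    { apply Rmult_le_reg_l with (s ^ 2); [apply pow_lt; assumption|]. rewrite <- Ew.
      replace (s ^ 2 * 16) with ((4 * s) ^ 2) by ring. apply pow_incr. generalize (Cmod_ge_0 (z - p)). lra. }
    assert (H2 : (1 + u ^ 2) * (1 + v ^ 2) <= 289) by nra.
    apply Rle_trans with ((Cmod ckern + 1568) * M * 289).
    + apply Rmult_le_compat; [apply Cmod_ge_0|lra|assumption|assumption].
    + unfold Cdecay. nra.
Qed.

(** * Finite-rank approximation of the localization operator *)

(* If lam vanishes on the unit ball then kap = 0; otherwise G nearly maximizes |lam| there and kap = 1 / lam G. *)
Lemma near_extremal (V : (C -> C) -> Prop) (Q : C -> Prop) (lam : (C -> C) -> C) :
  (forall c F, V F -> V (fun w => c * F w)%C) -> (forall c F, V F -> lam (fun w => c * F w)%C = (c * lam F)%C) ->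
  (exists B, forall F, V F -> (forall w, Q w -> Cmod (F w) <= 1) -> Cmod (lam F) <= B) -> (exists F, V F) ->
  exists G kap, V G /\ (forall w, Q w -> Cmod (G w) <= 1) /\
    forall F M, V F -> 0 < M -> (forall w, Q w -> Cmod (F w) <= M) ->
      Cmod (kap * lam F) <= 2 * M /\ lam F = (kap * lam F * lam G)%C.
Proof.
  intros Hsc Hlin [B HB] [F0 HF0].
  set (G0 := fun w => (RtoC 0 * F0 w)%C).
  assert (HG0 : V G0) by (apply Hsc, HF0).
  assert (HG01 : forall w, Q w -> Cmod (G0 w) <= 1).
  { intros w _. unfold G0. rewrite Cmod_mult, Cmod_0. lra. }
  destruct (completeness (fun x => exists F, V F /\ (forall w, Q w -> Cmod (F w) <= 1) /\ x = Cmod (lam F))) as [S [HS1 HS2]].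
  { exists B. intros x (F & HF & HF1 & ->). auto. }
  { exists (Cmod (lam G0)), G0. auto. }
  assert (Hsup : forall F M, V F -> 0 < M -> (forall w, Q w -> Cmod (F w) <= M) -> Cmod (lam F) <= S * M).
  { intros F M HF HM HFM.
    assert (Hr : Cmod (lam (fun w => RtoC (/ M) * F w)%C) <= S).
    { apply HS1. exists (fun w => RtoC (/ M) * F w)%C. split; [apply Hsc, HF|split; [|reflexivity]].
      intros w Hw. rewrite Cmod_mult, Cmod_R, Rabs_right by (left; apply Rinv_0_lt_compat, HM).
      apply Rmult_le_reg_l with M; [assumption|]. rewrite <- Rmult_assoc, Rinv_r, Rmult_1_l, Rmult_1_r by lra. auto. }
    rewrite Hlin, Cmod_mult, Cmod_R, Rabs_right in Hr by (try (left; apply Rinv_0_lt_compat, HM); assumption).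
    apply Rmult_le_compat_r with (r := M) in Hr; [|lra].
    replace (/ M * Cmod (lam F) * M) with (Cmod (lam F)) in Hr by (field; lra). exact Hr. }
  destruct (Rle_dec S 0) as [HS|HS].
  - exists G0, (RtoC 0). split; [assumption|split; [assumption|]]. intros F M HF HM HFM.
    assert (E : lam F = RtoC 0).
    { apply Cmod_le_0. specialize (Hsup F M HF HM HFM). nra. }
    rewrite E. split; [|cring]. replace (0 * 0)%C with (RtoC 0) by cring. rewrite Cmod_0; lra.
  - assert (HG : exists G, V G /\ (forall w, Q w -> Cmod (G w) <= 1) /\ S / 2 < Cmod (lam G)).
    { apply NNPP; intro Hno. assert (S <= S / 2); [|lra]. apply HS2. intros x (F & HF & HF1 & ->).
      apply Rnot_lt_le; intro Hlt. apply Hno. exists F; auto. }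
    destruct HG as (G & HG & HG1 & HG2). exists G, (/ lam G)%C.
    assert (Hn : lam G <> RtoC 0) by (apply Cmod_gt_0; lra).
    split; [assumption|split; [assumption|]]. intros F M HF HM HFM. split; [|field; assumption].
    rewrite Cmod_mult, Cmod_inv by assumption. specialize (Hsup F M HF HM HFM).
    apply Rmult_le_reg_l with (Cmod (lam G)); [lra|]. rewrite <- Rmult_assoc, Rinv_r, Rmult_1_l by lra. nra.
Qed.

Lemma acont_comb f g (c : C) : acont f -> acont g -> acont (fun w => f w + (- c) * g w)%C.
Proof. intros. apply acont_plus, acont_scal; assumption. Qed.

Lemma Cdiff1_comb (f g : C -> C) (c z : C) : Cdiff1 f z -> Cdiff1 g z -> Cdiff1 (fun w => Cplus (f w) (Cmult c (g w))) z.
Proof.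
  intros Hf Hg. apply holo_dbar. apply holo_dbar in Hf. apply holo_dbar in Hg.
  eapply dbar_eq; [|apply dbar_plus; [exact Hf|apply dbar_scal, Hg]]. cring.
Qed.

Definition holcont (U : C -> Prop) (F : C -> C) : Prop := acont F /\ forall z, U z -> Cdiff1 F z.

Lemma holcont_comb U F G c : holcont U F -> holcont U G -> holcont U (fun w => F w + c * G w)%C.
Proof.
  intros [H1 H2] [H3 H4]. split; [apply acont_plus, acont_scal; assumption|].
  intros z Hz. apply Cdiff1_comb; auto.
Qed.

Lemma holcont_scal U F c : holcont U F -> holcont U (fun w => c * F w)%C.
Proof. intros [H1 H2]. split; [apply acont_scal; assumption|]. intros z Hz. apply Cdiff1_scal; auto. Qed.

Lemma comb_bound (F G : C -> C) (c : C) (Q : C -> Prop) M x :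
  (forall w, Q w -> Cmod (F w) <= M) -> (forall w, Q w -> Cmod (G w) <= 1) -> Cmod c <= x ->
  forall w, Q w -> Cmod (F w + (- c) * G w) <= M + x.
Proof.
  intros HF HG Hc w Hw. eapply Rle_trans; [apply Cmod_triangle|]. rewrite Cmod_mult, Cmod_opp.
  specialize (HF w Hw). specialize (HG w Hw). generalize (Cmod_ge_0 c), (Cmod_ge_0 (G w)). nra.
Qed.

(** A triangular scheme: [G2] is extremal among functions with moment 0 equal to zero, [G3] among
    those with moments 0 and 1 equal to zero, so each correction preserves what the previous ones
    achieved. Removing a moment at most triples the supremum, whence 27. The coefficients are linear
    in the moments of F, with a matrix independent of F. *)
Lemma local_finite_rank (U : C -> Prop) (p : C) (N : nat) :
  exists (G1 G2 G3 : C -> C) (m1 m2 m3 : nat -> C), holcont U G1 /\ holcont U G2 /\ holcont U G3 /\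
    forall F M, holcont U F -> 0 < M -> (forall w, ksq p (/ 2 ^ N) w -> Cmod (F w) <= M) ->
    let x (m : nat -> C) := (m 0%nat * moment p N 0 F + m 1%nat * moment p N 1 F + m 2%nat * moment p N 2 F)%C in
    let T := vit (tent p N) (dtent p N) in
    forall z, Cmod (T F z - (x m1 * T G1 z + x m2 * T G2 z + x m3 * T G3 z)) <= Cdecay * (27 * M) * decay p N z.
Proof.
  set (Q := ksq p (/ 2 ^ N)). set (lam := moment p N).
  assert (Hlin : forall k c F, acont F -> lam k (fun w => c * F w)%C = (c * lam k F)%C) by (intros; apply moment_scal; assumption).
  assert (Hcomb : forall k c F G, acont F -> acont G -> lam k (fun w => F w + (- c) * G w)%C = (lam k F - c * lam k G)%C).
  { intros k c F G HF HG. unfold lam. rewrite moment_plus, moment_scal by auto using acont_scal. cring. }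
  assert (Hbd : forall k, exists B, forall F, acont F -> (forall w, Q w -> Cmod (F w) <= 1) -> Cmod (lam k F) <= B).
  { intro k. eexists. intros F HF HF1. apply (moment_le p N k F 1 HF HF1). }
  set (V0 := fun F => holcont U F).
  set (V1 := fun F => holcont U F /\ lam 0%nat F = RtoC 0).
  set (V2 := fun F => holcont U F /\ lam 0%nat F = RtoC 0 /\ lam 1%nat F = RtoC 0).
  assert (HZ : holcont U (fun _ => RtoC 0)).
  { split; [apply acont_const|]. intros z _. apply holo_dbar, dbar_const. }
  assert (HZl : forall k, lam k (fun _ => RtoC 0) = RtoC 0).
  { intro k. pose proof (Hlin k (RtoC 0) (fun _ => RtoC 0) (acont_const _)) as E. cbv beta in E.
    replace (fun _ : C => (0 * 0)%C) with (fun _ : C => RtoC 0) in E.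
    - rewrite E. cring.
    - apply functional_extensionality; intro; cring. }
  destruct (near_extremal V0 Q (lam 0%nat)) as (G1 & k1 & [A1 D1] & B1 & X1).
  { intros c F HF. apply holcont_scal, HF. }
  { intros c F [HF _]. apply Hlin, HF. }
  { destruct (Hbd 0%nat) as [B HB]. exists B. intros F [HF _]. apply HB, HF. }
  { exists (fun _ => RtoC 0). exact HZ. }
  destruct (near_extremal V1 Q (lam 1%nat)) as (G2 & k2 & [[A2 D2] Z2] & B2 & X2).
  { intros c F [HF HF0]. split; [apply holcont_scal, HF|]. rewrite Hlin, HF0 by apply HF. cring. }
  { intros c F [[HF _] _]. apply Hlin, HF. }
  { destruct (Hbd 1%nat) as [B HB]. exists B. intros F [[HF _] _]. apply HB, HF. }
  { exists (fun _ => RtoC 0). split; [exact HZ|apply HZl]. }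
  destruct (near_extremal V2 Q (lam 2%nat)) as (G3 & k3 & [[A3 D3] [Z30 Z31]] & B3 & X3).
  { intros c F (HF & HF0 & HF1). split; [apply holcont_scal, HF|]. rewrite !Hlin, HF0, HF1 by apply HF. split; cring. }
  { intros c F [[HF _] _]. apply Hlin, HF. }
  { destruct (Hbd 2%nat) as [B HB]. exists B. intros F [[HF _] _]. apply HB, HF. }
  { exists (fun _ => RtoC 0). split; [exact HZ|split; apply HZl]. }
  (* The rows of the matrix: they unwind x1 = k1 lam0(F), x2 = k2 lam1(F - x1 G1) and x3 = k3 lam2(F
     - x1 G1 - x2 G2) in terms of the three moments of F. *)
  set (m1 := fun i : nat => match i with O => k1 | _ => RtoC 0 end).
  set (m2 := fun i : nat => match i with O => (- (k2 * k1 * lam 1%nat G1))%C | 1%nat => k2 | _ => RtoC 0 end).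
  set (m3 := fun i : nat => match i with
     | O => (k3 * lam 2%nat G2 * k2 * k1 * lam 1%nat G1 - k3 * lam 2%nat G1 * k1)%C
     | 1%nat => (- (k3 * lam 2%nat G2 * k2))%C | _ => k3 end).
  exists G1, G2, G3, m1, m2, m3. split; [split; assumption|split; [split; assumption|split; [split; assumption|]]].
  intros F M HF HM HFM x T z.
  assert (HFa : acont F) by apply HF.
  destruct (X1 F M HF HM HFM) as [C1 E1].
  set (x1 := (k1 * lam 0%nat F)%C) in *.
  set (F1 := fun w => (F w + (- x1) * G1 w)%C).
  assert (HF1 : holcont U F1) by (apply holcont_comb; [assumption|split; assumption]).
  assert (HF1b : forall w, Q w -> Cmod (F1 w) <= 3 * M).
  { intros w Hw. eapply Rle_trans; [apply (comb_bound F G1 x1 Q M (2 * M)); assumption|lra]. }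
  assert (L10 : lam 0%nat F1 = RtoC 0).
  { unfold F1. rewrite Hcomb by assumption. rewrite E1 at 1. cring. }
  destruct (X2 F1 (3 * M)) as [C2 E2]; [split; assumption|lra|assumption|].
  set (x2 := (k2 * lam 1%nat F1)%C) in *.
  set (F2 := fun w => (F1 w + (- x2) * G2 w)%C).
  assert (HF2 : holcont U F2) by (apply holcont_comb; [assumption|split; assumption]).
  assert (HF2b : forall w, Q w -> Cmod (F2 w) <= 9 * M).
  { intros w Hw. eapply Rle_trans; [apply (comb_bound F1 G2 x2 Q (3 * M) (2 * (3 * M))); assumption|lra]. }
  assert (L20 : lam 0%nat F2 = RtoC 0).
  { unfold F2. rewrite Hcomb, L10, Z2 by (try assumption; apply HF1). cring. }
  assert (L21 : lam 1%nat F2 = RtoC 0).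
  { unfold F2. rewrite Hcomb by (try assumption; apply HF1). rewrite E2 at 1. cring. }
  destruct (X3 F2 (9 * M)) as [C3 E3]; [split; [assumption|split; assumption]|lra|assumption|].
  set (x3 := (k3 * lam 2%nat F2)%C) in *.
  set (F3 := fun w => (F2 w + (- x3) * G3 w)%C).
  assert (HF3a : acont F3) by (apply acont_comb; [apply HF2|assumption]).
  assert (HF3b : forall w, Q w -> Cmod (F3 w) <= 27 * M).
  { intros w Hw. eapply Rle_trans; [apply (comb_bound F2 G3 x3 Q (9 * M) (2 * (9 * M))); assumption|lra]. }
  assert (L30 : lam 0%nat F3 = RtoC 0).
  { unfold F3. rewrite Hcomb, L20, Z30 by (try assumption; apply HF2). cring. }
  assert (L31 : lam 1%nat F3 = RtoC 0).
  { unfold F3. rewrite Hcomb, L21, Z31 by (try assumption; apply HF2). cring. }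
  assert (L32 : lam 2%nat F3 = RtoC 0).
  { unfold F3. rewrite Hcomb by (try assumption; apply HF2). rewrite E3 at 1. cring. }
  assert (Ex1 : x m1 = x1).
  { unfold x, m1, x1, lam. cring. }
  assert (Ex2 : x m2 = x2).
  { unfold x, m2, x2. unfold F1. rewrite Hcomb by assumption. unfold x1, lam. ring. }
  assert (Ex3 : x m3 = x3).
  { unfold x3. unfold F2. rewrite Hcomb by (try assumption; apply HF1). unfold x2, F1.
    rewrite !Hcomb by assumption. unfold x, m3, x1, lam. ring. }
  rewrite Ex1, Ex2, Ex3.
  assert (Ht := tent_test p N).
  assert (ET : T F3 z = (T F z - (x1 * T G1 z + x2 * T G2 z + x3 * T G3 z))%C).
  { unfold T, F3. rewrite vit_plus, vit_scal by (try assumption; try apply acont_scal; try assumption; apply HF2).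
    unfold F2. rewrite vit_plus, vit_scal by (try assumption; try apply acont_scal; try assumption; apply HF1).
    unfold F1. rewrite vit_plus, vit_scal by (try assumption; try apply acont_scal; try assumption; apply HF1).
    ring. }
  rewrite <- ET. apply vit_decay; try assumption. lra.
Qed.

(** * Finite-dimensional complex space *)

Lemma vnorm_ge_0 n (z : Cn n) : 0 <= vnorm n z.
Proof.
  induction n as [|n IH]; simpl; [lra|]. eapply Rle_trans; [apply (Cmod_ge_0 (z Fin.F1))|apply Rmax_l].
Qed.

Lemma vnorm_le n (z : Cn n) r : 0 <= r -> (vnorm n z <= r <-> forall i, Cmod (z i) <= r).
Proof.
  intros Hr. induction n as [|n IH]; simpl.
  - split; [intros _ i; apply (Fin.case0 (fun i => Cmod (z i) <= r) i)|intros; assumption].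
  - split.
    + intros H i. apply (Fin.caseS' i).
      * eapply Rle_trans; [apply Rmax_l|exact H].
      * intro j. apply (proj1 (IH (fun i => z (Fin.FS i)))). eapply Rle_trans; [apply Rmax_r|exact H].
    + intros H. apply Rmax_lub; [apply H|]. apply IH. intro i; apply H.
Qed.

Lemma vnorm_coord n (z : Cn n) i : Cmod (z i) <= vnorm n z.
Proof. apply (proj1 (vnorm_le n z _ (vnorm_ge_0 n z))), Rle_refl. Qed.

Lemma vnorm_triangle n (z w : Cn n) : vnorm n (fun i => Cplus (z i) (w i)) <= vnorm n z + vnorm n w.
Proof.
  apply vnorm_le; [generalize (vnorm_ge_0 n z), (vnorm_ge_0 n w); lra|]. intro i.
  eapply Rle_trans; [apply Cmod_triangle|]. generalize (vnorm_coord n z i), (vnorm_coord n w i). lra.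
Qed.

Lemma vdist_ge_0 n (z w : Cn n) : 0 <= vdist z w.
Proof. apply vnorm_ge_0. Qed.

Lemma vdist_triangle n (z w t : Cn n) : vdist z t <= vdist z w + vdist w t.
Proof.
  unfold vdist. eapply Rle_trans; [|apply vnorm_triangle]. right. f_equal.
  apply functional_extensionality; intro i. cring.
Qed.

Lemma vdist_self n (z : Cn n) : vdist z z = 0.
Proof.
  apply Rle_antisym; [|apply vdist_ge_0]. apply vnorm_le; [lra|]. intro i.
  change (Cmod (z i - z i) <= 0). rewrite Cmod_subself. lra.
Qed.

Definition fcons {n} (c : C) (z : Cn n) : Cn (S n) := fun i => Fin.caseS' i (fun _ => C) c z.

Lemma fcons_eta {n} (z : Cn (S n)) : fcons (z Fin.F1) (fun j => z (Fin.FS j)) = z.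
Proof.
  apply functional_extensionality; intro i. apply (Fin.caseS' i); reflexivity.
Qed.

Lemma Cn0_eq (z w : Cn 0) : z = w.
Proof. apply functional_extensionality; intro i; apply (Fin.case0 (fun i => z i = w i) i). Qed.

Lemma Cn1_eta (z : Cn 1) : (fun _ => z Fin.F1) = z.
Proof.
  apply functional_extensionality; intro i. apply (Fin.caseS' i); [reflexivity|].
  intro j. apply (Fin.case0 (fun j => z Fin.F1 = z (Fin.FS j)) j).
Qed.

Lemma vdist_fcons n (c d : C) (z w : Cn n) : vdist (fcons c z) (fcons d w) = Rmax (Cmod (c - d)) (vdist z w).
Proof. reflexivity. Qed.

(** The finite subcover principle without a finite list: the discs of radius [rho t] that are used
    have radii bounded below by a common d. *)
Lemma gauge_plane (M : R) (rho : C -> R) : (forall z, 0 < rho z) ->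
  exists d, 0 < d /\ forall z, Cmod z <= M -> exists t, Cmod (z - t) < rho t /\ d <= rho t.
Proof.
  intros Hrho. set (L := Rabs M + 1). assert (HL : 0 < L) by (unfold L; generalize (Rabs_pos M); lra).
  destruct (cousin_uniform (fun d z => exists t, Cmod (z - t) < rho t /\ d <= rho t) (- L) (- L) (2 * L)) as (d & Hd & H).
  - lra.
  - intros d d' z Hd (t & A & B). exists t. split; [assumption|lra].
  - intros z _. exists (rho z), (rho z). repeat split; try apply Hrho. intros t Ht. exists z. split; [exact Ht|lra].
  - exists d. split; [assumption|]. intros z Hz. apply H.
    generalize (Cmod_fst z), (Cmod_snd z), (Rle_abs M). intros A1 A2 A3.
    apply Rabs_le_between in A1. apply Rabs_le_between in A2. unfold insq, L in *. lra.
Qed.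

(** The tube lemma as an induction on the dimension: the lower bound [del c] for the slice over c
    serves as a gauge in the plane of the first coordinate. As the norm is a maximum, a disc times a
    ball is contained in the ball wanted. *)
Lemma gauge_box n (M : R) (rho : Cn n -> R) : (forall z, 0 < rho z) ->
  exists d, 0 < d /\ forall z, vnorm n z <= M -> exists t, vdist z t < rho t /\ d <= rho t.
Proof.
  revert rho. induction n as [|n IH]; intros rho Hrho.
  - set (z0 := (fun _ => RtoC 0) : Cn 0). exists (rho z0). split; [apply Hrho|]. intros z _. exists z0.
    rewrite (Cn0_eq z z0), vdist_self. split; [apply Hrho|lra].
  - assert (H : forall c : C, exists d, 0 < d /\ forall z : Cn n, vnorm n z <= M ->
       exists t, vdist z t < rho (fcons c t) /\ d <= rho (fcons c t)).
    { intro c. apply (IH (fun t => rho (fcons c t))). intro; apply Hrho. }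
    set (del := fun c => proj1_sig (constructive_indefinite_description _ (H c))).
    assert (Hdel : forall c, 0 < del c /\ forall z : Cn n, vnorm n z <= M ->
       exists t, vdist z t < rho (fcons c t) /\ del c <= rho (fcons c t)).
    { intro c. unfold del. apply (proj2_sig (constructive_indefinite_description _ (H c))). }
    destruct (gauge_plane M del) as (d & Hd & K); [apply Hdel|].
    exists d. split; [assumption|]. intros z Hz.
    assert (Hz1 : Cmod (z Fin.F1) <= M) by (eapply Rle_trans; [apply (vnorm_coord (S n) z)|exact Hz]).
    assert (Hz2 : vnorm n (fun j => z (Fin.FS j)) <= M) by (eapply Rle_trans; [apply Rmax_r|exact Hz]).
    destruct (K (z Fin.F1) Hz1) as (c & Hc & Hdc).
    destruct (proj2 (Hdel c) _ Hz2) as (t & Ht & Hdt).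
    exists (fcons c t). split; [|lra]. rewrite <- (fcons_eta z), vdist_fcons. apply Rmax_lub_lt; [lra|assumption].
Qed.

(** Off K the gauge is replaced by a radius at most the distance to K, positive because K is closed.
    A centre outside K then captures no point of K, so the centres found lie in K. *)
Lemma compact_gauge n (K : Cn n -> Prop) (rho : Cn n -> R) : is_compact K -> (forall z, 0 < rho z) ->
  exists d, 0 < d /\ forall z, K z -> exists t, K t /\ vdist z t < rho t /\ d <= rho t.
Proof.
  intros [Hc [M HM]] Hrho.
  assert (H : forall z, exists r, 0 < r /\ (K z -> r = rho z) /\ (~ K z -> forall w, K w -> r <= vdist w z)).
  { intro z. destruct (classic (K z)) as [Hz|Hz].
    - exists (rho z). split; [apply Hrho|tauto].
    - assert (Hr : exists r, 0 < r /\ forall w, K w -> r <= vdist w z).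
      { apply NNPP; intro Hno. apply Hz, Hc. intros r Hr. apply NNPP; intro Hno2.
        apply Hno. exists r. split; [assumption|]. intros w Hw. apply Rnot_lt_le; intro. apply Hno2. exists w; tauto. }
      destruct Hr as (r & Hr & Hr'). exists r. tauto. }
  set (rho' := fun z => proj1_sig (constructive_indefinite_description _ (H z))).
  assert (Hrho' : forall z, 0 < rho' z /\ (K z -> rho' z = rho z) /\ (~ K z -> forall w, K w -> rho' z <= vdist w z)).
  { intro z. unfold rho'. apply (proj2_sig (constructive_indefinite_description _ (H z))). }
  destruct (gauge_box n M rho') as (d & Hd & G); [apply Hrho'|].
  exists d. split; [assumption|]. intros z Hz. destruct (G z (HM z Hz)) as (t & Ht & Hdt).
  destruct (Hrho' t) as (_ & E & N). destruct (classic (K t)) as [Kt|Kt].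
  - exists t. rewrite <- E by assumption. tauto.
  - exfalso. specialize (N Kt z Hz). lra.
Qed.

(** The factor 2 leaves room for both a point within [rho z] of z and the small neighbourhood of
    that point. *)
Lemma continuity_radius n (K : Cn n -> Prop) (f : Cn n -> C) (eps : R) : Defs.continuous_on K f -> 0 < eps ->
  exists rho : Cn n -> R, forall z, 0 < rho z /\ (K z -> forall w, K w -> vdist w z < 2 * rho z -> Cmod (f w - f z) < eps).
Proof.
  intros Hf He.
  assert (H : forall z, exists r, 0 < r /\ (K z -> forall w, K w -> vdist w z < 2 * r -> Cmod (f w - f z) < eps)).
  { intro z. destruct (classic (K z)) as [Hz|Hz].
    - destruct (Hf z Hz eps He) as (d & Hd & G). exists (d / 2). split; [lra|]. intros _ w Hw Hwd. apply G; [assumption|lra].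
    - exists 1. split; [lra|tauto]. }
  exists (fun z => proj1_sig (constructive_indefinite_description _ (H z))). intro z.
  apply (proj2_sig (constructive_indefinite_description _ (H z))).
Qed.

Lemma compact_uniform_continuity n (K : Cn n -> Prop) (f : Cn n -> C) (eps : R) : is_compact K -> Defs.continuous_on K f -> 0 < eps ->
  exists d, 0 < d /\ forall z w, K z -> K w -> vdist w z < d -> Cmod (f w - f z) < eps.
Proof.
  intros HK Hf He. destruct (continuity_radius n K f (eps / 2) Hf ltac:(lra)) as (rho & Hrho).
  destruct (compact_gauge n K rho HK) as (d & Hd & G); [apply Hrho|].
  exists d. split; [assumption|]. intros z w Hz Hw Hd'. destruct (G z Hz) as (t & Ht & Hzt & Hdt).
  destruct (Hrho t) as [P Q].
  assert (A : Cmod (f z - f t) < eps / 2) by (apply Q; try assumption; lra).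
  assert (B : Cmod (f w - f t) < eps / 2).
  { apply Q; try assumption. generalize (vdist_triangle n w z t). lra. }
  generalize (Cmod_sub_triangle (f w) (f t) (f z)). rewrite (Cmod_sub_sym (f t) (f z)). lra.
Qed.

(* The gauge at t is shrunk to 1/(1+|f t|), so that a uniform lower bound for it bounds f. *)
Lemma compact_bounded n (K : Cn n -> Prop) (f : Cn n -> C) : is_compact K -> Defs.continuous_on K f ->
  exists M, 0 < M /\ forall z, K z -> Cmod (f z) <= M.
Proof.
  intros HK Hf. destruct (continuity_radius n K f 1 Hf ltac:(lra)) as (rho & Hrho).
  assert (Hp : forall t, 0 < / (1 + Cmod (f t))).
  { intro t. apply Rinv_0_lt_compat. generalize (Cmod_ge_0 (f t)). lra. }
  destruct (compact_gauge n K (fun t => Rmin (rho t) (/ (1 + Cmod (f t)))) HK) as (d & Hd & G).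
  { intro t. apply Rmin_glb_lt; [apply Hrho|apply Hp]. }
  exists (/ d + 1). split; [generalize (Rinv_0_lt_compat d Hd); lra|]. intros z Hz.
  destruct (G z Hz) as (t & Ht & Hzt & Hdt). destruct (Hrho t) as [P Q].
  generalize (Rmin_l (rho t) (/ (1 + Cmod (f t)))), (Rmin_r (rho t) (/ (1 + Cmod (f t)))). intros M1 M2.
  assert (A : Cmod (f z - f t) < 1) by (apply Q; try assumption; lra).
  assert (B : 1 + Cmod (f t) <= / d).
  { rewrite <- (Rinv_inv (1 + Cmod (f t))). apply Rinv_le_contravar; lra. }
  generalize (Cmod_le_sub (f z) (f t)). lra.
Qed.

(** * Holomorphic functions of several variables *)

Lemma Csum_bound n (a h : Fin.t n -> C) : exists A, 0 <= A /\ forall h : Fin.t n -> C,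
  Cmod (Csum n (fun i => Cmult (a i) (h i))) <= A * vnorm n h.
Proof.
  clear h. induction n as [|n IH]; simpl.
  - exists 0. split; [lra|]. intro h. change C0 with (RtoC 0). rewrite Cmod_0. lra.
  - destruct (IH (fun i => a (Fin.FS i))) as (A & HA & H). exists (Cmod (a Fin.F1) + A).
    split; [generalize (Cmod_ge_0 (a Fin.F1)); lra|]. intro h.
    eapply Rle_trans; [apply Cmod_triangle|]. specialize (H (fun i => h (Fin.FS i))).
    change (Cmod (Cadd ?x ?y)) with (Cmod (x + y)). rewrite Cmod_mult.
    generalize (Rmax_l (Cmod (h Fin.F1)) (vnorm n (fun i => h (Fin.FS i)))),
      (Rmax_r (Cmod (h Fin.F1)) (vnorm n (fun i => h (Fin.FS i)))). intros.
    change (Defs.Cmod (h Fin.F1)) with (Cmod (h Fin.F1)).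
    generalize (Cmod_ge_0 (a Fin.F1)). nra.
Qed.

Lemma Csum_plus n (f g : Fin.t n -> C) : Csum n (fun i => Cplus (f i) (g i)) = Cplus (Csum n f) (Csum n g).
Proof.
  induction n as [|n IH]; simpl; [cring|]. rewrite IH. cring.
Qed.

Lemma Csum_scal n (c : C) (f : Fin.t n -> C) : Csum n (fun i => Cmult c (f i)) = Cmult c (Csum n f).
Proof.
  induction n as [|n IH]; simpl; [cring|]. rewrite IH. cring.
Qed.

Lemma Csum_ext n (f g : Fin.t n -> C) : (forall i, f i = g i) -> Csum n f = Csum n g.
Proof. intros H. f_equal. apply functional_extensionality, H. Qed.

Definition lin {n} (a h : Fin.t n -> C) : C := Csum n (fun i => Cmult (a i) (h i)).

Lemma lin_comb n (a b h : Fin.t n -> C) (c d : C) :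
  lin (fun i => Cplus (Cmult c (a i)) (Cmult d (b i))) h = Cplus (Cmult c (lin a h)) (Cmult d (lin b h)).
Proof.
  unfold lin. rewrite <- !Csum_scal, <- Csum_plus. apply Csum_ext. intro; cring.
Qed.

Lemma Cdiff_plus n (f g : Cn n -> C) z : Cdiff f z -> Cdiff g z -> Cdiff (fun w => Cplus (f w) (g w)) z.
Proof.
  intros (a & Ha) (b & Hb). exists (fun i => Cplus (Cmult 1 (a i)) (Cmult 1 (b i))). intros eps He.
  destruct (Ha (eps / 2)) as (d1 & P1 & H1); [lra|]. destruct (Hb (eps / 2)) as (d2 & P2 & H2); [lra|].
  exists (Rmin d1 d2); split; [apply Rmin_glb_lt; assumption|]. intros h Hh.
  specialize (H1 h (Rlt_le_trans _ _ _ Hh (Rmin_l _ _))).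
  specialize (H2 h (Rlt_le_trans _ _ _ Hh (Rmin_r _ _))).
  change (Cmod (f (vadd z h) - f z - lin a h) <= eps / 2 * vnorm n h) in H1.
  change (Cmod (g (vadd z h) - g z - lin b h) <= eps / 2 * vnorm n h) in H2.
  change (Cmod ((f (vadd z h) + g (vadd z h)) - (f z + g z) - lin (fun i => Cplus (Cmult 1 (a i)) (Cmult 1 (b i))) h) <= eps * vnorm n h).
  rewrite lin_comb.
  replace (_ - _)%C with ((f (vadd z h) - f z - lin a h) + (g (vadd z h) - g z - lin b h))%C by cring.
  eapply Rle_trans; [apply Cmod_triangle|]. lra.
Qed.

Lemma Cdiff_mult n (f g : Cn n -> C) z : Cdiff f z -> Cdiff g z -> Cdiff (fun w => Cmult (f w) (g w)) z.
Proof.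
  intros (a & Ha) (b & Hb). exists (fun i => Cplus (Cmult (g z) (a i)) (Cmult (f z) (b i))). intros eps He.
  destruct (Csum_bound n a a) as (A & HA & HA'). destruct (Csum_bound n b b) as (B & HB & HB').
  set (M := Cmod (f z) + Cmod (g z) + A + B + 2).
  assert (HM : 2 <= M) by (unfold M; generalize (Cmod_ge_0 (f z)), (Cmod_ge_0 (g z)); lra).
  set (e := Rmin 1 (eps / (4 * M))). assert (He' : 0 < e) by (apply Rmin_glb_lt; [lra|apply Rdiv_lt_0_compat; lra]).
  assert (He1 : e <= 1) by apply Rmin_l. assert (He2 : 4 * M * e <= eps).
  { apply Rle_trans with (4 * M * (eps / (4 * M))); [apply Rmult_le_compat_l; [lra|apply Rmin_r]|]. right; field; lra. }
  destruct (Ha e He') as (d1 & P1 & H1). destruct (Hb e He') as (d2 & P2 & H2).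
  (* Below this radius the increment q of g is at most e, which turns the quadratic term p * q into
     a small multiple of the norm of h. *)
  set (e3 := e / M). assert (He3 : 0 < e3) by (apply Rdiv_lt_0_compat; lra).
  exists (Rmin e3 (Rmin d1 d2)); split; [repeat apply Rmin_glb_lt; assumption|]. intros h Hh.
  generalize (Rmin_l e3 (Rmin d1 d2)), (Rmin_r e3 (Rmin d1 d2)), (Rmin_l d1 d2), (Rmin_r d1 d2); intros.
  specialize (H1 h ltac:(lra)). specialize (H2 h ltac:(lra)).
  change (Cmod (f (vadd z h) - f z - lin a h) <= e * vnorm n h) in H1.
  change (Cmod (g (vadd z h) - g z - lin b h) <= e * vnorm n h) in H2.
  change (Cmod (f (vadd z h) * g (vadd z h) - f z * g z - lin (fun i => Cplus (Cmult (g z) (a i)) (Cmult (f z) (b i))) h) <= eps * vnorm n h).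
  rewrite lin_comb. specialize (HA' h). specialize (HB' h). fold (lin a h) in HA'. fold (lin b h) in HB'.
  set (p := (f (vadd z h) - f z)%C) in *. set (q := (g (vadd z h) - g z)%C) in *.
  replace (_ - _)%C with (g z * (p - lin a h) + (f z * (q - lin b h) + p * q))%C by (unfold p, q; cring).
  eapply Rle_trans; [apply Cmod_triangle|]. eapply Rle_trans; [apply Rplus_le_compat_l, Cmod_triangle|].
  rewrite !Cmod_mult. pose proof (vnorm_ge_0 n h) as Hv. set (v := vnorm n h) in *.
  assert (Bp : Cmod p <= (A + 1) * v).
  { generalize (Cmod_le_sub p (lin a h)). nra. }
  assert (Bq : Cmod q <= (B + 1) * v).
  { generalize (Cmod_le_sub q (lin b h)). nra. }
  assert (Hv3 : M * v <= e).
  { apply Rle_trans with (M * e3); [apply Rmult_le_compat_l; lra|]. right. unfold e3; field; lra. }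
  assert (Bpq : Cmod p * Cmod q <= (A + 1) * v * e).
  { apply Rmult_le_compat; try apply Cmod_ge_0; [assumption|]. eapply Rle_trans; [exact Bq|].
    generalize (Cmod_ge_0 (f z)), (Cmod_ge_0 (g z)). unfold M in *. nra. }
  generalize (Cmod_ge_0 (f z)), (Cmod_ge_0 (g z)). intros.
  assert (T1 : Cmod (g z) * Cmod (p - lin a h) <= M * e * v).
  { apply Rle_trans with (Cmod (g z) * (e * v)); [apply Rmult_le_compat_l; assumption|].
    assert (0 <= e * v) by nra. unfold M. nra. }
  assert (T2 : Cmod (f z) * Cmod (q - lin b h) <= M * e * v).
  { apply Rle_trans with (Cmod (f z) * (e * v)); [apply Rmult_le_compat_l; assumption|].
    assert (0 <= e * v) by nra. unfold M. nra. }
  assert (T3 : (A + 1) * v * e <= M * e * v).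
  { assert (0 <= e * v) by nra. unfold M. nra. }
  assert (P0 : 0 <= M * e * v) by (apply Rmult_le_pos; [apply Rmult_le_pos; lra|assumption]).
  assert (T4 : 4 * M * e * v <= eps * v) by (apply Rmult_le_compat_r; assumption). lra.
Qed.

Lemma fin_uniform n (P : Fin.t n -> R -> Prop) : (forall i d d', 0 < d' <= d -> P i d -> P i d') ->
  (forall i, exists d, 0 < d /\ P i d) -> exists d, 0 < d /\ forall i, P i d.
Proof.
  intros Hm H. induction n as [|n IH].
  - exists 1. split; [lra|]. intro i. apply (Fin.case0 (fun i => P i 1) i).
  - destruct (IH (fun i => P (Fin.FS i))) as (d & Hd & K); [intros i; apply Hm|intro i; apply H|].
    destruct (H Fin.F1) as (d' & Hd' & K'). exists (Rmin d d'). split; [apply Rmin_glb_lt; assumption|].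
    assert (P0 : 0 < Rmin d d') by (apply Rmin_glb_lt; assumption).
    intro i. apply (Fin.caseS' i).
    + apply (Hm _ d'); [split; [assumption|apply Rmin_r]|assumption].
    + intro j. apply (Hm _ d); [split; [assumption|apply Rmin_l]|apply K].
Qed.

Lemma Cdiff_chain n (g : Cn n -> C) (phi : C -> Cn n) (t : C) :
  Cdiff g (phi t) -> (forall i, Cdiff1 (fun s => phi s i) t) -> Cdiff1 (fun s => g (phi s)) t.
Proof.
  intros (a & Ha) Hphi.
  assert (HL : exists L : Cn n, forall i eps, 0 < eps -> exists delta, 0 < delta /\ forall h : C, Cmod h < delta ->
     Cmod (phi (t + h)%C i - phi t i - L i * h) <= eps * Cmod h).
  { exists (fun i => proj1_sig (constructive_indefinite_description _ (Hphi i))). intro i.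
    apply (proj2_sig (constructive_indefinite_description _ (Hphi i))). }
  destruct HL as (L & HL). exists (lin a L). intros eps He.
  destruct (Csum_bound n a a) as (A & HA & HA').
  set (B := vnorm n L). assert (HB : 0 <= B) by apply vnorm_ge_0.
  set (M := A + B + 2). assert (HM : 2 <= M) by (unfold M; lra).
  set (e := Rmin 1 (eps / (2 * M))). assert (He' : 0 < e) by (apply Rmin_glb_lt; [lra|apply Rdiv_lt_0_compat; lra]).
  assert (He1 : e <= 1) by apply Rmin_l. assert (He2 : 2 * M * e <= eps).
  { apply Rle_trans with (2 * M * (eps / (2 * M))); [apply Rmult_le_compat_l; [lra|apply Rmin_r]|]. right; field; lra. }
  destruct (Ha e He') as (d1 & Hd1 & K1).
  destruct (fin_uniform n (fun i d => forall h : C, Cmod h < d -> Cmod (phi (t + h)%C i - phi t i - L i * h) <= e * Cmod h))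
    as (d2 & Hd2 & K2).
  { intros i d d' Hd H h Hh. apply H. lra. }
  { intro i. apply HL, He'. }
  exists (Rmin d2 (d1 / (2 * M))). split; [apply Rmin_glb_lt; [assumption|apply Rdiv_lt_0_compat; lra]|].
  intros h Hh. change (Cmod h < Rmin d2 (d1 / (2 * M))) in Hh.
  generalize (Rmin_l d2 (d1 / (2 * M))), (Rmin_r d2 (d1 / (2 * M))); intros.
  assert (Hh2 : Cmod h * (2 * M) < d1).
  { rewrite Rmult_comm. apply Rlt_div_mult; [lra|]. eapply Rlt_le_trans; [exact Hh|apply Rmin_r]. }
  set (k := (fun i => Cminus (phi (t + h)%C i) (phi t i)) : Cn n).
  (* [r] is the nonlinear part of the increment [k] of phi; the candidate derivative satisfies lin a
     L * h = lin a k - lin a r. *)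
  set (r := (fun i => Cminus (k i) (Cmult (L i) h)) : Cn n).
  pose proof (Cmod_ge_0 h) as Hh0.
  assert (Hr : vnorm n r <= e * Cmod h).
  { apply vnorm_le; [nra|]. intro i. apply K2. lra. }
  assert (Hk : vnorm n k <= (B + 1) * Cmod h).
  { apply vnorm_le; [nra|]. intro i. generalize (vnorm_coord n r i), (vnorm_coord n L i). intros R1 R2.
    fold B in R2. change (Cmod (k i - L i * h) <= vnorm n r) in R1.
    generalize (Cmod_le_sub (k i) (L i * h)%C). rewrite Cmod_mult.
    change (Cmod (L i) <= B) in R2.
    assert (Cmod (L i) * Cmod h <= B * Cmod h) by (apply Rmult_le_compat_r; assumption).
    assert (e * Cmod h <= 1 * Cmod h) by (apply Rmult_le_compat_r; assumption). lra. }
  assert (Ek : vadd (phi t) k = phi (t + h)%C).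
  { apply functional_extensionality; intro i. unfold vadd, k. cring. }
  specialize (K1 k). rewrite Ek in K1.
  change (vnorm n k < d1 -> Cmod (g (phi (t + h)%C) - g (phi t) - lin a k) <= e * vnorm n k) in K1.
  assert (Hkd : vnorm n k < d1).
  { eapply Rle_lt_trans; [exact Hk|]. unfold M in *. nra. }
  specialize (K1 Hkd).
  change (Cmod (g (phi (t + h)%C) - g (phi t) - lin a L * h) <= eps * Cmod h).
  assert (El : (lin a L * h)%C = (lin a k - lin a r)%C).
  { unfold lin. rewrite Cmult_comm, <- Csum_scal.
    replace (Csum n (fun i => Cmult (a i) (k i))) with
      (Cplus (Csum n (fun i => Cmult h (Cmult (a i) (L i)))) (Csum n (fun i => Cmult (a i) (r i)))).
    - cring.
    - rewrite <- Csum_plus. apply Csum_ext. intro i. unfold r. cring. }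
  rewrite El.
  replace (_ - _)%C with ((g (phi (t + h)%C) - g (phi t) - lin a k) + lin a r)%C by cring.
  eapply Rle_trans; [apply Cmod_triangle|].
  specialize (HA' r). fold (lin a r) in HA'.
  assert (T1 : e * vnorm n k <= e * ((B + 1) * Cmod h)) by (apply Rmult_le_compat_l; lra).
  assert (T2 : A * vnorm n r <= A * (e * Cmod h)) by (apply Rmult_le_compat_l; lra).
  assert (T3 : 0 <= e * Cmod h) by nra. unfold M in He2.
  assert (T4 : (A + B + 1) * (e * Cmod h) <= eps * Cmod h).
  { apply Rle_trans with (2 * (A + B + 2) * e * Cmod h); [nra|]. apply Rmult_le_compat_r; assumption. }
  lra.
Qed.

Lemma Cdiff_first m (g : Cn 1 -> C) (z : Cn (S m)) : Cdiff g (fun _ => z Fin.F1) -> Cdiff (fun w : Cn (S m) => g (fun _ => w Fin.F1)) z.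
Proof.
  intros (a & Ha). exists (fcons (a Fin.F1) (fun _ => RtoC 0)). intros eps He.
  destruct (Ha eps He) as (d & Hd & K). exists d. split; [assumption|]. intros h Hh.
  assert (Hv : vnorm 1 (fun _ => h Fin.F1) <= vnorm (S m) h).
  { apply vnorm_le; [apply vnorm_ge_0|]. intro; apply vnorm_coord. }
  specialize (K (fun _ => h Fin.F1) ltac:(lra)).
  assert (E : Csum (S m) (fun i => Cmul (fcons (a Fin.F1) (fun _ => RtoC 0) i) (h i)) =
    Csum 1 (fun i => Cmul (a i) (h Fin.F1))).
  { change (Cadd (Cmul (a Fin.F1) (h Fin.F1)) (Csum m (fun i => Cmult (RtoC 0) (h (Fin.FS i)))) = Cadd (Cmul (a Fin.F1) (h Fin.F1)) C0).
    rewrite (Csum_scal m (RtoC 0) (fun i => h (Fin.FS i))). cring. }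
  rewrite E. eapply Rle_trans; [exact K|]. apply Rmult_le_compat_l; lra.
Qed.

Lemma Cdiff_rest m (g : Cn m -> C) (z : Cn (S m)) : Cdiff g (fun j => z (Fin.FS j)) -> Cdiff (fun w : Cn (S m) => g (fun j => w (Fin.FS j))) z.
Proof.
  intros (a & Ha). exists (fcons (RtoC 0) a). intros eps He.
  destruct (Ha eps He) as (d & Hd & K). exists d. split; [assumption|]. intros h Hh.
  assert (Hv : vnorm m (fun j => h (Fin.FS j)) <= vnorm (S m) h).
  { apply vnorm_le; [apply vnorm_ge_0|]. intro; apply (vnorm_coord (S m) h). }
  specialize (K (fun j => h (Fin.FS j)) ltac:(lra)).
  assert (E : Csum (S m) (fun i => Cmul (fcons (RtoC 0) a i) (h i)) = Csum m (fun i => Cmul (a i) (h (Fin.FS i)))).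
  { change (Cadd (Cmul (RtoC 0) (h Fin.F1)) (Csum m (fun i => Cmul (a i) (h (Fin.FS i)))) = Csum m (fun i => Cmul (a i) (h (Fin.FS i)))).
    cring. }
  rewrite E. eapply Rle_trans; [exact K|]. apply Rmult_le_compat_l; lra.
Qed.

(** * The algebras on compact sets *)

Lemma openC_disc c r : openC (Defs.disc c r).
Proof.
  intros z Hz. change (Cmod (z - c) < r) in Hz. exists (r - Cmod (z - c)). split; [lra|]. intros w Hw.
  change (Cmod (w - c) < r). generalize (Cmod_sub_triangle w z c). lra.
Qed.

Lemma continuous_on_plus n (K : Cn n -> Prop) f g : Defs.continuous_on K f -> Defs.continuous_on K g ->
  Defs.continuous_on K (fun z => Cplus (f z) (g z)).
Proof.
  intros Hf Hg z Hz eps He. destruct (Hf z Hz (eps / 2)) as (d1 & P1 & H1); [lra|].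
  destruct (Hg z Hz (eps / 2)) as (d2 & P2 & H2); [lra|].
  exists (Rmin d1 d2); split; [apply Rmin_glb_lt; assumption|]. intros w Hw Hd.
  specialize (H1 w Hw (Rlt_le_trans _ _ _ Hd (Rmin_l _ _))). specialize (H2 w Hw (Rlt_le_trans _ _ _ Hd (Rmin_r _ _))).
  change (Cmod (f w - f z) < eps / 2) in H1. change (Cmod (g w - g z) < eps / 2) in H2.
  change (Cmod ((f w + g w) - (f z + g z)) < eps).
  replace (_ - _)%C with ((f w - f z) + (g w - g z))%C by cring.
  eapply Rle_lt_trans; [apply Cmod_triangle|]. lra.
Qed.

Lemma continuous_on_const n (K : Cn n -> Prop) (c : C) : Defs.continuous_on K (fun _ => c).
Proof.
  intros z _ eps He. exists 1. split; [lra|]. intros w _ _. change (Cmod (c - c) < eps).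
  rewrite Cmod_subself; assumption.
Qed.

Lemma continuous_on_mult n (K : Cn n -> Prop) f g : Defs.continuous_on K f -> Defs.continuous_on K g ->
  Defs.continuous_on K (fun z => Cmult (f z) (g z)).
Proof.
  intros Hf Hg z Hz eps He. set (M := Cmod (f z) + Cmod (g z) + 2).
  pose proof (Cmod_ge_0 (f z)) as F0. pose proof (Cmod_ge_0 (g z)) as G0.
  assert (HM : 2 <= M) by (unfold M; lra).
  set (e := Rmin 1 (eps / (2 * M))). assert (He' : 0 < e) by (apply Rmin_glb_lt; [lra|apply Rdiv_lt_0_compat; lra]).
  assert (He1 : e <= 1) by apply Rmin_l. assert (He2 : 2 * M * e <= eps).
  { apply Rle_trans with (2 * M * (eps / (2 * M))); [apply Rmult_le_compat_l; [lra|apply Rmin_r]|]. right; field; lra. }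
  destruct (Hf z Hz e He') as (d1 & P1 & H1). destruct (Hg z Hz e He') as (d2 & P2 & H2).
  exists (Rmin d1 d2); split; [apply Rmin_glb_lt; assumption|]. intros w Hw Hd.
  specialize (H1 w Hw (Rlt_le_trans _ _ _ Hd (Rmin_l _ _))). specialize (H2 w Hw (Rlt_le_trans _ _ _ Hd (Rmin_r _ _))).
  change (Cmod (f w - f z) < e) in H1. change (Cmod (g w - g z) < e) in H2.
  change (Cmod (f w * g w - f z * g z) < eps).
  replace (_ - _)%C with ((f w - f z) * (g w - g z) + ((f w - f z) * g z + f z * (g w - g z)))%C by cring.
  eapply Rle_lt_trans; [apply Cmod_triangle|]. eapply Rle_lt_trans; [apply Rplus_le_compat_l, Cmod_triangle|].
  rewrite !Cmod_mult. generalize (Cmod_ge_0 (f w - f z)), (Cmod_ge_0 (g w - g z)). unfold M in *. nra.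
Qed.

Lemma continuous_on_limit n (K : Cn n -> Prop) f :
  (forall eps, 0 < eps -> exists g, Defs.continuous_on K g /\ forall z, K z -> Cmod (f z - g z) <= eps) -> Defs.continuous_on K f.
Proof.
  intros H z Hz eps He. destruct (H (eps / 4)) as (g & Hg & G); [lra|].
  destruct (Hg z Hz (eps / 4)) as (d & Hd & D); [lra|]. exists d; split; [assumption|]. intros w Hw Hwd.
  specialize (D w Hw Hwd). change (Cmod (g w - g z) < eps / 4) in D. change (Cmod (f w - f z) < eps).
  pose proof (G w Hw) as G1. pose proof (G z Hz) as G2.
  generalize (Cmod_sub_triangle (f w) (g w) (f z)), (Cmod_sub_triangle (g w) (g z) (f z)).
  rewrite (Cmod_sub_sym (g z) (f z)). lra.
Qed.

Lemma in_AD_limit n (K : Cn n -> Prop) f :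
  (forall eps, 0 < eps -> exists g, in_AD K g /\ forall z, K z -> Cmod (f z - g z) <= eps) -> in_AD K f.
Proof.
  intros H. split.
  - apply continuous_on_limit. intros eps He. destruct (H eps He) as (g & Hg & G). exists g. split; [apply Hg|exact G].
  - intros c r phi Hr Hphi Hinj HK. refine (holo_limit (fun t => f (phi t)) (Defs.disc c r) _ _); [apply openC_disc|].
    intros eps He. destruct (H eps He) as (g & Hg & G). exists (fun t => g (phi t)). split.
    + apply Hg; assumption.
    + intros t Ht. apply G, HK, Ht.
Qed.

Lemma in_AD_plus n (K : Cn n -> Prop) f g : in_AD K f -> in_AD K g -> in_AD K (fun z => Cplus (f z) (g z)).
Proof.
  intros [Hf Hf'] [Hg Hg']. split; [apply continuous_on_plus; assumption|].
  intros c r phi Hr Hphi Hinj HK t Ht. apply holo_dbar.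
  eapply dbar_eq; [|apply dbar_plus; apply holo_dbar; [apply (Hf' c r phi)|apply (Hg' c r phi)]; assumption]. cring.
Qed.

Lemma in_AD_scal n (K : Cn n -> Prop) (c : C) f : in_AD K f -> in_AD K (fun z => Cmult c (f z)).
Proof.
  intros [Hf Hf']. split; [apply (continuous_on_mult n K (fun _ => c)); [apply continuous_on_const|assumption]|].
  intros c' r phi Hr Hphi Hinj HK t Ht. apply Cdiff1_scal. apply (Hf' c' r phi); assumption.
Qed.

Lemma in_AD_const n (K : Cn n -> Prop) (c : C) : in_AD K (fun _ => c).
Proof.
  split; [apply continuous_on_const|]. intros c' r phi _ _ _ _ t _. apply holo_dbar, dbar_const.
Qed.

(** Functions are total, with arbitrary values off K. That only the values on K count follows from
    closedness under uniform limits on K, with f as the approximant at every precision. *)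
Lemma in_AD_ext n (K : Cn n -> Prop) f g : (forall z, K z -> f z = g z) -> in_AD K f -> in_AD K g.
Proof.
  intros E H. apply in_AD_limit. intros eps He. exists f. split; [assumption|]. intros z Hz.
  rewrite E by assumption. rewrite Cmod_subself. lra.
Qed.

Lemma in_Obar_in_AD n (K : Cn n -> Prop) f : in_Obar K f -> in_AD K f.
Proof.
  intros [Hc H]. split; [assumption|]. intros c r phi Hr Hphi Hinj HK.
  refine (holo_limit (fun t => f (phi t)) (Defs.disc c r) _ _); [apply openC_disc|]. intros eps He.
  destruct (H eps He) as (U & g & HU & HKU & Hg & G). exists (fun t => g (phi t)). split.
  - intros t Ht. apply Cdiff_chain; [apply Hg, HKU, HK, Ht|]. intro i. apply Hphi, Ht.
  - intros t Ht. apply G, HK, Ht.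
Qed.

Lemma in_Obar_plus n (K : Cn n -> Prop) f g : in_Obar K f -> in_Obar K g -> in_Obar K (fun z => Cplus (f z) (g z)).
Proof.
  intros [Hf Hf'] [Hg Hg']. split; [apply continuous_on_plus; assumption|]. intros eps He.
  destruct (Hf' (eps / 2)) as (U & F & HU & KU & HF & EF); [lra|].
  destruct (Hg' (eps / 2)) as (V & G & HV & KV & HG & EG); [lra|].
  exists (fun z => U z /\ V z), (fun z => Cplus (F z) (G z)). repeat split.
  - intros z [Hz1 Hz2]. destruct (HU z Hz1) as (r & Hr & R1). destruct (HV z Hz2) as (r' & Hr' & R2).
    exists (Rmin r r'). split; [apply Rmin_glb_lt; assumption|]. intros w Hw. split.
    + apply R1. eapply Rlt_le_trans; [exact Hw|apply Rmin_l].
    + apply R2. eapply Rlt_le_trans; [exact Hw|apply Rmin_r].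
  - apply KU, H.
  - apply KV, H.
  - intros z [Hz1 Hz2]. apply Cdiff_plus; [apply HF|apply HG]; assumption.
  - intros z Hz. specialize (EF z Hz). specialize (EG z Hz).
    change (Cmod (f z - F z) <= eps / 2) in EF. change (Cmod (g z - G z) <= eps / 2) in EG.
    change (Cmod ((f z + g z) - (F z + G z)) <= eps).
    replace (_ - _)%C with ((f z - F z) + (g z - G z))%C by cring.
    eapply Rle_trans; [apply Cmod_triangle|]. lra.
Qed.

Lemma in_Obar_limit n (K : Cn n -> Prop) f :
  (forall eps, 0 < eps -> exists g, in_Obar K g /\ forall z, K z -> Cmod (f z - g z) <= eps) -> in_Obar K f.
Proof.
  intros H. split.
  - apply continuous_on_limit. intros eps He. destruct (H eps He) as (g & Hg & G). exists g. split; [apply Hg|exact G].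
  - intros eps He. destruct (H (eps / 2)) as (g & [_ Hg] & G); [lra|].
    destruct (Hg (eps / 2)) as (U & F & HU & KU & HF & EF); [lra|]. exists U, F. repeat split; try assumption.
    intros z Hz. specialize (EF z Hz). specialize (G z Hz).
    change (Cmod (g z - F z) <= eps / 2) in EF. change (Cmod (f z - F z) <= eps).
    generalize (Cmod_sub_triangle (f z) (g z) (F z)). lra.
Qed.

Lemma in_Obar_const n (K : Cn n -> Prop) (c : C) : in_Obar K (fun _ => c).
Proof.
  split; [apply continuous_on_const|]. intros eps He. exists (fun _ => True), (fun _ => c). repeat split.
  - intros z _. exists 1. split; [lra|tauto].
  - intros z _. exists (fun _ => RtoC 0). intros e He'. exists 1. split; [lra|]. intros h _.
    change (Cmod (c - c - Csum n (fun i => Cmult (RtoC 0) (h i))) <= e * vnorm n h).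
    rewrite (Csum_scal n (RtoC 0) h). replace (_ - _)%C with (RtoC 0) by cring. rewrite Cmod_0.
    generalize (vnorm_ge_0 n h). nra.
  - intros z _. change (Cmod (c - c) <= eps). rewrite Cmod_subself. lra.
Qed.

Lemma in_Obar_tensor m (K1 : Cn 1 -> Prop) (K2 : Cn m -> Prop) a b : is_compact K1 -> is_compact K2 ->
  in_Obar K1 a -> in_Obar K2 b ->
  in_Obar (prodK K1 K2) (fun z => Cmult (a (fun _ => z Fin.F1)) (b (fun j => z (Fin.FS j)))).
Proof.
  intros HK1 HK2 [Ha Ha'] [Hb Hb'].
  assert (D1 : forall z w : Cn (S m), vdist (fun _ : Fin.t 1 => w Fin.F1) (fun _ => z Fin.F1) <= vdist w z).
  { intros z w. apply vnorm_le; [apply vdist_ge_0|]. intro. apply (vnorm_coord (S m) (fun i => Csub (w i) (z i))). }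
  assert (D2 : forall z w : Cn (S m), vdist (fun j => w (Fin.FS j)) (fun j => z (Fin.FS j)) <= vdist w z).
  { intros z w. apply vnorm_le; [apply vdist_ge_0|]. intro. apply (vnorm_coord (S m) (fun i => Csub (w i) (z i))). }
  split.
  - apply continuous_on_mult.
    + intros z [Hz _] eps He. destruct (Ha _ Hz eps He) as (d & Hd & D). exists d. split; [assumption|].
      intros w [Hw _] Hwd. apply D; [assumption|]. specialize (D1 z w). lra.
    + intros z [_ Hz] eps He. destruct (Hb _ Hz eps He) as (d & Hd & D). exists d. split; [assumption|].
      intros w [_ Hw] Hwd. apply D; [assumption|]. specialize (D2 z w). lra.
  - intros eps He. destruct (compact_bounded 1 K1 a HK1 Ha) as (A & HA & BA).
    destruct (compact_bounded m K2 b HK2 Hb) as (B & HB & BB).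
    (* Factors approximated within e <= 1 give a product within A e + B e + e^2 <= M e. *)
    set (M := A + B + 1). set (e := Rmin 1 (eps / M)).
    assert (HM : 1 < M) by (unfold M; lra).
    assert (He' : 0 < e) by (apply Rmin_glb_lt; [lra|apply Rdiv_lt_0_compat; lra]).
    assert (He1 : e <= 1) by apply Rmin_l. assert (He2 : M * e <= eps).
    { apply Rle_trans with (M * (eps / M)); [apply Rmult_le_compat_l; [lra|apply Rmin_r]|]. right; field; lra. }
    destruct (Ha' e He') as (U & F & HU & KU & HF & EF). destruct (Hb' e He') as (V & G & HV & KV & HG & EG).
    exists (fun z : Cn (S m) => U (fun _ => z Fin.F1) /\ V (fun j => z (Fin.FS j))),
      (fun z => Cmult (F (fun _ => z Fin.F1)) (G (fun j => z (Fin.FS j)))). repeat split.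
    + intros z [Hz1 Hz2]. destruct (HU _ Hz1) as (r & Hr & R1). destruct (HV _ Hz2) as (r' & Hr' & R2).
      exists (Rmin r r'). split; [apply Rmin_glb_lt; assumption|]. intros w Hw. split.
      * apply R1. eapply Rle_lt_trans; [apply D1|]. eapply Rlt_le_trans; [exact Hw|apply Rmin_l].
      * apply R2. eapply Rle_lt_trans; [apply D2|]. eapply Rlt_le_trans; [exact Hw|apply Rmin_r].
    + apply KU. apply H.
    + apply KV. apply H.
    + intros z [Hz1 Hz2]. apply Cdiff_mult.
      * apply (Cdiff_first m F), HF, Hz1.
      * apply (Cdiff_rest m G), HG, Hz2.
    + intros z [Hz1 Hz2]. specialize (EF _ Hz1). specialize (EG _ Hz2). specialize (BA _ Hz1). specialize (BB _ Hz2).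
      set (x := a _) in *. set (y := b _) in *. set (p := F _) in *. set (q := G _) in *.
      change (Cmod (x - p) <= e) in EF. change (Cmod (y - q) <= e) in EG.
      change (Cmod (x * y - p * q) <= eps).
      replace (x * y - p * q)%C with (x * (y - q) + (y * (x - p) + - ((x - p) * (y - q))))%C by cring.
      eapply Rle_trans; [apply Cmod_triangle|]. eapply Rle_trans; [apply Rplus_le_compat_l, Cmod_triangle|].
      rewrite Cmod_opp, !Cmod_mult. generalize (Cmod_ge_0 x), (Cmod_ge_0 y), (Cmod_ge_0 (x - p)), (Cmod_ge_0 (y - q)).
      unfold M in He2. nra.
Qed.

(** * Extension and integration of families in A_D *)

Definition closedC (S : C -> Prop) : Prop :=
  forall z, (forall r, 0 < r -> exists s, S s /\ Cmod (s - z) < r) -> S z.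

Lemma closedC_away S z : closedC S -> ~ S z -> exists r, 0 < r /\ forall s, S s -> r <= Cmod (z - s).
Proof.
  intros Hc Hz. apply NNPP; intro Hno. apply Hz, Hc. intros r Hr. apply NNPP; intro Hno2.
  apply Hno. exists r. split; [assumption|]. intros s Hs. apply Rnot_lt_le; intro.
  apply Hno2. exists s. rewrite Cmod_sub_sym. tauto.
Qed.

Lemma distance_exists (S : C -> Prop) (s0 : C) : S s0 -> exists d : C -> R, forall z,
  0 <= d z /\ (forall s, S s -> d z <= Cmod (z - s)) /\ (forall e, 0 < e -> exists s, S s /\ Cmod (z - s) < d z + e).
Proof.
  intros Hs0.
  assert (H : forall z, exists d, 0 <= d /\ (forall s, S s -> d <= Cmod (z - s)) /\
     (forall e, 0 < e -> exists s, S s /\ Cmod (z - s) < d + e)).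
  { intro z. destruct (completeness (fun x => exists s, S s /\ x = - Cmod (z - s))) as [D [HD1 HD2]].
    - exists 0. intros x (s & _ & ->). generalize (Cmod_ge_0 (z - s)). lra.
    - exists (- Cmod (z - s0)), s0. tauto.
    - exists (- D). split; [|split].
      + assert (D <= 0); [|lra]. apply HD2. intros x (s & _ & ->). generalize (Cmod_ge_0 (z - s)). lra.
      + intros s Hs. assert (- Cmod (z - s) <= D); [|lra]. apply HD1. exists s; tauto.
      + intros e He. apply NNPP; intro Hno. assert (D <= D - e); [|lra]. apply HD2. intros x (s & Hs & ->).
        apply Rnot_lt_le; intro. apply Hno. exists s. split; [assumption|lra]. }
  exists (fun z => proj1_sig (constructive_indefinite_description _ (H z))). intro z.
  apply (proj2_sig (constructive_indefinite_description _ (H z))).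
Qed.

Lemma dense_sequence (S : C -> Prop) (s0 : C) : S s0 -> exists s : nat -> C, (forall k, S (s k)) /\
  forall z e, S z -> 0 < e -> exists k, Cmod (s k - z) < e.
Proof.
  intros Hs0.
  set (q := fun i j n => ((INR i / (INR n + 1) - INR n)%R, (INR j / (INR n + 1) - INR n)%R) : C).
  (* Near each of countably many grid points a point of S is chosen whenever one exists, and [s0]
     otherwise. A point of S is within 2 / (n + 1) of some grid point once n is large, so the radius
     3 / (n + 1) catches it. *)
  assert (H : forall k, exists s, S s /\ (let '(ij, n) := Cantor.of_nat k in let '(i, j) := Cantor.of_nat ij in
     (exists t, S t /\ Cmod (t - q i j n) < 3 / (INR n + 1)) -> Cmod (s - q i j n) < 3 / (INR n + 1))).
  { intro k. destruct (Cantor.of_nat k) as [ij n]. destruct (Cantor.of_nat ij) as [i j].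
    destruct (classic (exists t, S t /\ Cmod (t - q i j n) < 3 / (INR n + 1))) as [(t & Ht & Ht2)|Hn].
    - exists t. tauto.
    - exists s0. tauto. }
  exists (fun k => proj1_sig (constructive_indefinite_description _ (H k))).
  assert (HH := fun k => proj2_sig (constructive_indefinite_description _ (H k))). cbv beta in HH.
  set (s := fun k => proj1_sig (constructive_indefinite_description _ (H k))) in *.
  split; [intro k; apply (HH k)|]. intros z e Hz He.
  destruct (nfloor_ex (Rabs (fst z) + Rabs (snd z) + 6 / e)) as [n0 Hn0].
  { generalize (Rabs_pos (fst z)), (Rabs_pos (snd z)), (Rdiv_lt_0_compat 6 e ltac:(lra) He). lra. }
  set (n := Datatypes.S n0).
  assert (Hn : Rabs (fst z) + Rabs (snd z) + 6 / e < INR n) by (unfold n; rewrite S_INR; lra).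
  assert (Hn1 : 0 < INR n + 1) by (generalize (pos_INR n); lra).
  assert (Hg : forall x, Rabs x <= INR n -> exists i, Rabs (x - (INR i / (INR n + 1) - INR n)) <= / (INR n + 1)).
  { intros x Hx. apply Rabs_le_between in Hx. destruct (nfloor_ex ((x + INR n) * (INR n + 1))) as [i Hi].
    - apply Rmult_le_pos; lra.
    - exists i. replace (x - (INR i / (INR n + 1) - INR n)) with (((x + INR n) * (INR n + 1) - INR i) * / (INR n + 1)) by (field; lra).
      rewrite Rabs_mult, (Rabs_right (/ _)) by (left; apply Rinv_0_lt_compat, Hn1).
      rewrite <- (Rmult_1_l (/ (INR n + 1))) at 2. apply Rmult_le_compat_r; [left; apply Rinv_0_lt_compat, Hn1|].
      apply Rabs_le. lra. }
  assert (H6 : 0 < 6 / e) by (apply Rdiv_lt_0_compat; lra).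
  destruct (Hg (fst z)) as [i Hi]; [generalize (Rabs_pos (snd z)); lra|].
  destruct (Hg (snd z)) as [j Hj]; [generalize (Rabs_pos (fst z)); lra|].
  assert (Hzq : Cmod (z - q i j n) < 3 / (INR n + 1)).
  { eapply Rle_lt_trans; [apply Cmod_le_max with (r := / (INR n + 1)); assumption|].
    unfold Rdiv. generalize (Rinv_0_lt_compat _ Hn1). lra. }
  set (k := Cantor.to_nat (Cantor.to_nat (i, j), n)). exists k.
  destruct (HH k) as [_ Hk]. unfold k in Hk at 1. rewrite Cantor.cancel_of_to, Cantor.cancel_of_to in Hk.
  specialize (Hk (ex_intro _ z (conj Hz Hzq))). change (Cmod (s k - q i j n) < 3 / (INR n + 1)) in Hk.
  change (Cmod (s k - z) < e).
  generalize (Cmod_sub_triangle (s k) (q i j n) z). rewrite (Cmod_sub_sym (q i j n) z).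
  assert (He6 : 6 / (INR n + 1) < e).
  { apply Rmult_lt_reg_r with (INR n + 1); [assumption|]. unfold Rdiv. rewrite Rmult_assoc, Rinv_l, Rmult_1_r by lra.
    assert (E6 : 6 = e * (6 / e)) by (field; lra). rewrite E6. apply Rmult_lt_compat_l; [assumption|].
    generalize (Rabs_pos (fst z)), (Rabs_pos (snd z)). lra. }
  replace (6 / (INR n + 1)) with (3 / (INR n + 1) + 3 / (INR n + 1)) in He6 by (field; lra). lra.
Qed.

Fixpoint csum (n : nat) (a : nat -> C) : C := match n with O => RtoC 0 | S k => (csum k a + a k)%C end.

Lemma csum_scal n c a : csum n (fun k => c * a k)%C = (c * csum n a)%C.
Proof. induction n as [|n IH]; simpl; [cring|]. rewrite IH. cring. Qed.

Lemma csum_ext n a b : (forall k, (k < n)%nat -> a k = b k) -> csum n a = csum n b.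
Proof.
  induction n as [|n IH]; intros H; simpl; [reflexivity|]. rewrite IH, H; [reflexivity|lia|]. intros; apply H; lia.
Qed.

Lemma clim_le p l B : clim p l -> (forall n, Cmod (p n) <= B) -> Cmod l <= B.
Proof.
  intros H HB. apply Rnot_lt_le; intro Hlt. destruct (H ((Cmod l - B) / 2)) as [N HN]; [lra|].
  specialize (HN N (le_n _)). specialize (HB N). generalize (Cmod_le_sub l (p N)). rewrite Cmod_sub_sym. lra.
Qed.

Lemma clim_le_fst p q l l' e : 0 <= e -> clim p l -> clim q l' -> (forall n, Cmod (p n) <= e * fst (q n)) -> Cmod l <= e * fst l'.
Proof.
  intros He H H' HB. apply Rnot_lt_le; intro Hlt. set (x := (Cmod l - e * fst l') / (2 * (e + 1))).
  assert (Hx : 0 < x) by (apply Rdiv_lt_0_compat; lra).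
  assert (Ex : Cmod l - e * fst l' = x * (2 * (e + 1))) by (unfold x; field; lra).
  destruct (H x Hx) as [N HN]. destruct (H' x Hx) as [N' HN'].
  specialize (HN _ (Nat.le_max_l N N')). specialize (HN' _ (Nat.le_max_r N N')). set (n := max N N') in *.
  specialize (HB n). generalize (Cmod_le_sub l (p n)), (Cmod_fst (q n - l')). rewrite Cmod_sub_sym. simpl. intros A B.
  assert (B2 : fst (q n) - fst l' <= x) by (generalize (Rle_abs (fst (q n) + - fst l')); lra).
  assert (e * (fst (q n) - fst l') <= e * x) by (apply Rmult_le_compat_l; lra). nra.
Qed.

(** Continuity of z -> G z as a map into the functions on K2 with the supremum norm. *)
Definition equicont {m} (K2 : Cn m -> Prop) (G : C -> Cn m -> C) : Prop :=
  forall z eps, 0 < eps -> exists delta, 0 < delta /\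
    forall z', Cmod (z' - z) < delta -> forall w, K2 w -> Cmod (G z' w - G z w) < eps.

(* Dugundji's extension, with weights 2^-k (2 d(z) - |z - s_k|)^+ along a dense sequence s of S; being linear in F, it stays in A_D. *)
Lemma dugundji_extension m (K2 : Cn m -> Prop) (S : C -> Prop) (s0 : C) (F : C -> Cn m -> C) (M : R) :
  closedC S -> S s0 -> 0 < M ->
  (forall z w, S z -> K2 w -> Cmod (F z w) <= M) ->
  (forall z eps, S z -> 0 < eps -> exists delta, 0 < delta /\
     forall z', S z' -> Cmod (z' - z) < delta -> forall w, K2 w -> Cmod (F z' w - F z w) < eps) ->
  (forall z, S z -> in_AD K2 (F z)) ->
  exists E : C -> Cn m -> C, (forall z w, S z -> E z w = F z w) /\ (forall z, in_AD K2 (E z)) /\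
    (forall z w, K2 w -> Cmod (E z w) <= M) /\ equicont K2 E.
Proof.
  intros HS Hs0 HM HFM HFe HFA.
  destruct (distance_exists S s0 Hs0) as [d Hd]. destruct (dense_sequence S s0 Hs0) as (s & Hs & Hdense).
  assert (Hlip : forall z z', d z <= d z' + Cmod (z - z')).
  { intros z z'. apply Rnot_lt_le; intro Hlt. destruct (Hd z') as (_ & _ & G).
    destruct (G (d z - Cmod (z - z') - d z')) as (t & Ht & Ht2); [lra|].
    destruct (Hd z) as (_ & L & _). specialize (L t Ht). generalize (Cmod_sub_triangle z z' t). lra. }
  set (om := fun k z => / 2 ^ k * Rmax 0 (2 * d z - Cmod (z - s k))).
  assert (Hom : forall k z, 0 <= om k z <= 2 * d z * / 2 ^ k).
  { intros k z. unfold om. pose proof (pow2_pos k). destruct (Hd z) as (D0 & _). pose proof (Cmod_ge_0 (z - s k)).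
    assert (0 <= Rmax 0 (2 * d z - Cmod (z - s k)) <= 2 * d z) by (split; [apply Rmax_l|apply Rmax_lub; lra]). nra. }
  assert (Homl : forall k z z', Rabs (om k z - om k z') <= 3 * Cmod (z - z') * / 2 ^ k).
  { intros k z z'. unfold om. rewrite <- Rmult_minus_distr_l, Rabs_mult, Rabs_right, Rmult_comm by (left; apply pow2_pos).
    apply Rmult_le_compat_r; [left; apply pow2_pos|].
    generalize (Hlip z z'), (Hlip z' z), (Cmod_sub_triangle z z' (s k)), (Cmod_sub_triangle z' z (s k)).
    rewrite (Cmod_sub_sym z' z). intros. apply Rabs_le. rmax; lra. }
  set (ps := fun z (a : nat -> C) n => csum n (fun k => RtoC (om k z) * a k)%C).
  (* The weighted series of a bounded sequence; the extension off S is the average W z a / W z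
     one. *)
  set (W := fun z a => epsilon (inhabits (RtoC 0)) (clim (ps z a))).
  assert (HWg : forall z a A, (forall k, Cmod (a k) <= A) -> forall n, Cmod (ps z a n - W z a) <= 8 * d z * A * / 2 ^ n).
  { intros z a A HA. assert (A0 : 0 <= A) by (generalize (HA O), (Cmod_ge_0 (a O)); lra).
    destruct (geometric_limit (ps z a) (2 * d z * A)) as [l Hl].
    - intro n. unfold ps. simpl. replace (_ - _)%C with (RtoC (om n z) * a n)%C by cring.
      rewrite Cmod_mult, Cmod_R, Rabs_right by (apply Rle_ge, Hom).
      replace (2 * d z * A * / 2 ^ n) with ((2 * d z * / 2 ^ n) * A) by ring.
      apply Rmult_le_compat; [apply Hom|apply Cmod_ge_0|apply Hom|apply HA].
    - assert (Cl : clim (ps z a) l) by (apply (geometric_clim _ _ _ Hl)).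
      assert (E : W z a = l).
      { apply (clim_unique (ps z a)); [|assumption]. apply (epsilon_spec (inhabits (RtoC 0)) (clim (ps z a))). exists l; assumption. }
      rewrite E. intro n. eapply Rle_trans; [apply Hl|]. right; ring. }
  assert (HWc : forall z a A, (forall k, Cmod (a k) <= A) -> clim (ps z a) (W z a)).
  { intros z a A HA. apply (geometric_clim _ _ _ (HWg z a A HA)). }
  set (one := fun _ : nat => RtoC 1).
  assert (Hone : forall k, Cmod (one k) <= 1) by (intro; unfold one; rewrite Cmod_1; lra).
  assert (Hps1 : forall z n, 0 <= fst (ps z one n) /\ forall k, (k < n)%nat -> om k z <= fst (ps z one n)).
  { intros z n; induction n as [|n [IH1 IH2]]; [split; [simpl; lra|intros; lia]|].
    assert (E : fst (ps z one (Datatypes.S n)) = fst (ps z one n) + om n z) by (unfold ps; simpl; ring).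
    rewrite E. pose proof (Hom n z). split; [lra|]. intros k Hk.
    destruct (Nat.eq_dec k n) as [->|]; [lra|]. specialize (IH2 k ltac:(lia)). lra. }
  assert (HW1 : forall z k, om k z <= fst (W z one)).
  { intros z k. apply Rnot_lt_le; intro Hlt.
    destruct (HWc z one 1 Hone ((om k z - fst (W z one)) / 2)) as [N2 HN2]; [lra|].
    specialize (HN2 (max N2 (Datatypes.S k)) (Nat.le_max_l _ _)).
    destruct (Hps1 z (max N2 (Datatypes.S k))) as [_ H2]. specialize (H2 k ltac:(lia)).
    generalize (Cmod_fst (ps z one (max N2 (Datatypes.S k)) - W z one)). simpl.
    intro B. generalize (Rle_abs (fst (ps z one (max N2 (Datatypes.S k))) + - fst (W z one))). lra. }
  assert (Hpos : forall z, ~ S z -> 0 < Cmod (W z one)).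
  { intros z Hz. assert (Dp : 0 < d z).
    { destruct (closedC_away S z HS Hz) as (r & Hr & R). destruct (Hd z) as (_ & _ & G).
      destruct (Rlt_dec 0 (d z)); [assumption|]. destruct (G r Hr) as (t & Ht & Ht2). specialize (R t Ht). lra. }
    destruct (Hd z) as (_ & _ & G). destruct (G (d z / 2)) as (t & Ht & Ht2); [lra|].
    destruct (Hdense t (d z / 2) Ht) as [k Hk]; [lra|].
    generalize (HW1 z k), (Cmod_fst (W z one)), (Rle_abs (fst (W z one))). intros.
    assert (0 < om k z); [|lra]. unfold om. apply Rmult_lt_0_compat; [apply pow2_pos|].
    generalize (Cmod_sub_triangle z t (s k)). rewrite (Cmod_sub_sym t (s k)). intro.
    eapply Rlt_le_trans; [|apply Rmax_r]. lra. }
  (* An average stays in every disc containing the terms of nonzero weight. The division is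
     postponed, so the estimate can be proved by induction on partial sums. *)
  assert (Havg : forall z a A c e, (forall k, Cmod (a k) <= A) -> 0 <= e ->
     (forall k, om k z = 0 \/ Cmod (a k - c) <= e) -> Cmod (W z a - c * W z one) <= e * Cmod (W z one)).
  { intros z a A c e HA He H.
    apply Rle_trans with (e * fst (W z one)).
    2: { apply Rmult_le_compat_l; [assumption|]. generalize (Cmod_fst (W z one)), (Rle_abs (fst (W z one))). lra. }
    apply (clim_le_fst (fun n => ps z a n + RtoC (-1) * (c * ps z one n))%C (ps z one)); [assumption| |apply (HWc z one 1 Hone)|].
    - replace (W z a - c * W z one)%C with (W z a + RtoC (-1) * (c * W z one))%C by cring.
      apply clim_plus; [apply (HWc z a A HA)|]. apply clim_scal, clim_scal, (HWc z one 1 Hone).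
    - intro n. induction n as [|n IH].
      + unfold ps; simpl. replace (_ + _)%C with (RtoC 0) by cring. rewrite Cmod_0. lra.
      + assert (E : fst (ps z one (Datatypes.S n)) = fst (ps z one n) + om n z) by (unfold ps; simpl; ring).
        rewrite E. replace (ps z a (Datatypes.S n) + _)%C with
          ((ps z a n + RtoC (-1) * (c * ps z one n)) + RtoC (om n z) * (a n - c))%C by (unfold ps, one; simpl; cring).
        eapply Rle_trans; [apply Cmod_triangle|]. rewrite Cmod_mult, Cmod_R, Rabs_right by (apply Rle_ge, Hom).
        destruct (H n) as [->|Hn]; [lra|]. pose proof (proj1 (Hom n z)). nra. }
  assert (HWl : forall z z' a A, (forall k, Cmod (a k) <= A) -> Cmod (W z a - W z' a) <= 6 * A * Cmod (z - z')).
  { intros z z' a A HA. assert (A0 : 0 <= A) by (generalize (HA O), (Cmod_ge_0 (a O)); lra).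
    apply (clim_le (fun n => ps z a n + RtoC (-1) * ps z' a n)%C).
    - replace (W z a - W z' a)%C with (W z a + RtoC (-1) * W z' a)%C by cring.
      apply clim_plus; [apply (HWc z a A HA)|]. apply clim_scal, (HWc z' a A HA).
    (* The factor 1 - 2^-n is the exact partial sum of the Lipschitz constants 3 * 2^-k, halved
       twice into 6, and makes the induction close. *)
    - intro n. assert (K : Cmod (ps z a n + RtoC (-1) * ps z' a n) <= 6 * A * Cmod (z - z') * (1 - / 2 ^ n)).
      2: { pose proof (pow2_pos n). pose proof (Cmod_ge_0 (z - z')).
           assert (0 <= 6 * A * Cmod (z - z')) by (repeat apply Rmult_le_pos; lra). nra. }
      induction n as [|n IH].
      + unfold ps; simpl. replace (_ + _)%C with (RtoC 0) by cring. rewrite Cmod_0. lra.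
      + replace (ps z a (Datatypes.S n) + RtoC (-1) * ps z' a (Datatypes.S n))%C with
          ((ps z a n + RtoC (-1) * ps z' a n) + RtoC (om n z - om n z') * a n)%C by (unfold ps; simpl; cring).
        eapply Rle_trans; [apply Cmod_triangle|]. rewrite Cmod_mult, Cmod_R.
        assert (Rabs (om n z - om n z') * Cmod (a n) <= (3 * Cmod (z - z') * / 2 ^ n) * A).
        { apply Rmult_le_compat; [apply Rabs_pos|apply Cmod_ge_0|apply Homl|apply HA]. }
        rewrite pow2_half. lra. }
  set (E := fun z w => if excluded_middle_informative (S z) then F z w
     else (/ W z one * W z (fun k => F (s k) w))%C).
  assert (EF : forall z w, S z -> E z w = F z w).
  { intros z w Hz. unfold E. destruct (excluded_middle_informative (S z)); [reflexivity|contradiction]. }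
  assert (EN : forall z w, ~ S z -> E z w = (/ W z one * W z (fun k => F (s k) w))%C).
  { intros z w Hz. unfold E. destruct (excluded_middle_informative (S z)); [contradiction|reflexivity]. }
  assert (HA : forall w, K2 w -> forall k, Cmod (F (s k) w) <= M) by (intros; apply HFM; auto).
  assert (Hdiv : forall z w c e, ~ S z -> K2 w -> 0 <= e -> (forall k, om k z = 0 \/ Cmod (F (s k) w - c) <= e) ->
     Cmod (E z w - c) <= e).
  { intros z w c e Hz Hw He H. rewrite EN by assumption. pose proof (Hpos z Hz) as P.
    assert (Hne : W z one <> RtoC 0) by (apply Cmod_gt_0, P).
    pose proof (Havg z (fun k => F (s k) w) M c e (HA w Hw) He H) as K.
    replace (_ - c)%C with (/ W z one * (W z (fun k => F (s k) w) - c * W z one))%C by (field; assumption).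
    rewrite Cmod_mult, Cmod_inv by assumption.
    apply Rmult_le_reg_l with (Cmod (W z one)); [assumption|]. rewrite <- Rmult_assoc, Rinv_r, Rmult_1_l by lra. lra. }
  exists E. split; [assumption|split; [|split]].
  - intro z. destruct (classic (S z)) as [Hz|Hz].
    + apply (in_AD_ext m K2 (F z)); [intros; symmetry; apply EF, Hz|apply HFA, Hz].
    + apply (in_AD_ext m K2 (fun w => Cmult (/ W z one) (W z (fun k => F (s k) w)))).
      { intros w _. symmetry. apply EN, Hz. }
      (* For fixed z the weights are constants: the partial sums are linear combinations of the
         [F (s k)], and [HWg] makes them converge uniformly on K2. *)
      apply in_AD_scal. apply in_AD_limit. intros eps He.
      set (B := 8 * d z * M). assert (HB : 0 <= B) by (unfold B; pose proof (proj1 (Hd z)); nra).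
      destruct (pow2_small (eps / (B + 1))) as [N HN]; [apply Rdiv_lt_0_compat; lra|].
      exists (fun w => ps z (fun k => F (s k) w) N). split.
      * clear HN. unfold ps. induction N as [|N IH]; simpl; [apply in_AD_const|].
        apply in_AD_plus; [exact IH|]. apply in_AD_scal, HFA, Hs.
      * intros w Hw. rewrite Cmod_sub_sym. eapply Rle_trans; [apply (HWg _ _ M), HA, Hw|]. fold B.
        apply Rlt_div_mult in HN; [|lra]. generalize (pow2_pos N). nra.
  - intros z w Hw. destruct (classic (S z)) as [Hz|Hz].
    + rewrite EF by assumption. apply HFM; assumption.
    + replace (E z w) with (E z w - 0)%C by cring. apply Hdiv; try assumption; [lra|]. intro k. right.
      replace (F (s k) w - 0)%C with (F (s k) w) by cring. apply HA, Hw.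
  - intros z eps He. destruct (classic (S z)) as [Hz|Hz].
    (* A term of nonzero weight at z' satisfies |z' - s_k| < 2 d(z') <= 2 |z' - z|, hence |s_k - z|
       < 3 |z' - z|. *)
    + destruct (HFe z (eps / 2) Hz) as (del & Hdel & K); [lra|]. exists (del / 3). split; [lra|].
      intros z' Hz' w Hw. rewrite (EF z) by assumption. apply Rle_lt_trans with (eps / 2); [|lra].
      destruct (classic (S z')) as [Hsz|Hsz].
      * rewrite EF by assumption. left. apply K; try assumption. lra.
      * apply Hdiv; try assumption; [lra|]. intro k. destruct (Rle_dec (2 * d z' - Cmod (z' - s k)) 0) as [Hk|Hk].
        -- left. unfold om. rewrite Rmax_left by lra. ring.
        -- right. left. apply K; [apply Hs| |assumption].
           destruct (Hd z') as (_ & L & _). specialize (L z Hz).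
           generalize (Cmod_sub_triangle (s k) z' z). rewrite (Cmod_sub_sym (s k) z'). lra.
    + destruct (closedC_away S z HS Hz) as (r & Hr & HR). pose proof (Hpos z Hz) as P0.
      set (v0 := Cmod (W z one)) in *.
      (* r keeps z' off S; v0 / 12 keeps the denominator above v0 / 2, its Lipschitz constant being
         6; the last radius makes the quotient bound 24 M h / v0 smaller than eps. *)
      exists (Rmin r (Rmin (v0 / 12) (eps * v0 / (24 * M)))). split.
      { repeat apply Rmin_glb_lt; try lra. apply Rdiv_lt_0_compat; [apply Rmult_lt_0_compat; assumption|lra]. }
      intros z' Hz' w Hw.
      generalize (Rmin_l r (Rmin (v0 / 12) (eps * v0 / (24 * M)))), (Rmin_r r (Rmin (v0 / 12) (eps * v0 / (24 * M)))),
        (Rmin_l (v0 / 12) (eps * v0 / (24 * M))), (Rmin_r (v0 / 12) (eps * v0 / (24 * M))). intros.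
      assert (Hsz : ~ S z') by (intro K; specialize (HR z' K); rewrite Cmod_sub_sym in HR; lra).
      rewrite !EN by assumption.
      set (a := fun k => F (s k) w).
      pose proof (HWl z' z a M (HA w Hw)) as L1. pose proof (HWl z' z one 1 Hone) as L2.
      assert (N0 : Cmod (W z a) <= M * v0).
      { replace (W z a) with (W z a - 0 * W z one)%C by cring. apply (Havg z a M); [apply HA, Hw|lra|].
        intro k. right. replace (a k - 0)%C with (a k) by cring. apply HA, Hw. }
      set (h := Cmod (z' - z)) in *. assert (Hh : 0 <= h) by apply Cmod_ge_0.
      assert (V1 : v0 / 2 <= Cmod (W z' one)).
      { generalize (Cmod_le_sub (W z one) (W z' one)). rewrite (Cmod_sub_sym (W z one)). fold v0. lra. }
      assert (Hne : W z one <> RtoC 0) by (apply Cmod_gt_0; assumption).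
      assert (Hne' : W z' one <> RtoC 0) by (apply Cmod_gt_0; lra).
      replace (_ - _)%C with (((W z' a - W z a) * W z one + W z a * - (W z' one - W z one)) * (/ W z' one * / W z one))%C
        by (field; split; assumption).
      rewrite Cmod_mult, (Cmod_mult (/ _)), !Cmod_inv by assumption. fold v0.
      assert (T : Cmod ((W z' a - W z a) * W z one + W z a * - (W z' one - W z one)) <= 12 * M * h * v0).
      { eapply Rle_trans; [apply Cmod_triangle|]. rewrite !Cmod_mult, Cmod_opp. fold v0.
        assert (Cmod (W z' a - W z a) * v0 <= 6 * M * h * v0) by (apply Rmult_le_compat_r; lra).
        assert (Cmod (W z a) * Cmod (W z' one - W z one) <= M * v0 * (6 * 1 * h)).
        { apply Rmult_le_compat; auto using Cmod_ge_0. }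
        lra. }
      assert (I1 : / Cmod (W z' one) <= / (v0 / 2)) by (apply Rinv_le_contravar; lra).
      assert (I0 : 0 < / Cmod (W z' one)) by (apply Rinv_0_lt_compat; lra).
      assert (I2 : 0 < / v0) by (apply Rinv_0_lt_compat; assumption).
      apply Rle_lt_trans with (12 * M * h * v0 * (/ (v0 / 2) * / v0)).
      * apply Rmult_le_compat; [apply Cmod_ge_0|nra|assumption|]. apply Rmult_le_compat_r; lra.
      * replace (12 * M * h * v0 * (/ (v0 / 2) * / v0)) with (h * (24 * M / v0)) by (field; lra).
        assert (Q : 0 < 24 * M / v0) by (apply Rdiv_lt_0_compat; lra).
        apply Rlt_le_trans with (eps * v0 / (24 * M) * (24 * M / v0)); [apply Rmult_lt_compat_r; lra|].
        right. field. lra.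
Qed.

Lemma equicont_acont m (K2 : Cn m -> Prop) G w : equicont K2 G -> K2 w -> acont (fun z => G z w).
Proof.
  intros H Hw z eps He. destruct (H z eps He) as (d & Hd & K). exists d. split; [assumption|]. intros z' Hz'. apply K; assumption.
Qed.

Lemma equicont_mult m (K2 : Cn m -> Prop) (G : C -> Cn m -> C) (v : C -> C) M :
  (forall z w, K2 w -> Cmod (G z w) <= M) -> equicont K2 G -> acont v -> equicont K2 (fun z w => v z * G z w)%C.
Proof.
  intros HM HG Hv z eps He.
  set (B := Rabs M + Cmod (v z) + 1).
  pose proof (Rabs_pos M) as M0. pose proof (Cmod_ge_0 (v z)) as V0.
  assert (HB : 1 <= B) by (unfold B; lra).
  assert (He' : 0 < eps / (2 * B)) by (apply Rdiv_lt_0_compat; lra).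
  assert (Ee : eps = eps / (2 * B) * (2 * B)) by (field; lra). set (e := eps / (2 * B)) in *.
  destruct (HG z e He') as (d1 & Hd1 & K1). destruct (Hv z e He') as (d2 & Hd2 & K2').
  exists (Rmin d1 d2). split; [apply Rmin_glb_lt; assumption|]. intros z' Hz' w Hw.
  specialize (K1 z' (Rlt_le_trans _ _ _ Hz' (Rmin_l _ _)) w Hw). specialize (K2' z' (Rlt_le_trans _ _ _ Hz' (Rmin_r _ _))).
  replace (_ - _)%C with ((v z' - v z) * G z' w + v z * (G z' w - G z w))%C by cring.
  eapply Rle_lt_trans; [apply Cmod_triangle|]. rewrite !Cmod_mult.
  specialize (HM z' w Hw). pose proof (Rle_abs M).
  assert (Cmod (v z' - v z) * Cmod (G z' w) <= e * Rabs M).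
  { apply Rmult_le_compat; try apply Cmod_ge_0; lra. }
  assert (Cmod (v z) * Cmod (G z' w - G z w) <= Cmod (v z) * e) by (apply Rmult_le_compat_l; lra).
  unfold B in Ee. nra.
Qed.

(** Riemann sums by bisection: on a small square around z the integral is close to l^2 G z,
    uniformly on K2, and [cousin_square] adds up these members of A_D. Only finite sums and one
    uniform limit occur. *)
Lemma in_AD_integral m (K2 : Cn m -> Prop) (G : C -> Cn m -> C) a b l : 0 < l ->
  (forall z, in_AD K2 (G z)) -> equicont K2 G -> (forall w, K2 w -> supp_in a b l (fun z => G z w)) ->
  in_AD K2 (fun w => Pint (fun z => G z w)).
Proof.
  intros Hl HA HG Hs. apply in_AD_limit. intros eps He.
  assert (P : forall eps, 0 < eps -> exists q, in_AD K2 q /\ forall w, K2 w -> Cmod (Isq a b l (fun z => G z w) - q w) <= eps * l ^ 2).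
  { clear eps He. intros eps He.
    apply (cousin_square (fun a b l => exists q, in_AD K2 q /\ forall w, K2 w -> Cmod (Isq a b l (fun z => G z w) - q w) <= eps * l ^ 2)); [assumption| |].
    - intros a' b' l' Hl' (q1 & A1 & B1) (q2 & A2 & B2) (q3 & A3 & B3) (q4 & A4 & B4).
      exists (fun w => Cplus (Cplus (Cplus (q1 w) (q2 w)) (q3 w)) (q4 w)). split; [repeat apply in_AD_plus; assumption|].
      intros w Hw. specialize (B1 w Hw). specialize (B2 w Hw). specialize (B3 w Hw). specialize (B4 w Hw).
      rewrite Isq_split by (try assumption; apply (equicont_acont m K2); assumption).
      set (i1 := Isq a' b' (l' / 2) _) in *. set (i2 := Isq (a' + l' / 2) b' (l' / 2) _) in *.
      set (i3 := Isq a' (b' + l' / 2) (l' / 2) _) in *. set (i4 := Isq (a' + l' / 2) (b' + l' / 2) (l' / 2) _) in *.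
      replace (i1 + i2 + i3 + i4 - (q1 w + q2 w + q3 w + q4 w))%C with
        ((i1 - q1 w) + ((i2 - q2 w) + ((i3 - q3 w) + (i4 - q4 w))))%C by cring.
      eapply Rle_trans; [apply Cmod_triangle|].
      eapply Rle_trans; [apply Rplus_le_compat_l, Cmod_triangle|].
      eapply Rle_trans; [apply Rplus_le_compat_l, Rplus_le_compat_l, Cmod_triangle|]. lra.
    - intros z Hz. destruct (HG z (eps / 4)) as (d & Hd & K); [lra|]. exists (d / 2). split; [lra|].
      intros a' b' l' Hl' Hz'. exists (fun w => Cmult (RtoC (l' ^ 2)) (G z w)). split; [apply in_AD_scal, HA|].
      intros w Hw. pose proof (equicont_acont m K2 G w HG Hw) as Ha.
      replace (Isq a' b' l' (fun z => G z w) - RtoC (l' ^ 2) * G z w)%C with (Isq a' b' l' (fun t => G t w + (RtoC (-1) * G z w))%C).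
      + replace (eps * l' ^ 2) with (4 * (eps / 4) * l' ^ 2) by field. apply Isq_le; [lra| |].
        * apply acont_plus; [assumption|apply acont_const].
        * intros t Ht. replace (_ + _)%C with (G t w - G z w)%C by cring. left. apply K; [|assumption].
          eapply Rle_lt_trans; [apply (insq_mod _ _ _ _ _ Hz' Ht)|lra].
      + rewrite Isq_plus, Isq_const by (try assumption; try apply acont_const; lra). cring. }
  destruct (P (eps / l ^ 2)) as (q & Hq & K); [apply Rdiv_lt_0_compat; [assumption|apply pow_lt; assumption]|].
  exists q. split; [assumption|]. intros w Hw.
  rewrite (Pint_eq a b l); [|assumption|apply (equicont_acont m K2); assumption|apply Hs; assumption].
  eapply Rle_trans; [apply K, Hw|]. right. field. lra.
Qed.

(** * Decomposition along a grid *)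

Fixpoint rsum (n : nat) (a : nat -> R) : R := match n with O => 0 | S k => rsum k a + a k end.

Lemma rsum_ext n a b : (forall k, a k = b k) -> rsum n a = rsum n b.
Proof. intros H. f_equal. apply functional_extensionality, H. Qed.

Lemma rsum_scal n c a : rsum n (fun k => c * a k) = c * rsum n a.
Proof. induction n as [|n IH]; simpl; [ring|]. rewrite IH. ring. Qed.

Lemma rsum_le n a b : (forall k, a k <= b k) -> rsum n a <= rsum n b.
Proof. intros H. induction n as [|n IH]; simpl; [lra|]. generalize (H n). lra. Qed.

Lemma rsum_telescope (g : R -> R) y n : rsum n (fun i => g (y - INR i + 1) - g (y - INR i)) = g (y + 1) - g (y + 1 - INR n).
Proof.
  induction n as [|n IH]; simpl rsum.
  - simpl. rewrite Rminus_0_r. ring.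
  - rewrite IH, S_INR. replace (y + 1 - (INR n + 1)) with (y - INR n) by ring. replace (y + 1 - INR n) with (y - INR n + 1) by ring. ring.
Qed.

Lemma rsum_hat y n : rsum n (fun i => hat (y - INR i)) = ramp (y + 1) - ramp (y + 1 - INR n).
Proof. rewrite <- rsum_telescope. apply rsum_ext. intro; apply hat_unfold. Qed.

Lemma rsum_dhat y n : rsum n (fun i => dhat (y - INR i)) = dramp (y + 1) - dramp (y + 1 - INR n).
Proof. rewrite <- rsum_telescope. apply rsum_ext. intro; apply dhat_unfold. Qed.

(** v / (1 + |v|) is a primitive of 1 / (1 + |v|)^2 with values between -1 and 1. Its unit
    increments telescope, so sums of any length are at most 4 * 2 = 8. *)
Lemma inv_sq_telescope v : / (1 + v ^ 2) <= 4 * ((v + 1) / (1 + Rabs (v + 1)) - v / (1 + Rabs v)).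
Proof.
  assert (Hv : 0 < 1 + v ^ 2) by (generalize (pow2_ge_0 v); lra).
  apply Rmult_le_reg_r with (1 + v ^ 2); [assumption|]. rewrite Rinv_l by lra.
  destruct (Rle_dec 0 v) as [H|H]; [|destruct (Rle_dec v (-1)) as [H'|H']].
  - rewrite !Rabs_right by lra.
    replace ((v + 1) / (1 + (v + 1)) - v / (1 + v)) with (/ ((1 + v) * (2 + v))) by (field; lra).
    apply Rmult_le_reg_r with ((1 + v) * (2 + v)); [nra|].
    replace (4 * / ((1 + v) * (2 + v)) * (1 + v ^ 2) * ((1 + v) * (2 + v))) with (4 * (1 + v ^ 2)) by (field; lra). nra.
  - rewrite (Rabs_left1 (v + 1)), (Rabs_left1 v) by lra.
    replace ((v + 1) / (1 + - (v + 1)) - v / (1 + - v)) with (/ ((- v) * (1 - v))) by (field; lra).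
    apply Rmult_le_reg_r with ((- v) * (1 - v)); [nra|].
    replace (4 * / (- v * (1 - v)) * (1 + v ^ 2) * (- v * (1 - v))) with (4 * (1 + v ^ 2)) by (field; lra). nra.
  - rewrite (Rabs_right (v + 1)), (Rabs_left1 v) by lra.
    assert (A : (v + 1) / 2 <= (v + 1) / (1 + (v + 1))).
    { apply Rmult_le_compat_l; [lra|]. apply Rinv_le_contravar; lra. }
    assert (B : - v / 2 <= - (v / (1 + - v))).
    { replace (- (v / (1 + - v))) with (- v * / (1 + - v)) by (field; lra). apply Rmult_le_compat_l; [lra|]. apply Rinv_le_contravar; lra. }
    nra.
Qed.

Lemma rsum_inv_sq y n : rsum n (fun i => / (1 + (y - INR i) ^ 2)) <= 8.
Proof.
  set (g := fun v => v / (1 + Rabs v)).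
  assert (Hg : forall v, -1 <= g v <= 1).
  { intro v. unfold g. assert (P : 0 < 1 + Rabs v) by (generalize (Rabs_pos v); lra). split.
    - apply Rmult_le_reg_r with (1 + Rabs v); [assumption|]. unfold Rdiv. rewrite Rmult_assoc, Rinv_l by lra.
      generalize (Rle_abs (- v)). rewrite Rabs_Ropp. lra.
    - apply Rmult_le_reg_r with (1 + Rabs v); [assumption|]. unfold Rdiv. rewrite Rmult_assoc, Rinv_l by lra.
      generalize (Rle_abs v). lra. }
  apply Rle_trans with (4 * rsum n (fun i => g (y - INR i + 1) - g (y - INR i))).
  - rewrite <- rsum_scal. apply rsum_le. intro k. apply inv_sq_telescope.
  - rewrite rsum_telescope. generalize (Hg (y + 1)), (Hg (y + 1 - INR n)). lra.
Qed.

(** The shift by n lets natural indices from 0 to 2n run over a grid centred at the origin. *)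
Definition node (n N i j : nat) : C := (((INR i - INR n) * / 2 ^ N)%R, ((INR j - INR n) * / 2 ^ N)%R).

Lemma node_coord n N i x : (x - (INR i - INR n) * / 2 ^ N) / / 2 ^ N = x / / 2 ^ N + INR n - INR i.
Proof. field. apply pow_nonzero; lra. Qed.

Lemma rsum_mult n m (a b : nat -> R) : rsum n (fun i => rsum m (fun j => a i * b j)) = rsum n a * rsum m b.
Proof.
  rewrite (rsum_ext n _ (fun i => rsum m b * a i)); [rewrite rsum_scal; ring|].
  intro i. rewrite rsum_scal. ring.
Qed.

Lemma rsum_decay n N L z : rsum L (fun i => rsum L (fun j => decay (node n N i j) N z)) <= 64.
Proof.
  rewrite (rsum_ext L _ (fun i => rsum L (fun j => / (1 + (fst z / / 2 ^ N + INR n - INR i) ^ 2) * / (1 + (snd z / / 2 ^ N + INR n - INR j) ^ 2)))).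
  - rewrite (rsum_mult L L (fun i => / (1 + (fst z / / 2 ^ N + INR n - INR i) ^ 2)) (fun j => / (1 + (snd z / / 2 ^ N + INR n - INR j) ^ 2))).
    assert (P : forall y, 0 <= rsum L (fun i => / (1 + (y - INR i) ^ 2))).
    { intro y. induction L as [|L IH]; simpl; [lra|].
      assert (0 < / (1 + (y - INR L) ^ 2)) by (apply Rinv_0_lt_compat; generalize (pow2_ge_0 (y - INR L)); lra). simpl in *; lra. }
    generalize (rsum_inv_sq (fst z / / 2 ^ N + INR n) L), (rsum_inv_sq (snd z / / 2 ^ N + INR n) L),
      (P (fst z / / 2 ^ N + INR n)), (P (snd z / / 2 ^ N + INR n)). nra.
  - intro i. apply rsum_ext. intro j. unfold decay, node. cbn [fst snd]. rewrite !node_coord. reflexivity.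
Qed.

Lemma test_zero : test (fun _ => RtoC 0) (fun _ => RtoC 0).
Proof.
  split; [intro; apply dbar_const|split; [apply acont_const|]]. exists 1. split; [lra|]. intros z _; reflexivity.
Qed.

Lemma test_plus phi dphi psi dpsi : test phi dphi -> test psi dpsi ->
  test (fun w => phi w + psi w)%C (fun w => dphi w + dpsi w)%C.
Proof.
  intros (A & B & D) (A' & B' & D'). split; [intro; apply dbar_plus; auto|split; [apply acont_plus|apply csupp_plus]; assumption].
Qed.

Lemma vit_csum n (phi dphi : nat -> C -> C) f z : (forall i, test (phi i) (dphi i)) -> acont f ->
  test (fun w => csum n (fun i => phi i w)) (fun w => csum n (fun i => dphi i w)) /\
  vit (fun w => csum n (fun i => phi i w)) (fun w => csum n (fun i => dphi i w)) f z = csum n (fun i => vit (phi i) (dphi i) f z).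
Proof.
  intros Ht Hf. induction n as [|n [IH1 IH2]]; simpl.
  - split; [apply test_zero|]. unfold vit.
    rewrite (CT_ext _ (fun w => RtoC 0 * (fun _ => RtoC 0) w)%C) by (intro; cring).
    rewrite CT_scal by apply test_zero. cring.
  - split; [apply test_plus; auto|]. rewrite vit_add_phi by auto. rewrite IH2. reflexivity.
Qed.

Lemma csum_pair n (a : nat -> C) : csum n a = (rsum n (fun k => fst (a k)), rsum n (fun k => snd (a k))).
Proof. induction n as [|n IH]; simpl; [reflexivity|]. rewrite IH. reflexivity. Qed.

Lemma tent_sum n N z : Rabs (fst z) <= INR n * / 2 ^ N -> Rabs (snd z) <= INR n * / 2 ^ N ->
  csum (2 * n + 1) (fun i => csum (2 * n + 1) (fun j => tent (node n N i j) N z)) = RtoC 1 /\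
  csum (2 * n + 1) (fun i => csum (2 * n + 1) (fun j => dtent (node n N i j) N z)) = RtoC 0.
Proof.
  intros Hx Hy. pose proof (pow2_pos N) as P. set (L := (2 * n + 1)%nat).
  assert (HL : INR L = 2 * INR n + 1) by (unfold L; rewrite plus_INR, mult_INR; simpl; ring).
  assert (H : forall x, Rabs x <= INR n * / 2 ^ N ->
    rsum L (fun i => hat (x / / 2 ^ N + INR n - INR i)) = 1 /\ rsum L (fun i => dhat (x / / 2 ^ N + INR n - INR i)) = 0).
  { intros x Hx'. apply (Rabs_div_le x (/ 2 ^ N) (INR n) P) in Hx'. apply Rabs_le_between in Hx'.
    rewrite rsum_hat, rsum_dhat, HL.
    (* The rescaled coordinate y lies in [0, 2n], so the two ends of the telescope are ramp (y + 1)
       = 1 and ramp (y - 2n) = 0. This is why 2n + 1 nodes are taken. *)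
    destruct (ramp_1 (x / / 2 ^ N + INR n + 1)) as [-> ->]; [lra|].
    destruct (ramp_0 (x / / 2 ^ N + INR n + 1 - (2 * INR n + 1))) as [-> ->]; lra. }
  destruct (H _ Hx) as [X1 X0]. destruct (H _ Hy) as [Y1 Y0].
  assert (Hp : forall a : nat -> nat -> C, csum L (fun i => csum L (a i)) =
    (rsum L (fun i => rsum L (fun j => fst (a i j))), rsum L (fun i => rsum L (fun j => snd (a i j))))).
  { intro a. rewrite csum_pair. f_equal; apply rsum_ext; intro; rewrite csum_pair; reflexivity. }
  set (hx := fun i => hat (fst z / / 2 ^ N + INR n - INR i)) in *. set (hy := fun i => hat (snd z / / 2 ^ N + INR n - INR i)) in *.
  set (gx := fun i => dhat (fst z / / 2 ^ N + INR n - INR i)) in *. set (gy := fun i => dhat (snd z / / 2 ^ N + INR n - INR i)) in *.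
  rewrite !Hp. split.
  - rewrite (rsum_ext L (fun i => rsum L (fun j => fst (tent (node n N i j) N z))) (fun i => rsum L (fun j => hx i * hy j))).
    2: { intro i. apply rsum_ext. intro j. unfold tent, bump, node, hx, hy. cbn [fst snd RtoC]. rewrite !node_coord. reflexivity. }
    rewrite (rsum_ext L (fun i => rsum L (fun j => snd (tent (node n N i j) N z))) (fun i => rsum L (fun j => 0 * 0))).
    2: { intro i. apply rsum_ext. intro j. unfold tent, bump. simpl. ring. }
    rewrite !(rsum_mult L L (fun _ => 0) (fun _ => 0)), !(rsum_mult L L hx hy), X1, Y1.
    rewrite (rsum_ext L (fun _ => 0) (fun _ => 0 * 0)) by (intro; ring). rewrite (rsum_scal L 0 (fun _ => 0)). apply C_ext; simpl; ring.
  - rewrite (rsum_ext L (fun i => rsum L (fun j => fst (dtent (node n N i j) N z))) (fun i => rsum L (fun j => gx i * (/ (2 * / 2 ^ N) * hy j)))).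
    2: { intro i. apply rsum_ext. intro j. unfold dtent, dbump, node, gx, hy. cbn [fst snd]. rewrite !node_coord. field. apply pow_nonzero; lra. }
    rewrite (rsum_ext L (fun i => rsum L (fun j => snd (dtent (node n N i j) N z))) (fun i => rsum L (fun j => hx i * (/ (2 * / 2 ^ N) * gy j)))).
    2: { intro i. apply rsum_ext. intro j. unfold dtent, dbump, node, gy, hx. cbn [fst snd]. rewrite !node_coord. field. apply pow_nonzero; lra. }
    rewrite (rsum_mult L L gx (fun j => / (2 * / 2 ^ N) * hy j)), (rsum_mult L L hx (fun j => / (2 * / 2 ^ N) * gy j)).
    rewrite !rsum_scal, X0, Y0. apply C_ext; simpl; ring.
Qed.

Lemma vit_decomposition n N f z : acont f ->
  (forall w, f w = RtoC 0 \/ (Rabs (fst w) <= INR n * / 2 ^ N /\ Rabs (snd w) <= INR n * / 2 ^ N)) ->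
  csum (2 * n + 1) (fun i => csum (2 * n + 1) (fun j => vit (tent (node n N i j) N) (dtent (node n N i j) N) f z)) = (ckern * f z)%C.
Proof.
  intros Hf Hs. set (L := (2 * n + 1)%nat).
  assert (Hrow : forall i, test (fun w => csum L (fun j => tent (node n N i j) N w)) (fun w => csum L (fun j => dtent (node n N i j) N w)) /\
    vit (fun w => csum L (fun j => tent (node n N i j) N w)) (fun w => csum L (fun j => dtent (node n N i j) N w)) f z =
    csum L (fun j => vit (tent (node n N i j) N) (dtent (node n N i j) N) f z)).
  { intro i. apply (vit_csum L (fun j => tent (node n N i j) N) (fun j => dtent (node n N i j) N)); [intro; apply tent_test|assumption]. }
  destruct (vit_csum L (fun i w => csum L (fun j => tent (node n N i j) N w)) (fun i w => csum L (fun j => dtent (node n N i j) N w)) f z)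
    as [Ht E]; [intro; apply Hrow|assumption|].
  rewrite (csum_ext L _ (fun i => vit (fun w => csum L (fun j => tent (node n N i j) N w)) (fun w => csum L (fun j => dtent (node n N i j) N w)) f z)).
  - rewrite <- E. apply vit_one; [assumption|assumption|]. intro w. destruct (Hs w) as [H0|[Hx Hy]]; [left; assumption|right].
    apply (tent_sum n N w Hx Hy).
  - intros i _. symmetry. apply Hrow.
Qed.

(** * The product theorem *)

Definition slice (K1 : Cn 1 -> Prop) : C -> Prop := fun z => K1 (fun _ => z).

Definition interiorC (S : C -> Prop) : C -> Prop := fun z => exists r, 0 < r /\ forall w, Cmod (w - z) < r -> S w.

Lemma openC_interior S : openC (interiorC S).
Proof.
  intros z (r & Hr & H). exists (r / 2). split; [lra|]. intros w Hw. exists (r / 2). split; [lra|]. intros t Ht.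
  apply H. generalize (Cmod_sub_triangle t w z). lra.
Qed.

(** A disc mapped injectively into K1 has an open image, which therefore lies in the interior of K1;
    the chain rule does the rest. *)
Lemma holcont_in_AD (K1 : Cn 1 -> Prop) (h : C -> C) : acont h -> (forall z, interiorC (slice K1) z -> Cdiff1 h z) ->
  in_AD K1 (fun y => h (y Fin.F1)).
Proof.
  intros Hc Hd. split.
  - intros z _ eps He. destruct (Hc (z Fin.F1) eps He) as (d & Hd' & K). exists d. split; [assumption|]. intros w _ Hw.
    apply K. eapply Rle_lt_trans; [|exact Hw]. apply (vnorm_coord 1 (fun i => Csub (w i) (z i))).
  - intros c r phi Hr Hphi Hinj HK t Ht.
    apply (Cdiff1_comp h (fun t => phi t Fin.F1)); [|apply Hphi, Ht]. apply Hd.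
    destruct (injective_holo_open (fun t => phi t Fin.F1) (Defs.disc c r) t) as (eps & He & Hopen).
    + apply openC_disc.
    + intros; apply Hphi; assumption.
    + intros t1 t2 H1 H2 E. apply Hinj; try assumption. intro i.
      rewrite <- (Cn1_eta (phi t1)), <- (Cn1_eta (phi t2)). exact E.
    + exact Ht.
    + exists eps. split; [assumption|]. intros w Hw. destruct (Hopen w Hw) as (t' & Ht' & <-).
      unfold slice. rewrite Cn1_eta. apply HK, Ht'.
Qed.

(** The errors stay functions of z: each piece errs mostly near its own cell, and adding suprema
    would lose that. *)
Lemma in_Obar_csum n (K : Cn n -> Prop) (L : nat) (a : nat -> Cn n -> C) (b : nat -> Cn n -> R) :
  (forall k, exists h, in_Obar K h /\ forall z, K z -> Cmod (a k z - h z) <= b k z) ->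
  exists h, in_Obar K h /\ forall z, K z -> Cmod (csum L (fun k => a k z) - h z) <= rsum L (fun k => b k z).
Proof.
  intros H. induction L as [|L (h & Hh & IH)]; simpl.
  - exists (fun _ => RtoC 0). split; [apply in_Obar_const|]. intros z _. rewrite Cmod_subself. lra.
  - destruct (H L) as (g & Hg & G). exists (fun z => Cplus (h z) (g z)). split; [apply in_Obar_plus; assumption|].
    intros z Hz. specialize (IH z Hz). specialize (G z Hz).
    replace (_ - _)%C with ((csum L (fun k => a k z) - h z) + (a L z - g z))%C by cring.
    eapply Rle_trans; [apply Cmod_triangle|]. lra.
Qed.

Lemma prodK_compact m (K1 : Cn 1 -> Prop) (K2 : Cn m -> Prop) : is_compact K1 -> is_compact K2 -> is_compact (prodK K1 K2).
Proof.
  intros [C1 [M1 B1]] [C2 [M2 B2]]. split.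
  - intros z Hz. split.
    + apply C1. intros r Hr. destruct (Hz r Hr) as (w & [Hw _] & Hd). exists (fun _ => w Fin.F1). split; [assumption|].
      eapply Rle_lt_trans; [|exact Hd]. apply vnorm_le; [apply vdist_ge_0|]. intro. apply (vnorm_coord (S m) (fun i => Csub (w i) (z i))).
    + apply C2. intros r Hr. destruct (Hz r Hr) as (w & [_ Hw] & Hd). exists (fun j => w (Fin.FS j)). split; [assumption|].
      eapply Rle_lt_trans; [|exact Hd]. apply vnorm_le; [apply vdist_ge_0|]. intro. apply (vnorm_coord (S m) (fun i => Csub (w i) (z i))).
  - exists (Rmax M1 M2). intros z [H1 H2]. simpl. apply Rmax_lub.
    + eapply Rle_trans; [|apply Rmax_l]. eapply Rle_trans; [|apply (B1 _ H1)]. apply (vnorm_coord 1 (fun _ => z Fin.F1) Fin.F1).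
    + eapply Rle_trans; [|apply Rmax_r]. apply (B2 _ H2).
Qed.

Lemma equicont_uniform m (K2 : Cn m -> Prop) (G : C -> Cn m -> C) r eps : 0 < eps -> equicont K2 G ->
  (forall z w, K2 w -> ~ ksq (RtoC 0) r z -> G z w = RtoC 0) ->
  exists d, 0 < d /\ forall z z' w, K2 w -> Cmod (z' - z) < d -> Cmod (G z' w - G z w) <= eps.
Proof.
  intros He HG Hs.
  assert (H : forall z, exists rho, 0 < rho /\ forall z', Cmod (z' - z) < 2 * rho -> forall w, K2 w -> Cmod (G z' w - G z w) < eps / 2).
  { intro z. destruct (HG z (eps / 2)) as (d & Hd & K); [lra|]. exists (d / 2). split; [lra|]. intros z' Hz'. apply K; lra. }
  set (rho := fun z => proj1_sig (constructive_indefinite_description _ (H z))).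
  assert (Hrho : forall z, 0 < rho z /\ forall z', Cmod (z' - z) < 2 * rho z -> forall w, K2 w -> Cmod (G z' w - G z w) < eps / 2).
  { intro z. unfold rho. apply (proj2_sig (constructive_indefinite_description _ (H z))). }
  (* The square of radius r lies in the disc of radius 2 |r|. A point beyond 2 |r| + 1 stays outside
     that disc after a move shorter than 1, so both values are 0; hence the minimum of d and 1. *)
  destruct (gauge_plane (2 * Rabs r + 1) rho) as (d & Hd & K); [apply Hrho|].
  exists (Rmin d 1). split; [apply Rmin_glb_lt; lra|]. intros z z' w Hw Hz.
  generalize (Rmin_l d 1), (Rmin_r d 1); intros. destruct (Rle_dec (Cmod z) (2 * Rabs r + 1)) as [Hr|Hr].
  - destruct (K z Hr) as (t & Ht & Hdt). destruct (Hrho t) as [_ Q].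
    assert (A : Cmod (G z w - G t w) < eps / 2) by (apply Q; [lra|assumption]).
    assert (B : Cmod (G z' w - G t w) < eps / 2).
    { apply Q; [|assumption]. generalize (Cmod_sub_triangle z' z t). lra. }
    generalize (Cmod_sub_triangle (G z' w) (G t w) (G z w)). rewrite (Cmod_sub_sym (G t w) (G z w)). lra.
  - assert (Hout : forall t, 2 * Rabs r < Cmod t -> G t w = RtoC 0).
    { intros t Ht. apply Hs; [assumption|]. intro Hk. apply ksq_mod in Hk. replace (t - 0)%C with t in Hk by cring.
      generalize (Rle_abs r). lra. }
    rewrite (Hout z), (Hout z'); [rewrite Cmod_subself; lra| |lra].
    generalize (Cmod_le_sub z z'). rewrite Cmod_sub_sym. lra.
Qed.

Lemma in_AD_moment m (K2 : Cn m -> Prop) (G : C -> Cn m -> C) M p N k : (forall z, in_AD K2 (G z)) -> equicont K2 G ->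
  (forall z w, K2 w -> Cmod (G z w) <= M) -> in_AD K2 (fun w => moment p N k (fun z => G z w)).
Proof.
  intros HA HG HM.
  apply (in_AD_ext m K2 (fun w => Pint (fun z => (dtent p N z * (z - p) ^ k) * G z w)%C)).
  { intros w _. unfold moment. apply Pint_ext. intro; cring. }
  apply (in_AD_integral m K2 _ (fst p - / 2 ^ N) (snd p - / 2 ^ N) (2 * / 2 ^ N)).
  - generalize (pow2_pos N); lra.
  - intro z. apply in_AD_scal, HA.
  - apply (equicont_mult m K2 G _ M); [assumption|assumption|]. apply acont_mult; [apply tent_test|apply acont_pow].
  - intros w _ z Hz. rewrite dtent_supp by assumption. cring.
Qed.

Lemma in_AD_lin3 m (K2 : Cn m -> Prop) (a b c : Cn m -> C) (x y z k : C) : in_AD K2 a -> in_AD K2 b -> in_AD K2 c ->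
  in_AD K2 (fun w => Cmult k (Cplus (Cplus (Cmult x (a w)) (Cmult y (b w))) (Cmult z (c w)))).
Proof. intros. apply in_AD_scal. repeat apply in_AD_plus; apply in_AD_scal; assumption. Qed.

Lemma in_AD_in_Obar_prod (m : nat) (K1 : Cn 1 -> Prop) (K2 : Cn m -> Prop) f :
  is_compact K1 -> is_compact K2 -> (forall f, in_AD K1 f -> in_Obar K1 f) -> (forall f, in_AD K2 f -> in_Obar K2 f) ->
  in_AD (prodK K1 K2) f -> in_Obar (prodK K1 K2) f.
Proof.
  intros HK1 HK2 H1 H2 Hf. pose proof (prodK_compact m K1 K2 HK1 HK2) as HK.
  (* The extension averages over points of S and requires one to exist. An empty product has the
     empty neighbourhood. *)
  destruct (classic (exists z, prodK K1 K2 z)) as [(z0 & Hz0)|Hempty].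
  2: { split; [apply Hf|]. intros eps He. exists (fun _ => False), (fun _ => RtoC 0). repeat split.
    - intros z [].
    - intros z Hz. apply Hempty. exists z; assumption.
    - intros z [].
    - intros z Hz. exfalso. apply Hempty. exists z; assumption. }
  set (S := slice K1). assert (Hs0 : S (z0 Fin.F1)) by apply Hz0.
  set (F := fun z w => f (fcons z w)).
  assert (HFK : forall z w, S z -> K2 w -> prodK K1 K2 (fcons z w)) by (intros z w Hz Hw; split; assumption).
  destruct (compact_bounded _ _ f HK (proj1 Hf)) as (M & HM & HfM).
  assert (HS : closedC S).
  { intros z Hz. apply (proj1 HK1). intros r Hr. destruct (Hz r Hr) as (s & Hs & Hsz). exists (fun _ => s). split; [assumption|].
    unfold vdist; simpl. apply Rmax_lub_lt; [exact Hsz|assumption]. }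
  destruct (dugundji_extension m K2 S (z0 Fin.F1) F M HS Hs0 HM) as (E & EF & EA & EM & EE).
  { intros z w Hz Hw. apply HfM, HFK; assumption. }
  { intros z eps Hz He. destruct (compact_uniform_continuity _ _ f eps HK (proj1 Hf) He) as (d & Hd & K).
    exists d. split; [assumption|]. intros z' Hz' Hd' w Hw. apply K; try (apply HFK; assumption).
    rewrite vdist_fcons, vdist_self. apply Rmax_lub_lt; assumption. }
  { intros z Hz. split.
    - intros w Hw eps He. destruct (proj1 Hf _ (HFK z w Hz Hw) eps He) as (d & Hd & K). exists d. split; [assumption|].
      intros w' Hw' Hd'. apply K; [apply HFK; assumption|]. rewrite vdist_fcons, Cmod_subself. apply Rmax_lub_lt; assumption.
    - intros c r phi Hr Hphi Hinj Hin. apply (proj2 Hf c r (fun t => fcons z (phi t)) Hr).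
      + intro i. apply (Fin.caseS' i).
        * intros t _. apply holo_dbar. exact (dbar_const z t).
        * intro j. exact (Hphi j).
      + intros t s Ht Hs E. apply Hinj; try assumption. intro i. apply (E (Fin.FS i)).
      + intros t Ht. apply HFK; [assumption|apply Hin, Ht]. }
  destruct HK1 as [HK1c [R0 HR0]].
  set (R1 := Rabs R0 + 1). assert (HR1 : 0 < R1) by (unfold R1; generalize (Rabs_pos R0); lra).
  assert (HSR : forall z, S z -> ksq (RtoC 0) R1 z).
  { intros z Hz. apply mod_ksq. replace (z - 0)%C with z by cring. specialize (HR0 _ Hz). simpl in HR0.
    change (Rmax (Cmod z) 0 <= R0) in HR0. unfold R1. generalize (Rmax_l (Cmod z) 0), (Rle_abs R0). lra. }
  (* The cutoff is 1 on K1 and makes the support compact, so that finitely many cells suffice. *)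
  set (Ft := fun z w => (cutoff (RtoC 0) R1 z * E z w)%C).
  assert (FtF : forall z w, S z -> Ft z w = f (fcons z w)).
  { intros z w Hz. unfold Ft. rewrite (EF z w Hz). destruct (cutoff_one (RtoC 0) R1 z HR1 (HSR z Hz)) as [-> _]. unfold F. cring. }
  assert (FtA : forall z, in_AD K2 (Ft z)) by (intro z; apply in_AD_scal, EA).
  assert (FtE : equicont K2 Ft).
  { apply (equicont_mult m K2 E _ M); [assumption|assumption|]. apply (test_acont _ _ (cutoff_test _ _ HR1)). }
  assert (FtM : forall z w, K2 w -> Cmod (Ft z w) <= M).
  { intros z w Hw. unfold Ft. rewrite Cmod_mult. rewrite <- (Rmult_1_l M).
    apply Rmult_le_compat; try apply Cmod_ge_0; [apply bump_mod, plateau_range|apply EM, Hw]. }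
  assert (FtS : forall z w, ~ ksq (RtoC 0) (2 * R1) z -> Ft z w = RtoC 0).
  { intros z w Hz. unfold Ft. destruct (cutoff_far (RtoC 0) R1 z HR1 Hz) as [-> _]. cring. }
  set (U := interiorC S).
  assert (FtH : forall w, K2 w -> holcont U (fun z => Ft z w)).
  { intros w Hw. split; [apply (equicont_acont m K2); assumption|]. intros z (r & Hr & HrS).
    apply (Cdiff1_ext_loc (fun z => f (fcons z w)) _ _ r); [assumption|intros t Ht; symmetry; apply FtF, HrS, Ht|].
    (* The A_D condition of f on the horizontal disc t -> (t, w). Inside K1 neither the extension
       nor the cutoff has changed f. *)
    apply (proj2 Hf z r (fun t => fcons t w) Hr).
    - intro i. apply (Fin.caseS' i).
      + intros t _. apply holo_dbar. exact (dbar_id t).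
      + intros j t _. apply holo_dbar. exact (dbar_const (w j) t).
    - intros t s _ _ Ets. apply (Ets Fin.F1).
    - intros t Ht. apply HFK; [apply HrS, Ht|assumption].
    - change (Cmod (z - z) < r). rewrite Cmod_subself; assumption. }
  assert (Hck : 0 < Cmod ckern) by (apply Cmod_gt_0, ckern_neq_0).
  pose proof Cdecay_pos as HCd.
  apply in_Obar_limit. intros eps He.
  (* The final error is Cdecay * 27 e * 64 / |ckern|: 27 from [local_finite_rank], 64 = 8 * 8 from
     the grid sum, and [ckern] from recovering f out of its pieces. *)
  set (e := eps * Cmod ckern / (Cdecay * 27 * 64)).
  assert (He' : 0 < e) by (apply Rdiv_lt_0_compat; nra).
  destruct (equicont_uniform m K2 Ft (2 * R1) e He' FtE) as (d & Hd & Hmod); [intros; apply FtS; assumption|].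
  (* A point of the cell is within 2 * 2^-N of the node, hence within the modulus of continuity
     d. *)
  destruct (pow2_small (d / 2)) as [N HN]; [lra|]. pose proof (pow2_pos N) as PN. set (s := / 2 ^ N) in *.
  destruct (nfloor_ex (2 * R1 / s)) as [n0 Hn0]; [apply Rlt_le, Rdiv_lt_0_compat; lra|].
  set (n := Datatypes.S n0).
  assert (Hn : 2 * R1 <= INR n * s).
  { apply Rmult_le_reg_r with (/ s); [apply Rinv_0_lt_compat, PN|]. rewrite (Rmult_assoc (INR n)), Rinv_r, Rmult_1_r by lra.
    unfold n. rewrite S_INR. unfold Rdiv in Hn0. lra. }
  set (L := (2 * n + 1)%nat).
  set (a := fun (i j : nat) (z : Cn (Datatypes.S m)) =>
    (/ ckern * vit (tent (node n N i j) N) (dtent (node n N i j) N) (fun t => Ft t (fun k => z (Fin.FS k))) (z Fin.F1))%C).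
  set (b := fun (i j : nat) (z : Cn (Datatypes.S m)) => / Cmod ckern * (Cdecay * (27 * e)) * decay (node n N i j) N (z Fin.F1)).
  assert (Hloc : forall i j, exists h, in_Obar (prodK K1 K2) h /\ forall z, prodK K1 K2 z -> Cmod (a i j z - h z) <= b i j z).
  { intros i j. set (p := node n N i j).
    destruct (local_finite_rank U p N) as (G1 & G2 & G3 & m1 & m2 & m3 & HG1 & HG2 & HG3 & HG).
    (* Normalized at the node, the function is bounded by e on the cell, and [vit_const] shows that
       its localization is unchanged. The node may lie off K1, where the extended family is still
       defined and in A_D. *)
    set (Fp := fun t w => (Ft t w + RtoC (-1) * Ft p w)%C).
    assert (FpA : forall t, in_AD K2 (Fp t)) by (intro t; apply in_AD_plus; [apply FtA|apply in_AD_scal, FtA]).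
    assert (FpE : equicont K2 Fp).
    { intros t ep Hep. destruct (FtE t ep Hep) as (dd & Hdd & K). exists dd. split; [assumption|]. intros t' Ht' w Hw.
      unfold Fp. replace (_ - _)%C with (Ft t' w - Ft t w)%C by cring. apply K; assumption. }
    assert (FpM : forall t w, K2 w -> Cmod (Fp t w) <= 2 * M).
    { intros t w Hw. unfold Fp. eapply Rle_trans; [apply Cmod_triangle|]. rewrite Cmod_mult, Cmod_R.
      rewrite Rabs_left by lra. generalize (FtM t w Hw), (FtM p w Hw). lra. }
    assert (HT : forall G, holcont U G -> in_Obar K1 (fun y => vit (tent p N) (dtent p N) G (y Fin.F1))).
    { intros G [HGa HGh]. apply H1. apply holcont_in_AD.
      - apply vit_acont; [apply tent_test|assumption].
      - intros z Hz. apply (vit_holo _ _ G U); [apply tent_test|assumption|apply openC_interior|assumption|assumption]. }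
    set (x := fun (mm : nat -> C) (w : Cn m) => Cmult (/ ckern) (Cplus (Cplus (Cmult (mm 0%nat) (moment p N 0 (fun t => Fp t w)))
       (Cmult (mm 1%nat) (moment p N 1 (fun t => Fp t w)))) (Cmult (mm 2%nat) (moment p N 2 (fun t => Fp t w))))).
    assert (Hx : forall mm, in_Obar K2 (x mm)).
    { intro mm. apply H2. apply in_AD_lin3; apply (in_AD_moment m K2 Fp (2 * M)); assumption. }
    set (T := fun (G : C -> C) (y : Cn 1) => vit (tent p N) (dtent p N) G (y Fin.F1)).
    set (h := fun z : Cn (Datatypes.S m) => Cplus (Cplus (Cmult (T G1 (fun _ => z Fin.F1)) (x m1 (fun k => z (Fin.FS k))))
       (Cmult (T G2 (fun _ => z Fin.F1)) (x m2 (fun k => z (Fin.FS k)))))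
       (Cmult (T G3 (fun _ => z Fin.F1)) (x m3 (fun k => z (Fin.FS k))))).
    exists h. split.
    { repeat apply in_Obar_plus; apply (in_Obar_tensor m K1 K2); try (split; [assumption|exists R0; assumption]); try assumption; try (apply HT; assumption); apply Hx. }
    intros z [Hz1 Hz2]. set (w := fun k => z (Fin.FS k)) in *.
    assert (HFp : holcont U (fun t => Fp t w)).
    { unfold Fp. apply (holcont_comb U (fun t => Ft t w) (fun _ => Ft p w)); [apply FtH, Hz2|].
      split; [apply acont_const|]. intros t _. apply holo_dbar, dbar_const. }
    specialize (HG (fun t => Fp t w) e HFp He').
    assert (HFpe : forall t, ksq p (/ 2 ^ N) t -> Cmod (Fp t w) <= e).
    { intros t Ht. apply ksq_mod in Ht. unfold Fp. replace (_ + _)%C with (Ft t w - Ft p w)%C by cring.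
      apply Hmod; [assumption|]. fold s in Ht. lra. }
    specialize (HG HFpe (z Fin.F1)). cbv zeta in HG.
    assert (EV : vit (tent p N) (dtent p N) (fun t => Fp t w) (z Fin.F1) = vit (tent p N) (dtent p N) (fun t => Ft t w) (z Fin.F1)).
    { unfold Fp. rewrite (vit_plus _ _ (fun t => Ft t w) (fun _ => RtoC (-1) * Ft p w)%C); [|apply tent_test|apply FtH, Hz2|apply acont_const].
      rewrite vit_const by apply tent_test. cring. }
    rewrite EV in HG. unfold a, b. fold p. fold w.
    replace (_ - h z)%C with (/ ckern * (vit (tent p N) (dtent p N) (fun t => Ft t w) (z Fin.F1) -
      ((m1 0%nat * moment p N 0 (fun t => Fp t w) + m1 1%nat * moment p N 1 (fun t => Fp t w) + m1 2%nat * moment p N 2 (fun t => Fp t w)) * vit (tent p N) (dtent p N) G1 (z Fin.F1) +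
       (m2 0%nat * moment p N 0 (fun t => Fp t w) + m2 1%nat * moment p N 1 (fun t => Fp t w) + m2 2%nat * moment p N 2 (fun t => Fp t w)) * vit (tent p N) (dtent p N) G2 (z Fin.F1) +
       (m3 0%nat * moment p N 0 (fun t => Fp t w) + m3 1%nat * moment p N 1 (fun t => Fp t w) + m3 2%nat * moment p N 2 (fun t => Fp t w)) * vit (tent p N) (dtent p N) G3 (z Fin.F1))))%C.
    2: { unfold h, x, T. fold w. ring. }
    rewrite Cmod_mult, Cmod_inv by apply ckern_neq_0. rewrite (Rmult_assoc (/ Cmod ckern)).
    apply Rmult_le_compat_l; [left; apply Rinv_0_lt_compat, Hck|]. exact HG. }
  destruct (in_Obar_csum _ (prodK K1 K2) L (fun i z => csum L (fun j => a i j z)) (fun i z => rsum L (fun j => b i j z))) as (h & Hh & Hb).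
  { intro i. apply (in_Obar_csum _ (prodK K1 K2) L (a i) (b i)). intro j. apply Hloc. }
  exists h. split; [assumption|]. intros z [Hz1 Hz2]. set (w := fun k => z (Fin.FS k)).
  specialize (Hb z (conj Hz1 Hz2)).
  assert (Ea : csum L (fun i => csum L (fun j => a i j z)) = f z).
  { unfold a. fold w.
    rewrite (csum_ext L _ (fun i => / ckern * csum L (fun j => vit (tent (node n N i j) N) (dtent (node n N i j) N) (fun t => Ft t w) (z Fin.F1)))%C).
    - rewrite csum_scal. unfold L. rewrite (vit_decomposition n N (fun t => Ft t w)).
      + rewrite (FtF (z Fin.F1) w Hz1). unfold w. rewrite fcons_eta. field. apply ckern_neq_0.
      + apply FtH, Hz2.
      + intro t. destruct (classic (ksq (RtoC 0) (2 * R1) t)) as [Ht|Ht]; [right|left; apply FtS, Ht].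
        destruct Ht as [T1 T2]. simpl in T1, T2. rewrite Rminus_0_r in T1, T2. fold s. lra.
    - intros i _. rewrite csum_scal. reflexivity. }
  cbv beta in Hb. rewrite Ea in Hb. eapply Rle_trans; [exact Hb|].
  unfold b. rewrite (rsum_ext L _ (fun i => / Cmod ckern * (Cdecay * (27 * e)) * rsum L (fun j => decay (node n N i j) N (z Fin.F1)))).
  2: { intro i. apply rsum_scal. }
  rewrite rsum_scal.
  apply Rle_trans with (/ Cmod ckern * (Cdecay * (27 * e)) * 64).
  - apply Rmult_le_compat_l; [|apply rsum_decay]. apply Rmult_le_pos; [left; apply Rinv_0_lt_compat, Hck|nra].
  - right. unfold e. field. lra.
Qed.

Theorem mainTheorem13 (m : nat) (K1 : Cn 1 -> Prop) (K2 : Cn m -> Prop) :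
  is_compact K1 -> is_compact K2 ->
  (forall f, in_Obar K1 f <-> in_AD K1 f) ->
  (forall f, in_Obar K2 f <-> in_AD K2 f) ->
  forall f, in_Obar (prodK K1 K2) f <-> in_AD (prodK K1 K2) f.
Proof.
  intros HK1 HK2 H1 H2 f. split; [apply in_Obar_in_AD|].
  apply in_AD_in_Obar_prod; try assumption; [intros g; apply H1|intros g; apply H2].
Qed.
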